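(* Let $G$ be a finite-dimensional real vector space partially ordered by a closed and pointed convex cone $C\subset G$. Then the weakly $h^*$-monotone $\mathbb{R}^d$-valuations $\varphi:\mathcal{P}(\mathbb{R}^d)\to G$ are exactly the maps $c_1\chi+c_2\mathrm{vol}_d$ with $c_1,c_2\in C$, and $(c_1,c_2)\mapsto c_1\chi+c_2\mathrm{vol}_d$ is an isomorphism from $C\times C$ onto the cone of weakly $h^*$-monotone $\mathbb{R}^d$-valuations into $G$.
   Context: $\mathcal{P}(\mathbb{R}^d)$ is the set of all convex polytopes in $\mathbb{R}^d$ (including $\emptyset$); $\chi$ is the Euler characteristic ($\chi(P)=1$ for $P\ne\emptyset$, $\chi(\emptyset)=0$), $\mathrm{vol}_d$ the $d$-dimensional volume. The order is $x\preceq y$ iff $y-x\in C$. An $\mathbb{R}^d$-valuation is a map $\varphi:\mathcal{P}(\mathbb{R}^d)\to G$ with $\varphi(\emptyset)=0$, $\varphi(P\cup Q)+\varphi(P\cap Q)=\varphi(P)+\varphi(Q)$ whenever $P,Q,P\cup Q$ are polytopes, and $\varphi(t+P)=\varphi(P)$ for $t\in\mathbb{R}^d$. For an $r$-dimensional polytope $P$ there are unique $h_0,\dots,h_r\in G$ with $\varphi(nP)=\sum_{i=0}^rh_i\binom{n+r-i}{r}$ for all $n\in\mathbb{Z}_{\ge0}$; $h^\varphi_i(P)=h_i$ for $i\le r$ and $0$ for $r<i\le d$. $\varphi$ is weakly $h^*$-monotone if $\varphi(\{0\})\succeq0$ and $h^\varphi_i(P)\preceq h^\varphi_i(Q)$ for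 all $0\le i\le d$ and all polytopes $P\subseteq Q$ with $\dim P=\dim Q$. *)

(* Defs.v *)
From HB Require Import structures.
From mathcomp Require Import all_boot all_order all_algebra.
From mathcomp Require Import all_classical all_reals all_analysis.

Set Implicit Arguments.
Unset Strict Implicit.
Unset Printing Implicit Defensive.

Import Order.TTheory GRing.Theory Num.Theory.
Import numFieldNormedType.Exports.
Import VectorInternalTheory.

Local Open Scope classical_set_scope.
Local Open Scope ring_scope.

(** Cones *)

Definition convex_cone (R : realType) (V : lmodType R) (C : set V) : Prop :=
  [/\ C 0,
      forall x y, C x -> C y -> C (x + y) &
      forall (a : R) x, 0 <= a -> C x -> C (a *: x)].

Definition pointed_cone (R : realType) (V : lmodType R) (C : set V) : Prop :=
  C `&` [set x | C (- x)] = [set 0].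

(* A finite-dimensional real vector space has a unique Hausdorff vector space
   topology: it is the one transported from 'rV_n along any linear isomorphism,
   here the coordinate isomorphism [r2v : 'rV[R]_(dim V) -> V]. *)
Definition vect_closed (R : realType) (V : vectType R) (C : set V) : Prop :=
  closed ((r2v : 'rV[R]_(dim V) -> V) @^-1` C).

Definition cone_le (R : realType) (V : lmodType R) (C : set V) (x y : V) : Prop :=
  C (y - x).

Definition cone_isomorphism (R : realType) (U V : lmodType R)
    (C : set U) (D : set V) (f : U -> V) : Prop :=
  [/\ set_bij C D f,
      forall x y, C x -> C y -> f (x + y) = f x + f y &
      forall (a : R) x, 0 <= a -> C x -> f (a *: x) = a *: f x].

(** Polytopes *)

Section Polytope.
Variables (R : realType) (d : nat).

Definition conv_hull n (p : 'I_n -> 'rV[R]_d) : set 'rV[R]_d :=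
  [set x | exists w : 'I_n -> R,
     [/\ forall i, 0 <= w i, \sum_i w i = 1 & x = \sum_i w i *: p i]].

(* [n = 0] yields the empty polytope. *)
Definition is_polytope (P : set 'rV[R]_d) : Prop :=
  exists n (p : 'I_n -> 'rV[R]_d), P = conv_hull p.

Record polytope := Polytope {
  pset :> set 'rV[R]_d;
  psetP : is_polytope pset }.

Lemma is_polytope0 : is_polytope set0.
Proof.
exists 0%N, (fun=> 0); apply/seteqP; split=> x //= -[w [_ + _]].
by rewrite big_ord0 => /esym/eqP; rewrite oner_eq0.
Qed.

Lemma is_polytope1 (x : 'rV[R]_d) : is_polytope [set x].
Proof.
exists 1%N, (fun=> x); apply/seteqP; split=> y /=.
  move=> ->; exists (fun=> 1); split=> //; first by rewrite big_ord1.
  by rewrite big_ord1 scale1r.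
by move=> [w [_]]; rewrite !big_ord1 => -> ->; rewrite scale1r.
Qed.

Lemma is_polytope_translate (t : 'rV[R]_d) (P : set 'rV[R]_d) :
  is_polytope P -> is_polytope [set t + x | x in P].
Proof.
move=> [n [p ->]]; exists n, (fun i => t + p i).
have E (w : 'I_n -> R) : \sum_i w i = 1 ->
    \sum_i w i *: (t + p i) = t + \sum_i w i *: p i.
  move=> w1; under eq_bigr do rewrite scalerDr.
  by rewrite big_split /= -scaler_suml w1 scale1r.
apply/seteqP; split=> x /=.
  by move=> [_ [w [w0 w1 ->]] <-]; exists w; split; rewrite ?E.
move=> [w [w0 w1 ->]]; exists (\sum_i w i *: p i); last by rewrite E.
by exists w.
Qed.

Lemma is_polytope_dilate (a : R) (P : set 'rV[R]_d) :
  is_polytope P -> is_polytope [set a *: x | x in P].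
Proof.
move=> [n [p ->]]; exists n, (fun i => a *: p i).
have E (w : 'I_n -> R) : \sum_i w i *: (a *: p i) = a *: \sum_i w i *: p i.
  by rewrite scaler_sumr; apply: eq_bigr => i _; rewrite !scalerA mulrC.
apply/seteqP; split=> x /=.
  by move=> [_ [w [w0 w1 ->]] <-]; exists w; split; rewrite ?E.
move=> [w [w0 w1 ->]]; exists (\sum_i w i *: p i); last by rewrite E.
by exists w.
Qed.

Definition poly0 : polytope := Polytope is_polytope0.
Definition poly1 (x : 'rV[R]_d) : polytope := Polytope (is_polytope1 x).
Definition translate (t : 'rV[R]_d) (P : polytope) : polytope :=
  Polytope (is_polytope_translate t (psetP P)).
Definition dilate (n : nat) (P : polytope) : polytope :=
  Polytope (is_polytope_dilate n%:R (psetP P)).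

(* The dimension of the affine hull of a nonempty [P]: the largest [r] such
   that [P] contains [r.+1] affinely independent points
   [x, x + row 0 M, ..., x + row r.-1 M]; the empty set gets the junk
   value 0. *)
Definition pdim (P : set 'rV[R]_d) : nat :=
  \big[maxn/0%N]_(r < d.+1 | `[< exists (x : 'rV[R]_d) (M : 'M[R]_(r, d)),
    [/\ P x, forall i, P (x + row i M) & row_free M] >]) r.

Definition euler (P : polytope) : R := (`[< P !=set0 >])%:R.

End Polytope.

(* The d-dimensional Lebesgue measure as the d-fold product of the Lebesgue
   measure on the line: the recursive case is what
   [product_measure1 lebesgue_measure _] unfolds to, the first coordinate being
   separated from the remaining ones; the measure on the one-point space
   'rV_0 is the unit mass. *)
Fixpoint lebesgue_rV (R : realType) (d : nat) : set 'rV[R]_d -> \bar R :=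
  match d with
  | 0 => fun A => (\1_A (0 : 'rV[R]_0))%:E
  | d'.+1 => fun A => (\int[lebesgue_measure]_(x in [set: R])
      lebesgue_rV [set v : 'rV[R]_d' | A (row_mx (x%:M : 'rV[R]_1) v)])%E
  end.

Definition vol (R : realType) (d : nat) (P : polytope R d) : R :=
  fine (lebesgue_rV P).

(** Valuations *)

Section Valuation.
Variables (R : realType) (d : nat) (G : vectType R).
Implicit Types (phi : polytope R d -> G) (P Q : polytope R d) (C : set G).

Definition valuation phi : Prop :=
  [/\ phi (poly0 R d) = 0,
      forall P Q U I : polytope R d,
        U = P `|` Q :> set _ -> I = P `&` Q :> set _ ->
        phi U + phi I = phi P + phi Q &
      forall t P, phi (translate t P) = phi P].

Definition is_hvector phi P (h : {ffun 'I_d.+1 -> G}) : Prop :=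
  let r := pdim P in
  (forall n : nat, phi (dilate n P) =
     \sum_(i < d.+1 | (i <= r)%N) h i *+ 'C(n + r - i, r)) /\
  (forall i : 'I_d.+1, (r < i)%N -> h i = 0).

(* The zero default is irrelevant for a valuation [phi] and [P] nonempty: the
   vector then exists and is unique. *)
Definition hvector phi P : {ffun 'I_d.+1 -> G} :=
  xget [ffun=> 0] [set h | is_hvector phi P h].

(* [P] is taken nonempty because [pdim] does not tell the dimension of the empty
   polytope (-1) from 0; the only pair thereby left out is P = Q = set0. *)
Definition weakly_hmonotone C phi : Prop :=
  cone_le C 0 (phi (poly1 0)) /\
  forall P Q, P !=set0 -> P `<=` Q -> pdim P = pdim Q ->
    forall i : 'I_d.+1, cone_le C (hvector phi P i) (hvector phi Q i).

Definition weakly_hmonotone_valuations C : set (polytope R d -> G) :=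
  [set phi | valuation phi /\ weakly_hmonotone C phi].

Definition euler_vol (c : G * G) : polytope R d -> G :=
  fun P => euler P *: c.1 + vol P *: c.2.

End Valuation.

Arguments weakly_hmonotone_valuations {R} d {G} C.
Arguments euler_vol {R} d {G} c.

(* Main.v *)
Require Import Defs.
From HB Require Import structures.
From mathcomp Require Import all_boot all_order all_algebra.
From mathcomp Require Import all_classical all_reals all_analysis.
From mathcomp Require Import measurable_realfun.
From mathcomp Require Import ring lra zify.

Set Implicit Arguments.
Unset Strict Implicit.
Unset Printing Implicit Defensive.

Import Order.TTheory GRing.Theory Num.Theory.
Import numFieldNormedType.Exports.
Import VectorInternalTheory.

Local Open Scope classical_set_scope.
Local Open Scope ring_scope.

(* Subtracting [phi {0}] times the Euler characteristic, we may assume that the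
   monotone valuation [mu] vanishes on points, so that [h_1 P = mu P] and [mu]
   itself is monotone among polytopes of equal dimension.  By induction on
   r < d, [mu] vanishes in dimension r.  If it vanishes below r, it is a simple
   valuation on r-dimensional subspaces, nonnegative on simplices, hence on all
   polytopes by triangulation, and a simplex is dominated by a parallelepiped.
   For a prism of height e over an r-dimensional parallelepiped B the value at
   the n-th dilate is a n^(r+1) + b n^r with top h-entry a - b, where a tends to
   0 and b to [mu B] as e tends to 0; comparing the prisms over B and 2 B gives
   [mu B <= 0], hence [mu B = 0].  In dimension d, [mu] is thus a nonnegative
   simple translation-invariant valuation, and covering a polytope by small
   cubes shows that it is at most the volume times its value on the unit cube;
   the difference is again such a valuation and vanishes on large cubes. *)

(** * Convex hulls *)

Section Hull.
Variable R : realType.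
Implicit Types (d e : nat).

Definition hull d (I : finType) (D : pred I) (p : I -> 'rV[R]_d) : set 'rV[R]_d :=
  [set x | exists w : I -> R,
     [/\ forall i, 0 <= w i, forall i, ~~ D i -> w i = 0, \sum_i w i = 1
       & x = \sum_i w i *: p i]].

Lemma sum_fibre (V : lmodType R) (I J : finType) (f : J -> I) (v : J -> R)
    (p : I -> V) :
  \sum_i (\sum_(j | f j == i) v j) *: p i = \sum_j v j *: p (f j).
Proof.
rewrite [RHS](partition_big f xpredT)//=; apply: eq_bigr => i _.
by rewrite scaler_suml; apply: eq_bigr => j /eqP ->.
Qed.

Lemma sum_fibre1 (I J : finType) (f : J -> I) (v : J -> R) :
  \sum_i (\sum_(j | f j == i) v j) = \sum_j v j.
Proof. by rewrite [RHS](partition_big f xpredT). Qed.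

Lemma hull_reindex d (I J : finType) (D : pred I) (E : pred J) (f : J -> I)
    (p : I -> 'rV[R]_d) (q : J -> 'rV[R]_d) :
  (forall j, E j -> D (f j) /\ q j = p (f j)) -> hull E q `<=` hull D p.
Proof.
move=> ED x [w [w0 wE w1 ->]]; exists (fun i => \sum_(j | f j == i) w j); split.
- by move=> i; apply: sumr_ge0.
- move=> i nDi; apply: big1 => j /eqP fj; apply: wE; apply/negP => Ej.
  by case: (ED j Ej) => Dfj _; rewrite -fj Dfj in nDi.
- by rewrite sum_fibre1.
- rewrite sum_fibre; apply: eq_bigr => j _.
  have [Ej|nEj] := boolP (E j); first by case: (ED j Ej) => _ ->.
  by rewrite wE// !scale0r.
Qed.

Lemma conv_hullE d n (p : 'I_n -> 'rV[R]_d) : conv_hull p = hull xpredT p.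
Proof.
by apply/seteqP; split => x [w]; [move=> [? ? ?]|move=> [? _ ? ?]]; exists w.
Qed.

Lemma hull_enum d (I : finType) (D : pred I) (p : I -> 'rV[R]_d) :
  hull D p = hull xpredT (fun k : 'I_#|D| => p (enum_val k)).
Proof.
apply/seteqP; split; last first.
  by apply: (@hull_reindex _ _ _ _ _ enum_val) => k _; split => //; exact: enum_valP.
have [->|/set0P[x0 [w0 [w00 w0D w01 _]]]] := eqVneq (hull D p) set0; first by [].
have [i0 Di0] : exists i, D i.
  apply: contrapT => nD; move: w01; rewrite big1 => [/esym/eqP|i _].
    by rewrite oner_eq0.
  by apply: w0D; apply/negP => Di; apply: nD; exists i.
apply: (@hull_reindex _ _ _ _ _ (enum_rank_in (A:=D) (x0:=i0) Di0)) => j Dj.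
by split=> //; rewrite enum_rankK_in.
Qed.

Lemma is_polytope_hull d (I : finType) (D : pred I) (p : I -> 'rV[R]_d) :
  is_polytope (hull D p).
Proof. by exists #|D|, (fun k => p (enum_val k)); rewrite conv_hullE hull_enum. Qed.

Lemma is_polytopeP d (A : set 'rV[R]_d) :
  is_polytope A <-> exists n (p : 'I_n -> 'rV[R]_d), A = hull xpredT p.
Proof.
by split=> -[n [p ->]]; exists n, p; rewrite conv_hullE.
Qed.

Lemma hull_pt d (I : finType) (D : pred I) (p : I -> 'rV[R]_d) i :
  D i -> hull D p (p i).
Proof.
move=> Di; exists (fun j => (j == i)%:R); split.
- by move=> j; rewrite ler0n.
- by move=> j; apply: contraNeq; rewrite pnatr_eq0 eqb0 negbK => /eqP ->.
- by rewrite (bigD1 i)//= eqxx big1 ?addr0// => j /negbTE ->.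
- rewrite (bigD1 i)//= eqxx scale1r big1 ?addr0// => j /negbTE ->.
  by rewrite scale0r.
Qed.

Lemma hull_min d (I J : finType) (D : pred I) (E : pred J) (p : I -> 'rV[R]_d) q :
  (forall j, E j -> hull D p (q j)) -> hull E q `<=` hull D p.
Proof.
move=> Eq x [w [w0 wE w1 ->]].
have [v vP] : {v : J -> I -> R & forall j, E j ->
    [/\ forall i, 0 <= v j i, forall i, ~~ D i -> v j i = 0, \sum_i v j i = 1
       & q j = \sum_i v j i *: p i]}.
  apply: (@choice _ _ (fun j v => E j -> [/\ forall i, 0 <= v i,
    forall i, ~~ D i -> v i = 0, \sum_i v i = 1 & q j = \sum_i v i *: p i])) => j.
  have [/Eq[v vP]|nEj] := boolP (E j); first by exists v.
  by exists (fun=> 0).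
exists (fun i => \sum_j w j * v j i); split.
- move=> i; apply: sumr_ge0 => j _; have [/vP[v0 _ _ _]|/wE->] := boolP (E j).
    by rewrite mulr_ge0.
  by rewrite mul0r.
- move=> i nDi; apply: big1 => j _; have [/vP[_ -> // _ _]|/wE->] := boolP (E j).
    by rewrite mulr0.
  by rewrite mul0r.
- rewrite exchange_big/= -w1; apply: eq_bigr => j _; rewrite -mulr_sumr.
  have [/vP[_ _ -> _]|/wE->] := boolP (E j); first by rewrite mulr1.
  by rewrite mul0r.
- under [RHS]eq_bigr do rewrite scaler_suml.
  rewrite exchange_big/=; apply: eq_bigr => j _.
  under [RHS]eq_bigr do rewrite -scalerA.
  rewrite -scaler_sumr.
  have [/vP[_ _ _ <-]|/wE->//] := boolP (E j); first by [].
  by rewrite !scale0r.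
Qed.

Lemma hull_convex2 d (I : finType) (D : pred I) (p : I -> 'rV[R]_d) x y t :
  hull D p x -> hull D p y -> 0 <= t -> t <= 1 ->
  hull D p ((1 - t) *: x + t *: y).
Proof.
move=> hx hy t0 t1.
apply: (@hull_min _ _ _ D xpredT p (fun b : bool => if b then x else y)).
  by move=> [].
exists (fun b : bool => if b then 1 - t else t).
split=> //; rewrite ?big_bool/= ?subrK//.
by move=> []//; rewrite subr_ge0.
Qed.

Definition affim d e (t : 'rV[R]_e) (M : 'M[R]_(d, e)) (A : set 'rV[R]_d) :=
  [set t + x *m M | x in A].

Lemma affim_hull d e (t : 'rV[R]_e) (M : 'M[R]_(d, e)) (I : finType) (D : pred I)
    (p : I -> 'rV[R]_d) :
  affim t M (hull D p) = hull D (fun i => t + p i *m M).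
Proof.
have E (w : I -> R) : \sum_i w i = 1 ->
    \sum_i w i *: (t + p i *m M) = t + (\sum_i w i *: p i) *m M.
  move=> w1; under eq_bigr do rewrite scalerDr.
  rewrite big_split /= -scaler_suml w1 scale1r mulmx_suml.
  by congr (_ + _); apply: eq_bigr => i _; rewrite scalemxAl.
apply/seteqP; split=> x /=.
  by move=> [_ [w [w0 wD w1 ->]] <-]; exists w; split; rewrite ?E.
move=> [w [w0 wD w1 ->]]; exists (\sum_i w i *: p i); last by rewrite E.
by exists w.
Qed.

Lemma is_polytope_affim d e (t : 'rV[R]_e) (M : 'M[R]_(d, e)) A :
  is_polytope A -> is_polytope (affim t M A).
Proof.
by move=> /is_polytopeP[n [p ->]]; rewrite affim_hull; exact: is_polytope_hull.
Qed.

Definition mink_sum d (A B : set 'rV[R]_d) : set 'rV[R]_d :=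
  [set z | exists x y, [/\ A x, B y & z = x + y]].

Lemma is_polytope_sum d (A B : set 'rV[R]_d) :
  is_polytope A -> is_polytope B -> is_polytope (mink_sum A B).
Proof.
move=> /is_polytopeP[n [p ->]] /is_polytopeP[m [q ->]].
suff -> : mink_sum (hull xpredT p) (hull xpredT q) =
    hull xpredT (fun ij : 'I_n * 'I_m => p ij.1 + q ij.2).
  exact: is_polytope_hull.
apply/seteqP; split=> z.
- move=> [_ [_ [[v [v0 _ v1 ->]] [w [w0 _ w1 ->]] ->]]].
  exists (fun ij => v ij.1 * w ij.2); split => //.
  + by move=> ij; rewrite mulr_ge0.
  + rewrite -(pair_bigA _ (fun i j => v i * w j))/=.
    by under eq_bigr do rewrite -mulr_sumr w1 mulr1.
  + rewrite -(pair_bigA _ (fun i j => (v i * w j) *: (p i + q j)))/=.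
    under [RHS]eq_bigr do under eq_bigr do rewrite scalerDr.
    under [RHS]eq_bigr do rewrite big_split/=.
    rewrite big_split/=; congr (_ + _).
      by apply: eq_bigr => i _; rewrite -scaler_suml -mulr_sumr w1 mulr1.
    rewrite exchange_big/=; apply: eq_bigr => j _.
    by rewrite -scaler_suml -mulr_suml v1 mul1r.
- move=> [w [w0 _ w1 ->]].
  exists (\sum_ij w ij *: p ij.1), (\sum_ij w ij *: q ij.2); split.
  + exists (fun i => \sum_(ij : 'I_n * 'I_m | ij.1 == i) w ij).
    by split=> //; [move=> i; exact: sumr_ge0|rewrite sum_fibre1|rewrite sum_fibre].
  + exists (fun j => \sum_(ij : 'I_n * 'I_m | ij.2 == j) w ij).
    by split=> //; [move=> i; exact: sumr_ge0|rewrite sum_fibre1|rewrite sum_fibre].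
  + by rewrite -big_split/=; apply: eq_bigr => ij _; rewrite scalerDr.
Qed.

Definition aff d (a : 'cV[R]_d) (b : R) (x : 'rV[R]_d) : R := (x *m a) 0 0 + b.

Lemma aff_sum d (a : 'cV[R]_d) b (I : finType) (w : I -> R) (p : I -> 'rV[R]_d) :
  \sum_i w i = 1 -> aff a b (\sum_i w i *: p i) = \sum_i w i * aff a b (p i).
Proof.
move=> w1; rewrite /aff; under [RHS]eq_bigr do rewrite mulrDr.
rewrite big_split/= -mulr_suml w1 mul1r mulmx_suml summxE; congr (_ + _).
by apply: eq_bigr => i _; rewrite -scalemxAl mxE.
Qed.

Definition halfspace d (a : 'cV[R]_d) (b : R) : set 'rV[R]_d :=
  [set x | 0 <= aff a b x].

Definition hyperplane d (a : 'cV[R]_d) (b : R) : set 'rV[R]_d :=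
  [set x | aff a b x = 0].

(* The off-diagonal generators are the points where the segments between two of
   the [p i] cross the boundary. *)
Lemma hull_halfspace d (a : 'cV[R]_d) b (I : finType) (p : I -> 'rV[R]_d) :
  hull xpredT p `&` halfspace a b =
  hull (fun ij : I * I => (0 <= aff a b (p ij.1)) &&
                          ((aff a b (p ij.2) < 0) || (ij.1 == ij.2)))
       (fun ij => if ij.1 == ij.2 then p ij.1 else
         (aff a b (p ij.1) - aff a b (p ij.2))^-1 *:
         (aff a b (p ij.1) *: p ij.2 - aff a b (p ij.2) *: p ij.1)).
Proof.
pose l i := aff a b (p i).
apply/seteqP; split => x.
- move=> [[w [w0 _ w1 xE]]]; rewrite /halfspace/= xE aff_sum// => lx.
  pose A := \sum_(i | 0 <= l i) w i * l i.
  pose B := \sum_(i | l i < 0) w i * - l i.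
  have A0 : 0 <= A by apply: sumr_ge0 => i li; rewrite mulr_ge0.
  have B0 : 0 <= B.
    by apply: sumr_ge0 => i li; rewrite mulr_ge0// oppr_ge0 ltW.
  have BA : B <= A.
    move: lx; rewrite (bigID (fun i => 0 <= l i))/= -/A.
    rewrite [X in _ + X](_ : _ = - B) ?subr_ge0// /B -sumrN.
    by apply: eq_big => i; rewrite ?ltNge// => _; rewrite mulrN opprK.
  pose t := if A == 0 then 0 else A^-1.
  have t0 : 0 <= t by rewrite /t; case: ifP => // _; rewrite invr_ge0.
  have tA i : l i < 0 -> w i * (t * A) = w i.
    move=> li; rewrite /t; case: eqVneq => [A00|A00]; last by rewrite mulVf ?mulr1.
    move: BA; rewrite A00 => BA; have {BA} /eqP : B = 0 by apply/le_anti; rewrite BA B0.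
    rewrite psumr_eq0/=; last by move=> j lj; rewrite mulr_ge0// oppr_ge0 ltW.
    move=> /allP/(_ i); rewrite mem_index_enum li => /(_ isT)/=.
    by rewrite mulf_eq0 oppr_eq0 (lt_eqF li) orbF => /eqP ->; rewrite mul0r.
  have tB : t * B <= 1.
    rewrite /t; case: eqVneq => [_|A00]; first by rewrite mul0r ler01.
    by rewrite mulrC ler_pdivrMr ?mul1r// lt_def A00.
  pose c ij := w ij.1 * w ij.2 * (l ij.1 - l ij.2) * t.
  pose u ij := if ~~ (0 <= l ij.1) then 0 else
               if ij.1 == ij.2 then w ij.1 * (1 - t * B) else
               if l ij.2 < 0 then c ij else 0.
  have split_sum (V : lmodType R) (q : I -> V) :
      \sum_ij u ij *: (if ij.1 == ij.2 then q ij.1 else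
        (l ij.1 - l ij.2)^-1 *: (l ij.1 *: q ij.2 - l ij.2 *: q ij.1)) =
      \sum_i w i *: q i.
    rewrite -(pair_bigA _ (fun i j => u (i, j) *: (if i == j then q i else
        (l i - l j)^-1 *: (l i *: q j - l j *: q i))))/=.
    rewrite (bigID (fun i => 0 <= l i))/= [X in _ + X]big1 ?addr0; last first.
      by move=> i nli; apply: big1 => j _; rewrite /u/= nli scale0r.
    have E i : 0 <= l i -> \sum_j u (i, j) *: (if i == j then q i else
        (l i - l j)^-1 *: (l i *: q j - l j *: q i)) =
        (w i *: q i - (w i * (t * B)) *: q i) +
        (\sum_(j | l j < 0) (w i * w j * t) *: (l i *: q j - l j *: q i)).
      move=> li; rewrite (bigD1 i)//= eqxx; congr (_ + _).
        by rewrite /u/= li/= eqxx -scalerBl mulrBr mulr1.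
      rewrite (bigID (fun j => l j < 0))/= [X in _ + X]big1 ?addr0; last first.
        move=> j /andP[ji lj]; rewrite /u/= li/= eq_sym (negbTE ji) (negbTE lj).
        by rewrite scale0r.
      apply: eq_big => j.
        by rewrite andb_idl// => lj; apply: contraTneq lj => ->; rewrite -leNgt.
      move=> /andP[ji lj]; rewrite /u/= li/= eq_sym (negbTE ji) lj scalerA /c/=.
      congr (_ *: _); field.
      by rewrite subr_eq0 gt_eqF// (lt_le_trans lj).
    under eq_bigr do rewrite E//.
    rewrite big_split/= sumrB/=.
    have -> : \sum_(i | 0 <= l i) \sum_(j | l j < 0)
        (w i * w j * t) *: (l i *: q j - l j *: q i) =
        \sum_(j | l j < 0) (w j * (t * A)) *: q j +
        \sum_(i | 0 <= l i) (w i * (t * B)) *: q i.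
      have H (i j : I) : (w i * w j * t) *: (l i *: q j - l j *: q i) =
         (w j * t * (w i * l i)) *: q j + (w i * t * (w j * - l j)) *: q i.
        rewrite scalerBr !scalerA -scaleNr; congr (_ *: _ + _ *: _); ring.
      under eq_bigr do under eq_bigr do rewrite H.
      under eq_bigr do rewrite big_split/=.
      rewrite big_split/= exchange_big/=; congr (_ + _).
        by apply: eq_bigr => j _; rewrite -scaler_suml -mulr_sumr mulrA.
      by apply: eq_bigr => i _; rewrite -scaler_suml -mulr_sumr mulrA.
    rewrite addrACA addNr addr0.
    rewrite [RHS](bigID (fun i => 0 <= l i))/=; congr (_ + _).
    by apply: eq_big => [j|j lj]; rewrite ?ltNge// tA.
  exists u; split.
  + move=> [i j]; rewrite /u/=; case: ifPn => // /negPn li.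
    case: ifPn => ij; first by rewrite mulr_ge0// subr_ge0.
    case: ifPn => // lj; rewrite /c/= !mulr_ge0// subr_ge0.
    by rewrite (le_trans (ltW lj)).
  + move=> [i j]; rewrite /u/= negb_and negb_or => /orP[->//|/andP[nlj ij]].
    by rewrite (negbTE ij) (negbTE nlj) if_same.
  + have := split_sum R^o (fun=> 1); under [RHS]eq_bigr do rewrite /GRing.scale/= mulr1.
    rewrite w1 => <-; apply: eq_bigr => -[i j] _ /=; rewrite /u/=.
    case: ifPn => [_|/negPn li]; first by rewrite scale0r.
    case: ifPn => ij; first by rewrite /GRing.scale/= mulr1.
    case: ifPn => lj; last by rewrite scale0r.
    rewrite /GRing.scale/= !mulr1 mulVf ?mulr1// subr_eq0 gt_eqF//.
    exact: lt_le_trans lj li.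
  + exact/esym/split_sum.
- move=> xh; split; last first.
    move: xh => [w [w0 wD w1 xE]]; rewrite /halfspace/= xE aff_sum//.
    apply: sumr_ge0 => -[i j] _ /=.
    have [/andP[/= li lj]|nD] := boolP ((0 <= aff a b (p (i, j).1)) &&
                          ((aff a b (p (i, j).2) < 0) || ((i, j).1 == (i, j).2))); last first.
      by rewrite wD// mul0r.
    rewrite mulr_ge0//; case: ifPn lj => [//|ij]; rewrite orbF => lj.
    have lij : l i - l j != 0 by rewrite subr_eq0 gt_eqF// (lt_le_trans lj).
    have Ei : (p i *m a) 0 0 = l i - b by rewrite /l /aff addrK.
    have Ej : (p j *m a) 0 0 = l j - b by rewrite /l /aff addrK.
    rewrite -/(l i) -/(l j) /aff -scalemxAl mulmxBl -!scalemxAl.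
    move: (p i *m a) (p j *m a) Ei Ej => u v Ei Ej; rewrite !mxE Ei Ej (_ : _ + b = 0)//; field; exact: lij.
  move: x xh; apply: hull_min => -[i j] /andP[/= li lj].
  case: ifPn lj => [_ _|ij]; first exact: hull_pt.
  rewrite orbF -/(l i) -/(l j) => lj.
  have lij : 0 < l i - l j by rewrite subr_gt0 (lt_le_trans lj).
  rewrite (_ : _ *: _ = (1 - l i / (l i - l j)) *: p i + (l i / (l i - l j)) *: p j).
    apply: hull_convex2; [exact: hull_pt|exact: hull_pt| |].
      by rewrite divr_ge0// ltW.
    by rewrite ler_pdivrMr// mul1r lerBrDr gerDl ltW.
  rewrite scalerBr !scalerA addrC -scaleNr; congr (_ *: _ + _ *: _); field;
    exact: lt0r_neq0.
Qed.

Lemma is_polytope_halfspace d (a : 'cV[R]_d) b A :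
  is_polytope A -> is_polytope (A `&` halfspace a b).
Proof.
move=> /is_polytopeP[n [p ->]]; rewrite hull_halfspace; exact: is_polytope_hull.
Qed.

Lemma affN d (a : 'cV[R]_d) b x : aff (- a) (- b) x = - aff a b x.
Proof. by rewrite /aff mulmxN mxE opprD. Qed.

Lemma hyperplaneE d (a : 'cV[R]_d) b :
  hyperplane a b = halfspace a b `&` halfspace (- a) (- b).
Proof.
apply/seteqP; split=> x; rewrite /hyperplane /halfspace/= affN oppr_ge0.
  by move=> ->.
by move=> [? ?]; apply/le_anti/andP.
Qed.

Lemma is_polytope_hyperplane d (a : 'cV[R]_d) b A :
  is_polytope A -> is_polytope (A `&` hyperplane a b).
Proof. by move=> ?; rewrite hyperplaneE setIA; do 2! apply: is_polytope_halfspace. Qed.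

Lemma polytope_convex2 d (A : set 'rV[R]_d) x y t : is_polytope A ->
  A x -> A y -> 0 <= t -> t <= 1 -> A ((1 - t) *: x + t *: y).
Proof. by move=> /is_polytopeP[n [p ->]]; exact: hull_convex2. Qed.

Lemma polytope_bounded d (A : set 'rV[R]_d) : is_polytope A ->
  exists N : nat, forall x i, A x -> `|x 0 i| <= N%:R.
Proof.
move=> /is_polytopeP[n [p ->]].
pose M := \sum_k \sum_i `|p k 0 i|.
exists (Num.bound M) => x i [w [w0 _ w1 ->]].
apply: le_trans (ltW (archi_boundP _)); last by do 2! apply: sumr_ge0 => ? _.
rewrite summxE (le_trans (ler_norm_sum _ _ _))//.
apply: ler_sum => k _; rewrite mxE normrM ger0_norm//.
apply: (@le_trans _ _ `|p k 0 i|).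
  rewrite ler_piMl// -w1 (bigD1 k)//= lerDl; exact: sumr_ge0.
by rewrite (bigD1 i)//= lerDl sumr_ge0.
Qed.

End Hull.

(** * Polyhedral descriptions *)

Section Weyl.
Variable R : realType.

Definition dot m (x : 'rV[R]_m) (a : 'cV[R]_m) : R := (x *m a) 0 0.

Lemma dotDl m (x y : 'rV[R]_m) a : dot (x + y) a = dot x a + dot y a.
Proof. by rewrite /dot mulmxDl mxE. Qed.

Lemma dotZl m t (x : 'rV[R]_m) a : dot (t *: x) a = t * dot x a.
Proof. by rewrite /dot -scalemxAl mxE. Qed.

Lemma dotBl m (x y : 'rV[R]_m) a : dot (x - y) a = dot x a - dot y a.
Proof. by rewrite -scaleN1r dotDl dotZl mulN1r. Qed.

Lemma dotBr m (x : 'rV[R]_m) a b : dot x (a - b) = dot x a - dot x b.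
Proof. by rewrite /dot mulmxBr !mxE. Qed.

Lemma dotZr m t (x : 'rV[R]_m) a : dot x (t *: a) = t * dot x a.
Proof. by rewrite /dot -scalemxAr mxE. Qed.

Lemma dotNr m (x : 'rV[R]_m) a : dot x (- a) = - dot x a.
Proof. by rewrite -scaleN1r dotZr mulN1r. Qed.

Lemma dot_delta m (x : 'rV[R]_m) i : dot x (delta_mx i 0) = x 0 i.
Proof.
rewrite /dot mxE (bigD1 i)//= mxE !eqxx mulr1 big1 ?addr0// => j /negbTE ji.
by rewrite mxE ji mulr0.
Qed.

Fixpoint cone m (s : seq 'rV[R]_m) : set 'rV[R]_m :=
  if s is p :: s' then [set x | exists t, 0 <= t /\ cone s' (x - t *: p)]
  else [set 0].

Lemma cone_map m (I : eqType) (r : seq I) (p : I -> 'rV[R]_m) x : uniq r ->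
  cone (map p r) x <->
  exists w : I -> R, (forall i, 0 <= w i) /\ x = \sum_(i <- r) w i *: p i.
Proof.
elim: r x => [x _|i r IH x] /=.
  split=> [->|[w [_ ->]]]; last by rewrite big_nil.
  by exists (fun=> 0); rewrite big_nil.
move=> /andP[ir ur]; split.
- move=> [t [t0 /(IH _ ur)[w [w0 xE]]]].
  exists (fun j => if j == i then t else w j); split; first by move=> j; case: ifP.
  rewrite big_cons eqxx -(subrK (t *: p i) x) xE addrC; congr (_ + _).
  rewrite !big_seq; apply: eq_bigr => j jr; rewrite ifF//.
  by apply: contraNF ir => /eqP <-.
- move=> [w [w0 xE]]; exists (w i); split=> //.
  by apply/(IH _ ur); exists w; split=> //; rewrite xE big_cons addrC addKr.
Qed.

Lemma exists_between (lo up : seq R) :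
  (forall u, u \in up -> 0 <= u) ->
  (forall l u, l \in lo -> u \in up -> l <= u) ->
  exists t, [/\ 0 <= t, forall l, l \in lo -> l <= t &
                forall u, u \in up -> t <= u].
Proof.
move=> up0; elim: lo => [_|l lo IH lu]; first by exists 0.
have [|t [t0 lot tup]] := IH.
  by move=> k u klo uup; apply: lu => //; rewrite inE klo orbT.
exists (Num.max l t); split.
- by rewrite le_max t0 orbT.
- by move=> k; rewrite inE le_max => /predU1P[->|/lot ->]; rewrite ?lexx ?orbT.
- by move=> u uup; rewrite ge_max lu ?tup// mem_head.
Qed.

(* Fourier-Motzkin elimination of the coefficient of the first generator. *)
Lemma cone_weyl m (s : seq 'rV[R]_m) :
  exists L : seq 'cV[R]_m, forall x, cone s x <-> forall a, a \in L -> 0 <= dot x a.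
Proof.
elim: s => [|p s [L LP]].
  exists ([seq delta_mx i 0 | i <- enum 'I_m] ++
          [seq - delta_mx i 0 | i <- enum 'I_m]) => x /=; split.
    by move=> -> a _; rewrite /dot mul0mx mxE.
  move=> xL; apply/rowP => i; rewrite mxE; apply/le_anti/andP; split.
    rewrite -oppr_ge0 -dot_delta -dotNr; apply: xL; rewrite mem_cat.
    by apply/orP; right; apply/mapP; exists i; rewrite ?mem_enum.
  rewrite -dot_delta; apply: xL; rewrite mem_cat.
  by apply/orP; left; apply/mapP; exists i; rewrite ?mem_enum.
exists ([seq a <- L | 0 <= dot p a] ++
  [seq (dot p a)^-1 *: a - (dot p b)^-1 *: b |
    a <- [seq a <- L | 0 < dot p a], b <- [seq a <- L | dot p a < 0]]) => x /=.
split.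
- move=> [t [t0 /LP xL]] c; rewrite mem_cat => /orP[|].
    rewrite mem_filter => /andP[pc cL]; have := xL _ cL.
    rewrite dotBl dotZl subr_ge0; apply: le_trans; exact: mulr_ge0.
  move=> /allpairsP[[a b] [/=]]; rewrite !mem_filter => /andP[pa aL] /andP[pb bL] ->.
  rewrite dotBr !dotZr subr_ge0 (@le_trans _ _ t)//.
    have := xL _ bL; rewrite dotBl dotZl subr_ge0 => h.
    by rewrite mulrC ler_ndivrMr.
  have := xL _ aL; rewrite dotBl dotZl subr_ge0 => h.
  by rewrite mulrC ler_pdivlMr.
- move=> xL.
  have [||t [t0 lot tup]] := @exists_between
    [seq dot x b / dot p b | b <- [seq a <- L | dot p a < 0]]
    [seq dot x a / dot p a | a <- [seq a <- L | 0 < dot p a]].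
  + move=> u /mapP[a]; rewrite mem_filter => /andP[pa aL] ->.
    by rewrite divr_ge0 ?(ltW pa)// xL// mem_cat mem_filter (ltW pa) aL.
  + move=> l u /mapP[b bL ->] /mapP[a aL ->].
    have := xL ((dot p a)^-1 *: a - (dot p b)^-1 *: b).
    rewrite mem_cat (allpairs_f _ aL bL) orbT => /(_ isT).
    by rewrite dotBr !dotZr subr_ge0 ![_^-1 * _]mulrC.
  exists t; split=> //; apply/LP => a aL; rewrite dotBl dotZl subr_ge0.
  have [pa|pa|pa] := ltgtP (dot p a) 0.
  + rewrite -ler_ndivrMr//; apply: lot; apply/mapP; exists a => //.
    by rewrite mem_filter pa.
  + rewrite -ler_pdivlMr//; apply: tup; apply/mapP; exists a => //.
    by rewrite mem_filter pa.
  + by rewrite pa mulr0 xL// mem_cat mem_filter pa lexx aL.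
Qed.

Lemma affE d (a : 'cV[R]_d) b x : aff a b x = dot x a + b.
Proof. by []. Qed.

Lemma affB d (a a' : 'cV[R]_d) b b' x :
  aff (a - a') (b - b') x = aff a b x - aff a' b' x.
Proof. by rewrite !affE dotBr opprD addrACA. Qed.

Definition affp d (f : 'cV[R]_d * R) (x : 'rV[R]_d) := aff f.1 f.2 x.

Definition polyhedron d (L : seq ('cV[R]_d * R)) : set 'rV[R]_d :=
  [set x | forall f, f \in L -> 0 <= affp f x].

Definition homog d (x : 'rV[R]_d) : 'rV[R]_(d + 1) := row_mx x 1%:M.

Lemma homog_sum d (I : finType) (w : I -> R) (p : I -> 'rV[R]_d) :
  \sum_i w i *: homog (p i) = row_mx (\sum_i w i *: p i) (\sum_i w i)%:M.
Proof.
elim/big_rec3: _ => [|i y1 y2 y3 _ ->]; first by rewrite raddf0 row_mx0.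
by rewrite scale_row_mx add_row_mx scalemx1 raddfD.
Qed.

Lemma dot_row_mx d e (x : 'rV[R]_d) (y : 'rV[R]_e) c :
  dot (row_mx x y) c = dot x (usubmx c) + dot y (dsubmx c).
Proof. by rewrite /dot -{1}[c]vsubmxK mul_row_col mxE. Qed.

Lemma dot_scalar (t : R) (c : 'cV[R]_1) : dot t%:M c = t * c 0 0.
Proof. by rewrite /dot mul_scalar_mx mxE. Qed.

Definition unhomog d (c : 'cV[R]_(d + 1)) : 'cV[R]_d * R :=
  (usubmx c, dsubmx c 0 0).

Lemma dot_homog d (x : 'rV[R]_d) c : dot (homog x) c = affp (unhomog c) x.
Proof. by rewrite dot_row_mx dot_scalar mul1r. Qed.

Lemma hull_cone d n (p : 'I_n -> 'rV[R]_d) x :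
  hull xpredT p x <-> cone [seq homog (p i) | i <- enum 'I_n] (homog x).
Proof.
rewrite cone_map ?enum_uniq//; split.
- move=> [w [w0 _ w1 ->]]; exists w; split=> //.
  by rewrite big_enum/= homog_sum w1.
- move=> [w [w0]]; rewrite big_enum/= homog_sum => /eq_row_mx[xE w1].
  exists w; split=> //; have := congr1 (fun M : 'M[R]_1 => M 0 0) w1.
  by rewrite !mxE.
Qed.

Lemma polytope_polyhedron d (A : set 'rV[R]_d) :
  is_polytope A -> exists L, A = polyhedron L.
Proof.
move=> /is_polytopeP[n [p ->]].
have [L LP] := cone_weyl [seq homog (p i) | i <- enum 'I_n].
exists (map (@unhomog d) L); apply/seteqP; split => x.
- by move=> /hull_cone/LP xL f /mapP[c cL ->]; rewrite -dot_homog; exact: xL.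
- move=> xL; apply/hull_cone/LP => c cL; rewrite dot_homog.
  by apply: xL; exact: map_f.
Qed.

Lemma is_polytope_polyhedron d (L : seq ('cV[R]_d * R)) A :
  is_polytope A -> is_polytope (A `&` polyhedron L).
Proof.
elim: L A => [|f L IH] A pA.
  by rewrite (_ : polyhedron _ = setT) ?setIT// -subTset.
rewrite (_ : A `&` _ = (A `&` halfspace f.1 f.2) `&` polyhedron L).
  exact/IH/is_polytope_halfspace.
rewrite -setIA; congr (_ `&` _); apply/seteqP; split=> x.
  move=> xL; split; first by apply: xL; rewrite mem_head.
  by move=> g gL; apply: xL; rewrite inE gL orbT.
by move=> [xf xL] g; rewrite inE => /predU1P[->|/xL].
Qed.

Lemma is_polytopeI d (A B : set 'rV[R]_d) :
  is_polytope A -> is_polytope B -> is_polytope (A `&` B).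
Proof.
by move=> pA /polytope_polyhedron[L ->]; exact: is_polytope_polyhedron.
Qed.

End Weyl.

(** * Valuations and cutting *)

Section SetValuation.
Variables (R : realType) (G : zmodType).

Definition trans d (t : 'rV[R]_d) (A : set 'rV[R]_d) := [set t + x | x in A].

Definition set_valuation d (mu : set 'rV[R]_d -> G) : Prop :=
  [/\ mu set0 = 0,
      forall A B, is_polytope A -> is_polytope B -> is_polytope (A `|` B) ->
        mu (A `|` B) + mu (A `&` B) = mu A + mu B &
      forall t A, is_polytope A -> mu (trans t A) = mu A].

Definition simple_val d (mu : set 'rV[R]_d -> G) : Prop :=
  forall A a b, is_polytope A -> a != 0 -> A `<=` hyperplane a b -> mu A = 0.

Variables (d : nat) (mu : set 'rV[R]_d -> G).
Hypotheses (muV : set_valuation mu).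

Lemma val_cut A a b : is_polytope A ->
  mu A + mu (A `&` hyperplane a b) =
  mu (A `&` halfspace a b) + mu (A `&` halfspace (- a) (- b)).
Proof.
move=> pA; have [_ + _] := muV.
move=> /(_ (A `&` halfspace a b) (A `&` halfspace (- a) (- b))) <-.
- rewrite setIACA setIid -hyperplaneE -setIUr (_ : _ `|` _ = setT) ?setIT//.
  rewrite -subTset => x _; rewrite /halfspace/= affN oppr_ge0.
  by have [|/ltW] := leP 0 (aff a b x); [left|right].
- exact: is_polytope_halfspace.
- exact: is_polytope_halfspace.
- rewrite -setIUr (_ : _ `|` _ = setT) ?setIT// -subTset => x _.
  rewrite /halfspace/= affN oppr_ge0.
  by have [|/ltW] := leP 0 (aff a b x); [left|right].
Qed.

Hypothesis (muS : simple_val mu).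

Lemma simple_cut A a b : is_polytope A -> a != 0 ->
  mu A = mu (A `&` halfspace a b) + mu (A `&` halfspace (- a) (- b)).
Proof.
move=> pA a0; rewrite -val_cut// [X in _ + X](muS (a:=a) (b:=b)) ?addr0//.
exact: is_polytope_hyperplane.
Qed.

Definition geq_set (f g : 'cV[R]_d * R) : set 'rV[R]_d :=
  [set x | affp g x <= affp f x].

Lemma geq_setE f g : geq_set f g = halfspace (f.1 - g.1) (f.2 - g.2).
Proof.
apply/seteqP; split=> x; rewrite /geq_set /halfspace /affp/=;
  by rewrite affB subr_ge0.
Qed.

Lemma simple_cut2 A f g : is_polytope A -> f != g ->
  mu A = mu (A `&` geq_set f g) + mu (A `&` geq_set g f).
Proof.
move=> pA fg; have [fg1|fg1] := eqVneq f.1 g.1.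
  have fg2 : f.2 != g.2 by apply: contra_neq fg => fg2; rewrite [f]surjective_pairing fg1 fg2 -surjective_pairing.
  have [mu0 _ _] := muV.
  have H u v : u.1 = v.1 -> u.2 < v.2 -> A `&` geq_set u v = set0 /\ A `&` geq_set v u = A.
    rewrite /geq_set /affp => uv1 uv2; split.
      by apply/seteqP; split => // x [_] /=; rewrite uv1 /aff lerD2l leNgt uv2.
    apply/seteqP; split => [x []//|x Ax]; split=> //=.
    by rewrite uv1 /aff lerD2l ltW.
  have [/H[]//|/H[]//|] := ltgtP f.2 g.2.
  - by move=> -> ->; rewrite mu0 add0r.
  - by move=> -> ->; rewrite mu0 addr0.
  - by move/eqP; rewrite (negbTE fg2).
rewrite !geq_setE (@simple_cut A (f.1 - g.1) (f.2 - g.2))//.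
  by rewrite !opprB.
by rewrite subr_eq0.
Qed.

Definition cell (F : seq ('cV[R]_d * R)) f (A : set 'rV[R]_d) :=
  A `&` [set x | forall g, g \in F -> affp g x <= affp f x].

Lemma is_polytope_cell F f A : is_polytope A -> is_polytope (cell F f A).
Proof.
move=> pA; rewrite /cell (_ : [set x | _] =
    polyhedron [seq (f.1 - g.1, f.2 - g.2) | g <- F]).
  exact: is_polytope_polyhedron.
apply/seteqP; split => x.
  move=> xF _ /mapP[g gF ->]; have := xF g gF.
  by move: (geq_setE f g) => /seteqP[+ _] => /(_ x)/[apply].
move=> xF g gF; have := geq_setE f g => /seteqP[_] /(_ x); apply.
by apply: (xF (f.1 - g.1, f.2 - g.2)); apply/mapP; exists g.
Qed.

Lemma power_sum F A : is_polytope A -> uniq F -> F != [::] ->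
  mu A = \sum_(f <- F) mu (cell F f A).
Proof.
elim: F A => // f [_ A pA _ _|h F' IH A pA].
  rewrite big_seq1; congr mu; apply/seteqP; split=> x; last by case.
  by move=> Ax; split=> // g; rewrite inE => /eqP ->.
move: (h :: F') (mem_head h F') IH => F hF IH /= /andP[fF uF] _.
have F0 : F != [::] by case: F hF {IH fF uF}.
rewrite big_cons (IH A)//.
rewrite (eq_big_seq (fun g => mu (cell (f :: F) g A) + mu (cell F g A `&` geq_set f g))).
  rewrite big_split/= addrC; congr (_ + _).
  rewrite [RHS](IH (cell (f :: F) f A))//; last exact: is_polytope_cell.
  apply: eq_big_seq => g gF; congr mu; apply/seteqP; split => x.
    move=> [[Ax xg] fg]; split=> //; split=> // k; rewrite inE => /predU1P[->//|kF].
    exact: le_trans (xg k kF) fg.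
  move=> [[Ax xf] xg]; split; first by split.
  by apply: xf; rewrite inE gF orbT.
move=> g gF; rewrite (simple_cut2 (f:=g) (g:=f)).
- congr (mu _ + _); apply/seteqP; split=> x.
    move=> [[Ax xg] fg]; split=> // k; rewrite inE => /predU1P[->//|]; exact: xg.
  move=> [Ax xg]; split; last by apply: xg; rewrite mem_head.
  by split=> // k kF; apply: xg; rewrite inE kF orbT.
- exact: is_polytope_cell.
- by apply: contraNneq fF => <-.
Qed.

End SetValuation.

Section Triangulation.
Variables (R : realType) (G : zmodType).

(* The functions in [F] are the lower facets of the hull of the points [p i]
   lifted to height [h i]. *)
Lemma lower_envelope d n (p : 'I_n -> 'rV[R]_d) (h : 'I_n -> R) :
  (forall i, 0 <= h i) -> (0 < n)%N ->
  exists F : seq ('cV[R]_d * R), [/\ uniq F, F != [::] &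
    forall f, f \in F ->
      cell F f (hull xpredT p) = hull (fun i => affp f (p i) == h i) p].
Proof.
move=> h0 n0.
pose q i : 'rV[R]_(d + 1 + 1) := row_mx (homog (p i)) (h i)%:M.
have [L LP] := cone_weyl [seq q i | i <- enum 'I_n].
have qE (w : 'I_n -> R) : \sum_i w i *: q i =
    row_mx (row_mx (\sum_i w i *: p i) (\sum_i w i)%:M) (\sum_i w i * h i)%:M.
  rewrite -homog_sum.
  elim/big_rec3: _ => [|i y1 y2 y3 _ ->]; first by rewrite raddf0 row_mx0.
  by rewrite scale_row_mx add_row_mx scale_scalar_mx raddfD.
pose al (c : 'cV[R]_(d + 1 + 1)) := unhomog (usubmx c).
pose be (c : 'cV[R]_(d + 1 + 1)) : R := dsubmx c 0 0.
have dotE x z c : dot (row_mx (homog x) z%:M) c = affp (al c) x + z * be c.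
  by rewrite dot_row_mx dot_homog dot_scalar.
pose ell c : 'cV[R]_d * R := (- (be c)^-1 *: (al c).1, - (be c)^-1 * (al c).2).
have ellE c x : affp (ell c) x = - (be c)^-1 * affp (al c) x.
  by rewrite /affp !affE dotZr mulrDr.
pose F := undup [seq ell c | c <- L & 0 < be c].
have FP f : f \in F -> exists c, [/\ c \in L, 0 < be c & f = ell c].
  by rewrite mem_undup => /mapP[c]; rewrite mem_filter => /andP[? ?] ->; exists c.
have FI c : c \in L -> 0 < be c -> ell c \in F.
  by move=> cL bc; rewrite mem_undup; apply: map_f; rewrite mem_filter bc.
have coneP x z : (forall c, c \in L -> 0 <= affp (al c) x + z * be c) <->
    exists w : 'I_n -> R, [/\ forall i, 0 <= w i, \sum_i w i = 1,
      x = \sum_i w i *: p i & z = \sum_i w i * h i].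
  split.
    move=> H; have : cone [seq q i | i <- enum 'I_n] (row_mx (homog x) z%:M).
      by apply/LP => c cL; rewrite dotE H.
    rewrite cone_map ?enum_uniq// => -[w [w0]]; rewrite big_enum/= qE.
    move=> /eq_row_mx[/eq_row_mx[xE w1] zE]; exists w; split=> //.
      by have := congr1 (fun M : 'M[R]_1 => M 0 0) w1; rewrite !mxE.
    by have := congr1 (fun M : 'M[R]_1 => M 0 0) zE; rewrite !mxE.
  move=> [w [w0 w1 xE zE]] c cL; rewrite -dotE.
  apply: (iffLR (LP _)) => //; rewrite cone_map ?enum_uniq//; exists w.
  by split=> //; rewrite big_enum/= qE xE zE w1.
have pL c i : c \in L -> 0 <= affp (al c) (p i) + h i * be c.
  move=> cL; apply: (iffRL (coneP _ _)) => //; exists (fun j => (j == i)%:R).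
  split=> [j||  |]; first by rewrite ler0n.
  - by rewrite (bigD1 i)//= eqxx big1 ?addr0// => j /negbTE ->.
  - rewrite (bigD1 i)//= eqxx scale1r big1 ?addr0// => j /negbTE ->.
    by rewrite scale0r.
  - by rewrite (bigD1 i)//= eqxx mul1r big1 ?addr0// => j /negbTE ->; rewrite mul0r.
have ell_le c i : c \in L -> 0 < be c -> affp (ell c) (p i) <= h i.
  by move=> cL bc; rewrite ellE mulNr lerNl ler_pdivlMl//; have := pL c i cL; lra.
exists F; split; first exact: undup_uniq.
- apply/negP => /eqP F0.
  have Lneg c : c \in L -> be c <= 0.
    by move=> cL; rewrite leNgt; apply/negP => /(FI _ cL); rewrite F0.
  have [|w [w0 w1 _ zE]] := iffLR (coneP (p (Ordinal n0)) (-1)).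
    move=> c cL; rewrite (le_trans (pL c (Ordinal n0) cL))// lerD2l.
    by rewrite ler_wnM2r ?Lneg// (le_trans _ (h0 _))// lerN10.
  have : (0 : R) <= - 1 by rewrite zE; apply: sumr_ge0 => i _; rewrite mulr_ge0.
  by rewrite ler0N1.
- move=> f fF; apply/seteqP; split => x.
  + move=> [[w [w0 _ w1 xE]] xF]; pose z := \sum_i w i * h i.
    have fxz : affp f x <= z.
      rewrite /affp xE aff_sum//; apply: ler_sum => i _; rewrite ler_wpM2l//.
      by have [c [cL bc ->]] := FP f fF; exact: ell_le.
    have [|v [v0 v1 xE' zE]] := iffLR (coneP x (affp f x)).
      move=> c cL; have [bc|bc] := ltP 0 (be c).
        have := xF _ (FI c cL bc); rewrite ellE mulNr lerNl ler_pdivlMl//; lra.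
      have : 0 <= affp (al c) x + z * be c by apply: (iffRL (coneP x z)) => //; exists w.
      by move=> /le_trans; apply; rewrite lerD2l ler_wnM2r.
    exists v; split=> // i fi.
    have : \sum_i v i * (h i - affp f (p i)) = 0.
      under eq_bigr do rewrite mulrBr; rewrite sumrB -zE -aff_sum// -xE'.
      by rewrite subrr.
    have nn i' : 0 <= v i' * (h i' - affp f (p i')).
      by rewrite mulr_ge0// subr_ge0; have [c [cL bc ->]] := FP f fF; exact: ell_le.
    move/eqP; rewrite psumr_eq0// => /allP/(_ i); rewrite mem_index_enum => /(_ isT).
    by rewrite /= mulf_eq0 subr_eq0 [h i == _]eq_sym (negbTE fi) orbF => /eqP.
  + move=> [w [w0 wD w1 xE]]; split; first by exists w.
    move=> g gF; rewrite xE /affp !aff_sum//; apply: ler_sum => i _.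
    have [/eqP fi|/wD->] := boolP (affp f (p i) == h i); last by rewrite !mul0r.
    rewrite ler_wpM2l// -/(affp f (p i)) fi.
    by have [c [cL bc ->]] := FP g gF; exact: ell_le.
Qed.

Definition homog_mx d n (p : 'I_n -> 'rV[R]_d) : 'M[R]_(n, d + 1) :=
  \matrix_i homog (p i).

Lemma row_homog_mx d n (p : 'I_n -> 'rV[R]_d) i : row i (homog_mx p) = homog (p i).
Proof. exact: rowK. Qed.

Lemma homog_mx_mul d n (p : 'I_n -> 'rV[R]_d) c i :
  (homog_mx p *m c) i 0 = affp (unhomog c) (p i).
Proof. by rewrite -dot_homog /dot -row_homog_mx -row_mul [RHS]mxE. Qed.

(* Induction on the number of points: the height that is 1 at one point and 0
   at the others can be chosen not to be affine, so each region of its lower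
   envelope has fewer points. *)
Lemma triangulation d (mu : set 'rV[R]_d -> G) (E : G -> Prop) :
  set_valuation mu -> simple_val mu -> E 0 -> (forall x y, E x -> E y -> E (x + y)) ->
  (forall p : 'I_(d + 1) -> 'rV[R]_d,
     homog_mx p \in unitmx -> E (mu (hull xpredT p))) ->
  forall A, is_polytope A -> E (mu A).
Proof.
move=> muV muS E0 ED Esimplex _ /is_polytopeP[n [p ->]].
have [mu0 _ _] := muV.
elim/ltn_ind: n p => n IH p.
have [n0|n0] := posnP n.
  rewrite (_ : hull _ _ = set0) ?mu0//; apply/seteqP; split=> // x.
  move=> [w [_ _ /esym/eqP + _]]; rewrite big1 ?oner_eq0// => -[i /= i0].
  by exfalso; rewrite n0 in i0.
set A := homog_mx p.
have [Afree|] := boolP (row_free A^T); last first.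
  rewrite -kermx_eq0 => /rowV0Pn[v /sub_kermxP vA v0].
  have Ac : A *m v^T = 0 by rewrite -[A]trmxK -trmx_mul vA trmx0.
  have pc i : affp (unhomog v^T) (p i) = 0 by rewrite -homog_mx_mul Ac mxE.
  rewrite (muS _ (unhomog v^T).1 (unhomog v^T).2)//.
  - exact: is_polytope_hull.
  - apply: contraNneq v0 => u0; rewrite -[v]trmxK -[v^T]vsubmxK.
    have /= d0 := pc (Ordinal n0).
    rewrite /affp affE u0 /dot mulmx0 mxE add0r in d0.
    rewrite [usubmx _]u0 (_ : dsubmx _ = 0) ?col_mx0 ?trmx0//.
    by apply/colP => k; rewrite ord1 [LHS]d0 mxE.
  - move=> x [w [_ _ w1 ->]]; rewrite /hyperplane/= aff_sum// big1// => i _.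
    by rewrite [X in _ * X]pc mulr0.
have dn : (d + 1 <= n)%N by rewrite -(eqnP Afree) rank_leq_col.
have [nE|nd] := eqVneq n (d + 1)%N.
  rewrite nE in p A Afree *.
  by apply: Esimplex; rewrite -unitmx_tr -row_free_unit.
have : ~~ row_full A^T.
  by rewrite /row_full (eqnP Afree) eq_sym.
rewrite -sub1mx => /row_subPn[i iA].
have [|F [uF F0 FP]] := @lower_envelope d n p (fun j => (j == i)%:R) _ n0.
  by move=> j; rewrite ler0n.
rewrite (power_sum muV muS _ uF F0); last exact: is_polytope_hull.
rewrite big_seq; apply: big_ind => // f fF.
rewrite FP// hull_enum; apply: IH.
set D := fun i0 : 'I_n => _.
have : (#|D| <= n)%N by have := max_card D; rewrite card_ord.
rewrite ltn_neqAle => ->; rewrite andbT.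
apply: contraNneq iA => DE; rewrite -(_ : (col_mx f.1 f.2%:M)^T *m A^T = row i 1%:M).
  exact: submxMl.
rewrite -trmx_mul; apply/rowP => j; rewrite mxE homog_mx_mul !mxE.
have : j \in D.
  have /subset_cardP : #|D| = #|'I_n| by rewrite card_ord.
  by move=> /(_ (subset_predT _)) ->.
rewrite unfold_in => /eqP; rewrite eq_sym => <-; congr affp.
by rewrite /unhomog col_mxKu col_mxKd mxE eqxx mulr1n -surjective_pairing.
Qed.

End Triangulation.

(** * h-vectors *)

Section HRep.
Variable G : zmodType.
Implicit Types (f : nat -> G) (h : nat -> G).

Definition hrep r f h : Prop :=
  forall n, f n = \sum_(i < r.+1) h i *+ 'C(n + r - i, r).

Lemma hrepD r f g h k : hrep r f h -> hrep r g k ->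
  hrep r (fun n => f n + g n) (fun i => h i + k i).
Proof.
by move=> fh gk n; rewrite fh gk -big_split/=; apply: eq_bigr => i _; rewrite mulrnDl.
Qed.

Lemma hrep_eq r f g h : f =1 g -> hrep r f h -> hrep r g h.
Proof. by move=> fg fh n; rewrite -fg. Qed.

Definition hlift r h i : G :=
  (if (i <= r)%N then h i else 0) - (if (0 < i)%N then h i.-1 else 0).

Lemma hrep_lift r f h : hrep r f h -> hrep r.+1 f (hlift r h).
Proof.
move=> fh n; rewrite {}fh; under [RHS]eq_bigr do rewrite mulrnBl.
rewrite sumrB [in X in X - _]big_ord_recr/= ltnn mul0rn addr0.
rewrite [X in _ - X]big_ord_recl/= mul0rn add0r -sumrB; apply: eq_bigr => i _.
rewrite -ltnS ltn_ord.
rewrite /bump/= add1n addnS subSS subSn ?(leq_trans _ (leq_addl n r)) -1?ltnS//.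
by rewrite binS mulrnDr addrC addKr.
Qed.

Lemma hrep_sum r f F h : hrep r f h -> (forall n, F n.+1 = F n + f n) ->
  hrep r.+1 (fun n => F n - F 0%N) (fun i => if (0 < i)%N then h i.-1 else 0).
Proof.
move=> fh FS n; rewrite big_ord_recl/= mul0rn add0r.
elim: n => [|n IH].
  rewrite subrr big1// => i _; rewrite /bump/= add0n add1n subSS.
  by rewrite bin_small ?mulr0n// ltnS leq_subr.
rewrite FS addrAC IH fh -big_split/=; apply: eq_bigr => i _.
rewrite /bump/= add1n !addnS addSn !subSS subSn ?binS ?mulrnDr//.
by rewrite (leq_trans _ (leq_addl n r))// -ltnS.
Qed.

Lemma hrep_unique r f h k : hrep r f h -> hrep r f k ->
  forall i, (i <= r)%N -> h i = k i.
Proof.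
move=> fh fk i; elim/ltn_ind: i => i IH ir.
have : \sum_(j < r.+1) (h j - k j) *+ 'C(i + r - j, r) = 0.
  by under eq_bigr do rewrite mulrnBl; rewrite sumrB -fh -fk subrr.
rewrite (bigD1 (Ordinal (ir : (i < r.+1)%N)))//= addKn binn mulr1n big1 ?addr0.
  by move/eqP; rewrite subr_eq0 => /eqP.
move=> j; rewrite -val_eqE/= neq_ltn => /orP[ji|ij].
  by rewrite IH ?subrr ?mul0rn// (leq_trans (ltnW ji)).
rewrite bin_small ?mulr0n// ltn_subLR ?ltn_add2r//.
by rewrite (leq_trans _ (leq_addl i r))// -ltnS.
Qed.

Fixpoint hconst r : nat -> int :=
  if r is r'.+1 then fun i => (if (i <= r')%N then hconst r' i else 0) -
                              (if (0 < i)%N then hconst r' i.-1 else 0)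
  else fun=> 1.

Lemma hrep_const r (c : G) : hrep r (fun=> c) (fun i => c *~ hconst r i).
Proof.
elim: r => [|r IH]; first by move=> n; rewrite big_ord1/= subn0 addn0 bin0.
move=> n; rewrite [LHS](hrep_lift IH n); apply: eq_bigr => i _; congr (_ *+ _).
by rewrite /hlift /= mulrzBr; congr (_ - _); case: ifP; rewrite ?mulr0z ?mulr1z.
Qed.

(* Eulerian numbers, by the recursion coming from [bin_eul]; [hrep_exp] is
   Worpitzky's identity. *)
Fixpoint eul m i : nat :=
  if m is m'.+1 then i * eul m' i + (if i is i'.+1 then (m' - i').+1 * eul m' i' else 0)
  else i == 0.

Lemma eul_gt m i : (m < i)%N -> eul m i = 0%N.
Proof.
elim: m i => [|m IH] [|i]//=; rewrite ltnS => mi.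
by rewrite !IH ?muln0// ltnW.
Qed.

Lemma eul_top m : eul m m = 1%N.
Proof.
by elim: m => //= m IH; rewrite eul_gt// muln0 add0n subnn mul1n IH.
Qed.

Lemma bin_eul n m i : (i <= m)%N ->
  (n * 'C(n + m - i, m) =
   i * 'C(n + m.+1 - i, m.+1) + (m - i).+1 * 'C(n + m.+1 - i.+1, m.+1))%N.
Proof.
move=> im; rewrite addnS subSS subSn ?(leq_trans im (leq_addl n m))// binS.
have NE : (n + m - i + i = n + m)%N by rewrite subnK// (leq_trans im (leq_addl n m)).
move: (n + m - i)%N NE => N NE.
have [mN|Nm] := leqP m N; last by rewrite !bin_small ?muln0// ltnW.
have := mul_bin_left N m; nia.
Qed.

Lemma hrep_exp m (A : G) : hrep m (fun n => A *+ n ^ m) (fun i => A *+ eul m i).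
Proof.
elim: m A => [|m IH] A n; first by rewrite big_ord1/= expn0 subn0 addn0 bin0.
rewrite expnSr mulrnA IH -sumrMnl.
have E (i : 'I_m.+1) : A *+ eul m i *+ 'C(n + m - i, m) *+ n =
    A *+ (eul m i * (i * 'C(n + m.+1 - i, m.+1))) +
    A *+ (eul m i * ((m - i).+1 * 'C(n + m.+1 - i.+1, m.+1))).
  have im : (i <= m)%N by rewrite -ltnS.
  by rewrite -!mulrnA [X in _ *+ (_ * X)]mulnC bin_eul// mulnDr mulrnDr.
under eq_bigr do rewrite E.
rewrite big_split/=.
under [RHS]eq_bigr do rewrite -mulrnA mulnDl mulrnDr.
rewrite big_split/=; congr (_ + _).
  rewrite [RHS]big_ord_recr/= eul_gt// muln0 mul0n mulr0n addr0.
  by apply: eq_bigr => i _; rewrite mulnA [(i * _)%N]mulnC.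
rewrite [RHS]big_ord_recl/= mul0n mulr0n add0r.
by apply: eq_bigr => i _; rewrite /bump/= add1n mulnA [(_.+1 * _)%N]mulnC.
Qed.

End HRep.

(** * Dimension and boxes *)

Lemma row_free_col_mx (F : fieldType) r d (M : 'M[F]_(r, d)) (y : 'rV[F]_d) :
  row_free M -> ~~ (y <= M)%MS -> row_free (col_mx M y).
Proof.
move=> Mf yM; rewrite /row_free -addsmxE mxrank_disjoint_sum ?(eqnP Mf).
  by rewrite rank_rV (_ : y != 0)//; apply: contraNneq yM => ->; rewrite sub0mx.
apply/eqP; rewrite -submx0; apply/row_subP => k.
set v := row k _.
have vM : (v <= M)%MS by rewrite (submx_trans (row_sub _ _))// capmxSl.
have /sub_rVP[a aE] : (v <= y)%MS by rewrite (submx_trans (row_sub _ _))// capmxSr.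
have [a0|a0] := eqVneq a 0; first by rewrite aE a0 scale0r sub0mx.
by move: yM; rewrite -(scalerK a0 y) -aE scalemx_sub.
Qed.

Section Dimension.
Variables (R : realType) (d : nat).
Implicit Types P Q : set 'rV[R]_d.

Lemma pdim_ge P r (x : 'rV[R]_d) (M : 'M[R]_(r, d)) :
  P x -> (forall i, P (x + row i M)) -> row_free M -> (r <= pdim P)%N.
Proof.
move=> Px PM Mf; have rd : (r < d.+1)%N by rewrite ltnS -(eqnP Mf) rank_leq_col.
rewrite /pdim (bigD1 (Ordinal rd))/= ?leq_maxl//.
by apply/asboolP; exists x, M.
Qed.

Lemma pdim_le P k (N : 'M[R]_(k, d)) t :
  (forall x, P x -> exists u, x = t + u *m N) -> (pdim P <= \rank N)%N.
Proof.
move=> PN; apply/bigmax_leqP => r /asboolP[x [M [Px PM Mf]]].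
rewrite -(eqnP Mf); apply: mxrankS; apply/row_subP => i.
have [u xE] := PN _ Px; have [v vE] := PN _ (PM i).
rewrite (_ : row i M = (v - u) *m N) ?submxMl// mulmxBl.
by apply: (addrI x); rewrite vE {1}xE addrACA subrr addr0 // addrAC subrr add0r.
Qed.

Lemma pdim_sub P Q : P `<=` Q -> (pdim P <= pdim Q)%N.
Proof.
move=> PQ; apply/bigmax_leqP => r /asboolP[x [M [Px PM Mf]]].
by apply: (pdim_ge (x := x) (M := M)) => // [|i]; apply: PQ.
Qed.

Lemma pdim_max P : (pdim P <= d)%N.
Proof. by apply/bigmax_leqP => i _; rewrite -ltnS. Qed.

Lemma pdim_span P : P !=set0 -> exists x (M : 'M[R]_(pdim P, d)),
  [/\ row_free M, P x & forall y, P y -> exists u, y = x + u *m M].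
Proof.
move=> [x0 Px0].
have [|i /asboolP[x [M [Px PM Mf]]] Ei] := @eq_bigmax_cond _
  (fun r : 'I_d.+1 => `[< exists (x : 'rV[R]_d) (M : 'M[R]_(r, d)),
    [/\ P x, forall i, P (x + row i M) & row_free M] >]) (@nat_of_ord _).
  apply/card_gt0P; exists ord0; apply/asboolP; exists x0, 0; split=> //.
    by move=> [].
  by rewrite /row_free mxrank0.
have {}Ei : pdim P = i by [].
rewrite Ei; exists x, M; split=> // y Py.
suff /submxP[u uE] : (y - x <= M)%MS by exists u; rewrite -uE addrC subrK.
apply: contrapT => /negP yM.
have : (i + 1 <= pdim P)%N.
  apply: (pdim_ge (x := x) (M := col_mx M (y - x))) => //.
    move=> j; have [k ->|k ->] := split_ordP j; first by rewrite rowKu.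
    by rewrite rowKd row_id [x + _]addrC subrK.
  exact: row_free_col_mx.
by rewrite Ei addn1 ltnn.
Qed.

Lemma pdim_set0 : pdim (set0 : set 'rV[R]_d) = 0%N.
Proof.
apply/eqP; rewrite -leqn0; apply/bigmax_leqP => r /asboolP[x [M []]]//.
Qed.

Lemma pdim0 P : pdim P = 0%N -> P !=set0 -> exists x, P = [set x].
Proof.
move=> P0 /pdim_span; rewrite P0 => -[x [M [_ Px PM]]]; exists x.
apply/seteqP; split => y; last by move=> ->.
by move=> /PM[u ->] /=; rewrite [u]thinmx0 mul0mx addr0.
Qed.

End Dimension.

Section AffineImage.
Variables (R : realType).

Lemma pdim_affim d e t (N : 'M[R]_(d, e)) A : (pdim (affim t N A) <= \rank N)%N.
Proof. by apply: (@pdim_le _ _ _ _ _ t) => _ [u Au <-]; exists u. Qed.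

Lemma pdim_affim_hyperplane d e t (N : 'M[R]_(d, e)) A a b : a != 0 ->
  A `<=` hyperplane a b -> (pdim (affim t N A) < d)%N.
Proof.
move=> a0 Aab.
have [->|/set0P[x0 Ax0]] := eqVneq A set0.
  rewrite /affim image_set0 pdim_set0; case: d N a a0 A Aab => // N a.
  by rewrite [a]flatmx0 eqxx.
apply: (@leq_ltn_trans (\rank (kermx a *m N))).
  apply: (@pdim_le _ _ _ _ _ (t + x0 *m N)) => _ [x Ax <-].
  have /sub_kermxP/submxP[u uE] : (x - x0) *m a = 0.
    apply/rowP => i; rewrite ord1 [RHS]mxE -[LHS]/(dot _ _) dotBl.
    by have := Aab _ Ax; have := Aab _ Ax0; rewrite /hyperplane/= !affE; lra.
  by exists u; rewrite mulmxA -uE mulmxBl -addrA [x0 *m N + _]addrC subrK.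
apply: (leq_ltn_trans (mxrankM_maxl _ _)).
rewrite mxrank_ker ltn_subrL; have : \rank a != 0%N by rewrite mxrank_eq0.
rewrite lt0n => ->; apply: leq_trans (rank_leq_row a).
by rewrite lt0n mxrank_eq0.
Qed.

Lemma polytope_affim d (P : set 'rV[R]_d) : is_polytope P -> P !=set0 ->
  exists t (N : 'M[R]_(pdim P, d)) Q, [/\ row_free N, is_polytope Q & P = affim t N Q].
Proof.
move=> /is_polytopeP[n [p PE]] /pdim_span[t [N [Nf Pt PN]]]; exists t, N.
have pP i : exists u, p i = t + u *m N by apply: PN; rewrite PE; exact: hull_pt.
have /choice[u uE] := pP.
exists (hull xpredT u); split=> //; first exact: is_polytope_hull.
rewrite {1}PE affim_hull; congr hull; apply/funext => i; exact: uE.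
Qed.

Lemma affim_inj d e t (N : 'M[R]_(d, e)) : row_free N ->
  injective (fun x : 'rV[R]_d => t + x *m N).
Proof. by move=> Nf x y /addrI; exact: row_free_inj. Qed.

Lemma affimI d e t (N : 'M[R]_(d, e)) A B : row_free N ->
  affim t N (A `&` B) = affim t N A `&` affim t N B.
Proof.
move=> Nf; apply/seteqP; split => x.
  by move=> [y [Ay By] <-]; split; exists y.
move=> [[y Ay <-] [z Bz /(affim_inj Nf) zy]]; rewrite zy in Bz; exists y => //.
Qed.

Definition pull (G : zmodType) d e (N : 'M[R]_(d, e)) (mu : set 'rV[R]_e -> G) A :=
  mu (affim 0 N A).

Lemma affim_trans d e t (N : 'M[R]_(d, e)) A : affim t N A = trans t (affim 0 N A).
Proof.
apply/seteqP; split => x.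
  by move=> [y Ay <-]; exists (y *m N) => //; exists y; rewrite ?add0r.
by move=> [_ [y Ay <-] <-]; exists y => //; rewrite add0r.
Qed.

Lemma trans_affim d e t (N : 'M[R]_(d, e)) A :
  affim 0 N (trans t A) = trans (t *m N) (affim 0 N A).
Proof.
rewrite -affim_trans; apply/seteqP; split => x.
  by move=> [_ [y Ay <-] <-]; exists y => //; rewrite mulmxDl add0r.
by move=> [y Ay <-]; exists (t + y); rewrite ?mulmxDl ?add0r//; exists y.
Qed.

Lemma pull_valuation (G : zmodType) d e (N : 'M[R]_(d, e)) (mu : set 'rV[R]_e -> G) :
  row_free N -> set_valuation mu -> set_valuation (pull N mu).
Proof.
move=> Nf [mu0 muU muT]; split.
- by rewrite /pull /affim image_set0.
- move=> A B pA pB pAB; rewrite /pull affimI// /affim image_setU.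
  by apply: muU; rewrite -?image_setU; exact: is_polytope_affim.
- by move=> t A pA; rewrite /pull trans_affim muT//; exact: is_polytope_affim.
Qed.

Lemma pull_simple (G : zmodType) d e (N : 'M[R]_(d, e)) (mu : set 'rV[R]_e -> G) :
  (forall P, is_polytope P -> (pdim P < d)%N -> mu P = 0) -> simple_val (pull N mu).
Proof.
move=> mud A a b pA a0 Aab; apply: mud; first exact: is_polytope_affim.
exact: pdim_affim_hyperplane Aab.
Qed.

Lemma affim_comp c d e s t (M : 'M[R]_(c, d)) (N : 'M[R]_(d, e)) A :
  affim t N (affim s M A) = affim (t + s *m N) (M *m N) A.
Proof.
by rewrite /affim image_comp; apply: eq_imagel => x _ /=; rewrite mulmxDl mulmxA addrA.
Qed.

End AffineImage.

Section Boxes.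
Variable R : realType.

Definition polyhedral d (A : set 'rV[R]_d) := exists L, A = polyhedron L.

Lemma is_polytope_polyhedral d (A B : set 'rV[R]_d) :
  is_polytope A -> polyhedral B -> is_polytope (A `&` B).
Proof. by move=> pA [L ->]; exact: is_polytope_polyhedron. Qed.

Lemma polyhedralT d : polyhedral (setT : set 'rV[R]_d).
Proof. by exists [::]; apply/esym; rewrite -subTset. Qed.

Lemma polyhedralI d (A B : set 'rV[R]_d) :
  polyhedral A -> polyhedral B -> polyhedral (A `&` B).
Proof.
move=> [L ->] [K ->]; exists (L ++ K); apply/seteqP; split => x.
  by move=> [xL xK] f; rewrite mem_cat => /orP[/xL|/xK].
by move=> xLK; split => f fL; apply: xLK; rewrite mem_cat fL ?orbT.
Qed.

Lemma polyhedral_forall d (I : finType) (A : I -> set 'rV[R]_d) :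
  (forall i, polyhedral (A i)) -> polyhedral [set x | forall i, A i x].
Proof.
move=> pA; have /choice[L LE] := pA.
exists (flatten [seq L i | i <- enum I]); apply/seteqP; split => x.
  move=> xA f /flattenP[_ /mapP[i _ ->]] fL.
  by have := xA i; rewrite LE; apply.
move=> xL i; rewrite LE => f fL; apply: xL; apply/flattenP; exists (L i) => //.
by apply/mapP; exists i; rewrite ?mem_enum.
Qed.

Lemma polyhedral_if d (b : bool) (A : set 'rV[R]_d) :
  polyhedral A -> polyhedral [set x | b -> A x].
Proof.
case: b => pA; last first.
  rewrite (_ : [set _ | _] = setT); first exact: polyhedralT.
  by rewrite -subTset.
by rewrite (_ : [set _ | _] = A)//; apply/seteqP; split => x //= ; apply.
Qed.

Lemma polyhedral_halfspace d (a : 'cV[R]_d) b : polyhedral (halfspace a b).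
Proof.
exists [:: (a, b)]; apply/seteqP; split => x.
  by move=> xa f; rewrite inE => /eqP ->.
by move/(_ (a, b)); apply; rewrite mem_head.
Qed.

Lemma polyhedral_preim d e (M : 'M[R]_(d, e)) A :
  polyhedral A -> polyhedral [set x | A (x *m M)].
Proof.
move=> [L ->]; exists [seq (M *m f.1, f.2) | f <- L].
have E f x : affp (M *m f.1, f.2) x = affp f (x *m M).
  by rewrite /affp /aff/= mulmxA.
apply/seteqP; split => x.
  by move=> xL _ /mapP[f fL ->]; rewrite E; exact: xL.
by move=> xL f fL; rewrite -E; apply: xL; apply: map_f.
Qed.

Lemma polyhedral_le d (i j : 'I_d) : polyhedral [set x : 'rV[R]_d | x 0 i <= x 0 j].
Proof.
rewrite (_ : [set _ | _] = halfspace (delta_mx j 0 - delta_mx i 0) 0).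
  exact: polyhedral_halfspace.
by apply/seteqP; split => x; rewrite /halfspace/= affE dotBr !dot_delta addr0 subr_ge0.
Qed.

Lemma polyhedral_lec d (i : 'I_d) c : polyhedral [set x : 'rV[R]_d | x 0 i <= c].
Proof.
rewrite (_ : [set _ | _] = halfspace (- delta_mx i 0) c).
  exact: polyhedral_halfspace.
by apply/seteqP; split => x; rewrite /halfspace/= affE dotNr !dot_delta addrC subr_ge0.
Qed.

Lemma polyhedral_gec d (i : 'I_d) c : polyhedral [set x : 'rV[R]_d | c <= x 0 i].
Proof.
rewrite (_ : [set _ | _] = halfspace (delta_mx i 0) (- c)).
  exact: polyhedral_halfspace.
by apply/seteqP; split => x; rewrite /halfspace/= affE !dot_delta subr_ge0.
Qed.

Lemma polyhedral_band d (i : 'I_d) a b : polyhedral [set x : 'rV[R]_d | a <= x 0 i <= b].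
Proof.
have := polyhedralI (polyhedral_gec i a) (polyhedral_lec i b).
congr polyhedral; apply/seteqP; split => x /=; first by move=> [-> ->].
by move=> /andP.
Qed.

Lemma bounded_polyhedral d (A : set 'rV[R]_d) (N : R) : polyhedral A ->
  (forall x i, A x -> `|x 0 i| <= N) -> is_polytope A.
Proof.
move=> [L AE] AN; pose K := 1 + \sum_(i < d) (N + N).
pose t : 'rV[R]_d := \row_i (- N).
pose p (o : option 'I_d) := if o is Some i then t + K *: delta_mx 0 i else t.
have [A0|/set0P[x0 Ax0]] := eqVneq A set0; first by rewrite A0; exact: is_polytope0.
suff AP : A `<=` hull xpredT p.
  rewrite -(setIidr AP) AE; apply: is_polytope_polyhedron; exact: is_polytope_hull.
move=> x Ax; have xN i : 0 <= x 0 i + N by have := AN x i Ax; rewrite ler_norml; lra.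
have xN' i : x 0 i + N <= N + N by have := AN x i Ax; rewrite ler_norml; lra.
have K0 : 0 < K.
  by apply: ltr_pwDl => //; apply: sumr_ge0 => i _; exact: le_trans (xN i) (xN' i).
pose S := \sum_i (x 0 i + N).
have SK : S <= K by rewrite (@le_trans _ _ (\sum_(i < d) (N + N)))// ?ler_sum// lerDr.
have big_opt (V : nmodType) (F : option 'I_d -> V) :
    \sum_o F o = F None + \sum_i F (Some i).
  rewrite (bigD1 None)//=; congr (_ + _).
  rewrite (reindex_omap (@Some 'I_d) id)//=; first by apply: eq_bigl => i; rewrite eqxx.
  by case.
exists (fun o => if o is Some i then (x 0 i + N) / K else 1 - S / K); split => //.
- by case=> [i|]; [rewrite divr_ge0// ltW|rewrite subr_ge0 ler_pdivrMr ?mul1r].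
- by rewrite big_opt -mulr_suml subrK.
- rewrite big_opt/=; under eq_bigr do rewrite scalerDr scalerA divfK ?gt_eqF//.
  rewrite big_split/= -scaler_suml -mulr_suml addrA -scalerDl subrK scale1r.
  apply/rowP => j; rewrite !mxE summxE (bigD1 j)//= !mxE !eqxx mulr1 big1.
    by rewrite addr0 addrC addrK.
  by move=> i ij; rewrite !mxE eqxx eq_sym (negbTE ij) mulr0.
Qed.

Definition box m (s : 'I_m -> R) : set 'rV[R]_m :=
  [set x | forall i, 0 <= x 0 i <= s i].

Lemma is_polytope_box m (s : 'I_m -> R) : is_polytope (box s).
Proof.
apply: (@bounded_polyhedral _ _ (\sum_i `|s i|)).
  by apply: polyhedral_forall => i; exact: polyhedral_band.
move=> x i /(_ i)/andP[xi xs]; rewrite ger0_norm// (le_trans xs)// (le_trans (ler_norm _))//.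
by rewrite (bigD1 i)//= lerDl sumr_ge0.
Qed.

End Boxes.

Section Multiadditive.
Variables (R : realType) (G : zmodType) (m : nat).
Implicit Types (s : 'I_m -> R) (f : ('I_m -> R) -> G).

Definition upd s i c : 'I_m -> R := fun j => if j == i then c else s j.

Definition nonneg s := forall i, 0 <= s i.

Lemma upd_id s i : upd s i (s i) = s.
Proof. by apply/funext => j; rewrite /upd; case: eqP => // ->. Qed.

Lemma upd_upd s i a b : upd (upd s i a) i b = upd s i b.
Proof. by apply/funext => j; rewrite /upd; case: eqP. Qed.

Lemma updC s i j a b : i != j -> upd (upd s i a) j b = upd (upd s j b) i a.
Proof.
move=> ij; apply/funext => k; rewrite /upd.
by have [->|//] := eqVneq k j; rewrite eq_sym (negbTE ij).
Qed.

Lemma nonneg_upd s i c : nonneg s -> 0 <= c -> nonneg (upd s i c).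
Proof. by move=> s0 c0 j; rewrite /upd; case: eqP. Qed.

Definition additive_at f i := forall s a b, nonneg s -> 0 <= a -> 0 <= b ->
  f (upd s i (a + b)) = f (upd s i a) + f (upd s i b).

Lemma additive_at_mulrn f i s a n : additive_at f i -> nonneg s -> 0 <= a ->
  f (upd s i (a *+ n)) = f (upd s i a) *+ n.
Proof.
move=> fi s0 a0; elim: n => [|n IH].
  have := fi s 0 0 s0 (lexx _) (lexx _); rewrite addr0 => /eqP.
  by rewrite eq_sym -subr_eq0 addrK => /eqP.
by rewrite !mulrS fi ?IH// mulrn_wge0.
Qed.

Definition scale_on (J : pred 'I_m) n s : 'I_m -> R :=
  fun j => if J j then s j *+ n else s j.

Lemma additive_scale_seq f (J : seq 'I_m) s n : uniq J ->
  (forall i, i \in J -> additive_at f i) -> nonneg s ->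
  f (scale_on (mem J) n s) = f s *+ n ^ size J.
Proof.
elim: J s => [|i J IH] s; first by rewrite expn0 mulr1n.
move=> /= /andP[iJ uJ] fJ s0.
have -> : scale_on (mem (i :: J)) n s = upd (scale_on (mem J) n s) i (s i *+ n).
  apply/funext => j; rewrite /scale_on /upd /= inE; case: eqP => [->//|//].
rewrite additive_at_mulrn//.
- rewrite (_ : s i = scale_on (mem J) n s i) ?upd_id; last first.
    by rewrite /scale_on /= (negbTE iJ).
  rewrite IH// => [|j jJ]; first by rewrite -mulrnA expnSr.
  by apply: fJ; rewrite inE jJ orbT.
- by apply: fJ; rewrite mem_head.
- by move=> j; rewrite /scale_on/=; case: ifP => // _; rewrite mulrn_wge0.
Qed.

Lemma additive_scale f (J : pred 'I_m) s n :
  (forall i, J i -> additive_at f i) -> nonneg s ->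
  f (scale_on J n s) = f s *+ n ^ #|J|.
Proof.
move=> fJ s0; rewrite cardE -(@additive_scale_seq _ (enum J)) ?enum_uniq//.
  by congr f; apply/funext => j; rewrite /scale_on/= mem_enum.
by move=> i; rewrite mem_enum; exact: fJ.
Qed.

Definition semiadditive f := forall i s a b, nonneg s -> 0 <= a -> 0 <= b ->
  f (upd s i (a + b)) + f (upd s i 0) = f (upd s i a) + f (upd s i b).

Definition face f i s := f (upd s i 0).

Definition core_part f s := f s - \sum_i face f i s.

(* A box has an [m]-dimensional part, additive in every side, and faces, each
   additive in the remaining sides; codimension two contributes nothing. *)
Hypothesis (f : ('I_m -> R) -> G) (fS : semiadditive f).
Hypothesis f2 : forall s i j, i != j -> nonneg s -> s i = 0 -> s j = 0 -> f s = 0.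

Lemma face_additive i j : i != j -> additive_at (face f i) j.
Proof.
move=> ij s a b s0 a0 b0; rewrite /face -!(@updC _ i j)//.
have si : nonneg (upd s i 0) by exact: nonneg_upd.
rewrite -fS// -[LHS]addr0; congr (_ + _); apply/esym/(@f2 _ i j) => //.
- by apply: nonneg_upd.
- by rewrite /upd (negbTE ij) eqxx.
- by rewrite /upd eqxx.

Qed.

Lemma core_additive i : additive_at (core_part f) i.
Proof.
move=> s a b s0 a0 b0; rewrite /core_part.
have E c : \sum_j face f j (upd s i c) =
    f (upd s i 0) + \sum_(j | j != i) face f j (upd s i c).
  by rewrite (bigD1 i)//= /face upd_upd.
rewrite !E !opprD !addrA.
have -> : \sum_(j | j != i) face f j (upd s i (a + b)) =
    \sum_(j | j != i) face f j (upd s i a) + \sum_(j | j != i) face f j (upd s i b).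
  by rewrite -big_split/=; apply: eq_bigr => j ji; rewrite face_additive// eq_sym.
have := fS i s0 a0 b0; move=> /(canRL (addrK _)) ->.
rewrite opprD !addrA; congr (_ - _).
by rewrite -!addrA; congr (_ + _); rewrite [RHS]addrA [RHS]addrC -[RHS]addrA.
Qed.

Lemma box_expansion s n : nonneg s -> (0 < m)%N ->
  f (fun i => s i *+ n) =
  core_part f s *+ n ^ m + (\sum_i face f i s) *+ n ^ m.-1.
Proof.
move=> s0 m0.
have -> : (fun i => s i *+ n) = scale_on xpredT n s by [].
rewrite -[LHS](subrK (\sum_i face f i (scale_on xpredT n s))); congr (_ + _).
  rewrite -/(core_part f _) additive_scale ?card_ord//.
  by move=> i _; exact: core_additive.
rewrite -sumrMnl; apply: eq_bigr => i _.
have -> : face f i (scale_on xpredT n s) = face f i (scale_on (predC1 i) n s).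
  by congr f; apply/funext => j; rewrite /upd /scale_on/=; case: eqP.
rewrite additive_scale ?cardC1 ?card_ord// => j ji.
by apply: face_additive; rewrite eq_sym.
Qed.

End Multiadditive.

Section BoxValuation.
Variables (R : realType) (G : zmodType).

Lemma box_semiadditive m (mu : set 'rV[R]_m -> G) : set_valuation mu ->
  semiadditive (fun s => mu (box s)).
Proof.
move=> muV i s a b s0 a0 b0 /=.
pose A := box (upd s i (a + b)).
have [_ _ muT] := muV.
have tE c : 0 <= c -> c <= b -> trans (a *: delta_mx 0 i) (box (upd s i c)) =
    [set x | forall j, if j == i then a <= x 0 j <= a + c else 0 <= x 0 j <= s j].
  move=> c0 cb; apply/seteqP; split => x.
    move=> [y yc <-] j; have := yc j; rewrite !mxE eqxx/= /upd.
    by case: eqP => _; rewrite ?mulr1 ?mulr0 ?add0r// lerDl lerD2l.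
  move=> xc; exists (x - a *: delta_mx 0 i); last by rewrite addrC subrK.
  move=> j; have := xc j; rewrite !mxE eqxx/= /upd.
  by case: eqP => _; rewrite ?mulr1 ?mulr0 ?subr0// subr_ge0 lerBlDl.
have affd x : aff (delta_mx i 0) (- a) x = x 0 i - a by rewrite affE dot_delta.
have := val_cut muV (delta_mx i 0) (- a) (is_polytope_box (upd s i (a + b))).
rewrite -/A.
have -> : A `&` hyperplane (delta_mx i 0) (- a) = trans (a *: delta_mx 0 i) (box (upd s i 0)).
  rewrite tE//; apply/seteqP; split => x.
    move=> [xA] /=; rewrite /hyperplane/= affd => /eqP; rewrite subr_eq0 => /eqP xi j.
    have := xA j; rewrite /upd; case: eqP => // ->.
    by rewrite xi addr0 lexx.
  move=> xc; split.
    move=> j; have := xc j; rewrite /upd; case: eqP => // _ /andP[xa xa'].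
    by rewrite (le_trans a0 xa)/= (le_trans xa')// addr0 lerDl.
  have := xc i; rewrite eqxx addr0 => /le_anti xi.
  by rewrite /hyperplane/= affd -xi subrr.
have -> : A `&` halfspace (delta_mx i 0) (- a) = trans (a *: delta_mx 0 i) (box (upd s i b)).
  rewrite tE//; apply/seteqP; split => x.
    move=> [xA] /=; rewrite /halfspace/= affd subr_ge0 => xi j.
    by have := xA j; rewrite /upd; case: eqP => // -> /andP[_ ->]; rewrite xi.
  move=> xc; split.
    move=> j; have := xc j; rewrite /upd; case: eqP => // _ /andP[xa ->].
    by rewrite (le_trans a0 xa).
  by have := xc i; rewrite eqxx /halfspace/= affd subr_ge0 => /andP[].
have -> : A `&` halfspace (- delta_mx i 0) (- - a) = box (upd s i a).
  apply/seteqP; split => x.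
    move=> [xA]; rewrite /halfspace/= affN affd oppr_ge0 subr_le0 => xi j.
    by have := xA j; rewrite /upd; case: eqP => // -> /andP[->].
  move=> xc; split.
    move=> j; have := xc j; rewrite /upd; case: eqP => // _ /andP[-> xa].
    by rewrite (le_trans xa)// lerDl.
  by have := xc i; rewrite /upd eqxx /halfspace/= affN affd oppr_ge0 subr_le0 => /andP[].
by rewrite !muT; [move=> ->; rewrite addrC|exact: is_polytope_box..].
Qed.

Lemma simple_box0 m (mu : set 'rV[R]_m -> G) s i : simple_val mu ->
  s i = 0 -> mu (box s) = 0.
Proof.
move=> muS si; apply: (muS _ (delta_mx i 0) 0).
- exact: is_polytope_box.
- by apply/eqP => /matrixP/(_ i 0)/eqP; rewrite !mxE !eqxx oner_eq0.
- move=> x /(_ i); rewrite si => /le_anti xi.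
  by rewrite /hyperplane/= affE dot_delta addr0 -xi.
Qed.

Lemma simple_box_additive m (mu : set 'rV[R]_m -> G) i :
  set_valuation mu -> simple_val mu -> additive_at (fun s => mu (box s)) i.
Proof.
move=> muV muS s a b s0 a0 b0.
rewrite -(box_semiadditive muV i s0 a0 b0) -[LHS]addr0.
by congr (_ + _); apply/esym/(simple_box0 (i := i)) => //; rewrite /upd eqxx.
Qed.

Lemma simple_box_scale m (mu : set 'rV[R]_m -> G) s n :
  set_valuation mu -> simple_val mu -> nonneg s ->
  mu (box (fun i => s i *+ n)) = mu (box s) *+ n ^ m.
Proof.
move=> muV muS s0.
have := @additive_scale _ _ _ (fun s => mu (box s)) xpredT s n.
rewrite card_ord /scale_on/=; apply=> // i _; exact: simple_box_additive.
Qed.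

Lemma scale_box m (s : 'I_m -> R) (n : nat) : (0 < n)%N ->
  [set n%:R *: x | x in box s] = box (fun i => s i *+ n).
Proof.
move=> n0; have n0R : (0 : R) < n%:R by rewrite ltr0n.
apply/seteqP; split => x.
  move=> [y ys <-] i; have /andP[y0 yi] := ys i; rewrite mxE -[s i *+ n]mulr_natl.
  by rewrite mulr_ge0//= ler_pM2l.
move=> xs; exists (n%:R^-1 *: x); last by rewrite scalerA divff ?gt_eqF// scale1r.
move=> i; have := xs i; rewrite mxE -[s i *+ n]mulr_natl => /andP[x0 xi].
by rewrite mulr_ge0 ?invr_ge0//= ler_pdivrMl.
Qed.

End BoxValuation.

Section HasHrep.
Variable G : zmodType.

Definition has_hrep r (f : nat -> G) := exists h, hrep r f h.

Lemma has_hrepD r f g : has_hrep r f -> has_hrep r g -> has_hrep r (fun n => f n + g n).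
Proof. by move=> [h fh] [k gk]; exists (fun i => h i + k i); exact: hrepD. Qed.

Lemma has_hrep_le r s f : (r <= s)%N -> has_hrep r f -> has_hrep s f.
Proof.
elim: s => [|s IH]; first by rewrite leqn0 => /eqP ->.
rewrite leq_eqVlt => /predU1P[->//|rs] /(IH rs)[h fh].
by exists (hlift s h); exact: hrep_lift.
Qed.

Lemma has_hrep_eq r f g : f =1 g -> has_hrep r f -> has_hrep r g.
Proof. by move=> fg [h fh]; exists h; exact: hrep_eq fh. Qed.

Lemma has_hrep_const r (c : G) : has_hrep r (fun=> c).
Proof. by eexists; exact: hrep_const. Qed.

Lemma has_hrep_sum r f F : has_hrep r f -> (forall n, F n.+1 = F n + f n) ->
  has_hrep r.+1 F.
Proof.
move=> [h fh] FS; apply: (@has_hrep_eq _ (fun n => (F n - F 0%N) + F 0%N)).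
  by move=> n; rewrite subrK.
apply: has_hrepD; last exact: has_hrep_const.
by eexists; exact: hrep_sum FS.
Qed.

End HasHrep.

(** * Simplices *)

Section Chain.
Variables (R : realType) (r : nat).
Implicit Types (Q : set 'rV[R]_r) (y : 'rV[R]_r) (a : R).

Definition trunc_mx k : 'M[R]_r := diag_mx (\row_i (i < k)%:R).

Lemma truncE k y i : (y *m trunc_mx k) 0 i = y 0 i * (i < k)%:R.
Proof. by rewrite mul_mx_diag !mxE. Qed.

(* The coordinates in [k, j[ form a decreasing chain in [0, a], those from [j]
   on vanish, and the first [k] ones are constrained by [Q] only. *)
Definition chain k j a Q : set 'rV[R]_r :=
  [set y | [/\ Q (y *m trunc_mx k), forall i : 'I_r, (j <= i)%N -> y 0 i = 0,
    forall i : 'I_r, (k <= i < j)%N -> 0 <= y 0 i <= a &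
    forall i i' : 'I_r, (k <= i <= i')%N && (i' < j)%N -> y 0 i' <= y 0 i]].

Lemma is_polytope_chain k j a Q : is_polytope Q -> is_polytope (chain k j a Q).
Proof.
move=> pQ; have [N QN] := polytope_bounded pQ.
apply: (@bounded_polyhedral _ _ _ (N%:R + `|a|)).
  suff -> : chain k j a Q = [set y | Q (y *m trunc_mx k)] `&`
     ([set y | forall i : 'I_r, (j <= i)%N -> 0 <= y 0 i <= 0] `&`
     ([set y | forall i : 'I_r, (k <= i < j)%N -> 0 <= y 0 i <= a] `&`
     [set y | forall i : 'I_r, forall i' : 'I_r,
        (k <= i <= i')%N && (i' < j)%N -> y 0 i' <= y 0 i])).
    apply: polyhedralI; first exact/polyhedral_preim/polytope_polyhedron.
    apply: polyhedralI.
      by apply: polyhedral_forall => i; apply: polyhedral_if; exact: polyhedral_band.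
    apply: polyhedralI.
      by apply: polyhedral_forall => i; apply: polyhedral_if; exact: polyhedral_band.
    by do 2 apply: polyhedral_forall => ?; apply: polyhedral_if; exact: polyhedral_le.
  apply/seteqP; split => y.
    move=> [yQ yj ya yy]; split=> //; split=> // i ij /=.
    by rewrite yj ?lexx.
  by move=> [yQ [yj [ya yy]]]; split=> // i ij; apply/esym/le_anti/yj.
move=> y i [yQ yj ya _]; have [ik|ki] := ltnP i k.
  have := QN _ i yQ; rewrite truncE ik mulr1 => /le_trans; apply.
  by rewrite lerDl.
have [ji|ij] := leqP j i; first by rewrite yj// normr0 addr_ge0.
have := ya i; rewrite ki ij => /(_ isT)/andP[y0 yia].
by rewrite ger0_norm// (le_trans yia)// (le_trans (ler_norm _))// lerDr.
Qed.

Definition block k j : 'rV[R]_r := \row_i (k <= i < j)%:R.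

(* Cutting [chain k r n.+1 Q] successively along [y_j = n] for j = k, k+1, ...
   splits off translates of products of chains whose scaled factor [n] has
   smaller dimension; this makes its value polynomial in [n]. *)
Definition peeled k j (n : nat) Q : set 'rV[R]_r :=
  chain k r n.+1%:R Q `&` [set y | forall i : 'I_r, (k <= i < j)%N -> n%:R <= y 0 i].

Lemma peeledE k j n Q : (k <= j)%N -> (j <= r)%N ->
  peeled k j n Q `&` [set y | forall i : 'I_r, i = j :> nat -> y 0 i <= n%:R] =
  trans (n%:R *: block k j) (chain j r n%:R (chain k j 1 Q)).
Proof.
move=> kj jr.
have n0 : (0 : R) <= n%:R by rewrite ler0n.
have nS : n.+1%:R = n%:R + 1 :> R by rewrite -natr1.
have bE i : (n%:R *: block k j) 0 i = if (k <= i < j)%N then n%:R else 0.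
  by rewrite !mxE; case: ifP; rewrite ?mulr1 ?mulr0.
have tb : (n%:R *: block k j) *m trunc_mx k = 0.
  apply/rowP => i; rewrite truncE bE [RHS]mxE; case: ifP; rewrite ?mul0r//.
  by move=> /andP[ki _]; rewrite ltnNge ki mulr0.
have tt (z : 'rV[R]_r) : z *m trunc_mx j *m trunc_mx k = z *m trunc_mx k.
  apply/rowP => i; rewrite !truncE; have [ik|] := ltnP i k; last by rewrite !mulr0.
  by rewrite (leq_trans ik kj) !mulr1.
apply/seteqP; split => y.
- move=> [[[yQ _ ya yy] yn] yj]; exists (y - n%:R *: block k j); last by rewrite addrC subrK.
  have zE i : (y - n%:R *: block k j) 0 i = y 0 i - if (k <= i < j)%N then n%:R else 0.
    by rewrite -bE !mxE.
  split.
  + split.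
    * by rewrite tt mulmxBl tb subr0.
    * by move=> i ji; rewrite truncE ltnNge ji mulr0.
    * move=> i /andP[ki ij]; rewrite truncE ij mulr1 zE ki ij/=.
      have := ya i; rewrite ki ltn_ord => /(_ isT); have := yn i; rewrite ki ij => /(_ isT).
      by rewrite nS => ? /andP[_ ?]; apply/andP; split; lra.
    * move=> i i' /andP[/andP[ki ii'] i'j].
      have ij := leq_ltn_trans ii' i'j; have ki' := leq_trans ki ii'.
      rewrite !truncE ij i'j !mulr1 !zE ki ij ki' i'j lerD2r.
      by apply: yy; rewrite ki ii' ltn_ord.
  + by move=> i; rewrite leqNgt ltn_ord.
  + move=> i /andP[ji _]; have ki := leq_trans kj ji.
    rewrite zE ki ltnNge ji subr0; have := ya i; rewrite ki ltn_ord => /(_ isT)/andP[-> _]/=.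
    have jr' : (j < r)%N by exact: leq_ltn_trans ji (ltn_ord i).
    apply: le_trans (yj (Ordinal jr') erefl); apply: yy.
    by rewrite /= kj ji ltn_ord.
  + move=> i i' /andP[/andP[ji ii'] i'r]; have ji' := leq_trans ji ii'.
    rewrite !zE !(leq_trans kj)// !ltnNge ji ji' !subr0; apply: yy.
    by rewrite (leq_trans kj) ?ii'.
- move=> [z [[zQ _ za zz] _ zn zzn] <-].
  have yE i : (n%:R *: block k j + z) 0 i = (if (k <= i < j)%N then n%:R else 0) + z 0 i.
    by rewrite -bE mxE.
  have zaj (i : 'I_r) : (k <= i < j)%N -> 0 <= z 0 i <= 1.
    by move=> kij; have := za i kij; rewrite truncE; case/andP: kij => _ ->; rewrite mulr1.
  have znj (i : 'I_r) : (j <= i)%N -> 0 <= z 0 i <= n%:R.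
    by move=> ji; apply: zn; rewrite ji ltn_ord.
  split; first split; first split.
  + by rewrite mulmxDl tb add0r -tt.
  + by move=> i; rewrite leqNgt ltn_ord.
  + move=> i /andP[ki _]; rewrite yE ki/=; case: ltnP => [ij|/znj/andP[? ?]].
      have /andP[? ?] : 0 <= z 0 i <= 1 by apply: zaj; rewrite ki.
      by rewrite nS; apply/andP; split; lra.
    by rewrite nS; apply/andP; split; lra.
  + move=> i i' /andP[/andP[ki ii'] _]; have ki' := leq_trans ki ii'.
    rewrite !yE ki ki'/=; have [i'j|ji'] := ltnP i' j.
      have ij := leq_ltn_trans ii' i'j.
      have := zz i i'; rewrite ki ii' i'j !truncE ij i'j !mulr1 => /(_ isT).
      by rewrite lerD2l.
    have /andP[_ z'n] := znj _ ji'; have [ij|ji] := ltnP i j.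
      have /andP[? ?] : 0 <= z 0 i <= 1 by apply: zaj; rewrite ki.
      lra.
    by rewrite lerD2l; apply: zzn; rewrite ji ii' ltn_ord.
  + move=> i /= kij; rewrite yE kij; have /andP[? _] := zaj i kij; lra.
  + move=> i /= ij; rewrite yE ij ltnn andbF add0r.
    by have /andP[] : 0 <= z 0 i <= n%:R by apply: znj; rewrite ij.
Qed.

Lemma peeled_start k n Q : peeled k k n Q = chain k r n.+1%:R Q.
Proof.
apply/seteqP; split => y; first by case.
by move=> yc; split=> // i /andP[ki /(leq_ltn_trans ki)]; rewrite ltnn.
Qed.

Lemma chain_chain0 k a Q : chain k r a (chain k k 1 Q) = chain k r a Q.
Proof.
have tt (z : 'rV[R]_r) : z *m trunc_mx k *m trunc_mx k = z *m trunc_mx k.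
  by apply/rowP => i; rewrite !truncE -mulrA -natrM mulnb andbb.
apply/seteqP; split => y.
  by move=> [[yQ _ _ _] ? ? ?]; split=> //; rewrite -tt.
move=> [yQ ? ? ?]; split=> //; split; rewrite ?tt//.
- by move=> i ki; rewrite truncE ltnNge ki mulr0.
- by move=> i /andP[ki /(leq_ltn_trans ki)]; rewrite ltnn.
- by move=> i i' /andP[/andP[ki ii'] /(leq_ltn_trans (leq_trans ki ii'))]; rewrite ltnn.
Qed.

Lemma is_polytope_peeled k j n Q : is_polytope Q -> is_polytope (peeled k j n Q).
Proof.
move=> pQ; apply: is_polytope_polyhedral; first exact: is_polytope_chain.
by apply: polyhedral_forall => i; apply: polyhedral_if; exact: polyhedral_gec.
Qed.

Variables (G : zmodType) (mu : set 'rV[R]_r -> G).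
Hypotheses (muV : set_valuation mu) (muS : simple_val mu).

Lemma peeled_step k j n Q : is_polytope Q -> (k <= j)%N -> (j < r)%N ->
  mu (peeled k j n Q) =
  mu (chain j r n%:R (chain k j 1 Q)) + mu (peeled k j.+1 n Q).
Proof.
move=> pQ kj jr; pose i0 := Ordinal jr.
have [_ _ muT] := muV.
rewrite (simple_cut muV muS (a := delta_mx i0 0) (- n%:R)); last 2 first.
- exact: is_polytope_peeled.
- by apply/eqP => /matrixP/(_ i0 0)/eqP; rewrite !mxE !eqxx oner_eq0.
rewrite addrC; congr (_ + _).
  rewrite -[RHS](muT (n%:R *: block k j)) -?peeledE// 1?ltnW//; last by do 2 apply: is_polytope_chain.
  congr mu; apply/seteqP; split => y [yp yj]; split=> //.
    move=> i ij; rewrite (_ : i = i0); last exact/val_inj.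
    by move: yj; rewrite /halfspace/= affN affE dot_delta oppr_ge0 subr_le0.
  by rewrite /halfspace/= affN affE dot_delta oppr_ge0 subr_le0; apply: yj.
congr mu; apply/seteqP; split => y.
  move=> [[yc yn]]; rewrite /halfspace/= affE dot_delta subr_ge0 => yj.
  split=> // i /andP[ki]; rewrite ltnS leq_eqVlt => /predU1P[ij|ij].
    by rewrite (_ : i = i0)//; exact/val_inj.
  by apply: yn; rewrite ki.
move=> [yc yn]; split.
  by split=> // i /andP[ki ij]; apply: yn; rewrite ki ltnS ltnW.
by rewrite /halfspace/= affE dot_delta subr_ge0; apply: yn; rewrite /= kj leqnn.
Qed.

Lemma peeled_last k n Q : is_polytope Q -> (k <= r)%N ->
  mu (peeled k r n Q) = mu (chain r r n%:R (chain k r 1 Q)).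
Proof.
move=> pQ kr; have [_ _ muT] := muV.
rewrite -[RHS](muT (n%:R *: block k r)) -?peeledE//; last by do 2 apply: is_polytope_chain.
congr mu; apply/seteqP; split => y; last by case.
by move=> yp; split=> // i ir; have := ltn_ord i; rewrite ir ltnn.
Qed.

Lemma chain_last a b Q : chain r r a Q = chain r r b Q.
Proof.
by apply/seteqP; split => y [yQ y0 ya yy]; split=> // i;
  rewrite andbC ltnNge; case: leqP.
Qed.

Lemma chain_hrep k Q : (k <= r)%N -> is_polytope Q ->
  has_hrep (r - k) (fun n => mu (chain k r n%:R Q)).
Proof.
move: {2}(r - k)%N (leqnn (r - k)) => m; elim: m k Q => [|m IH] k Q rkm kr pQ.
  have -> : k = r by apply/eqP; rewrite eqn_leq kr -subn_eq0 -leqn0.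
  rewrite (_ : (fun n => _) = (fun=> mu (chain r r 0 Q))); first exact: has_hrep_const.
  by apply/funext => n; rewrite (chain_last _ 0).
move: kr; rewrite leq_eqVlt => /predU1P[->|kr].
  rewrite (_ : (fun n => _) = (fun=> mu (chain r r 0 Q))); first exact: has_hrep_const.
  by apply/funext => n; rewrite (chain_last _ 0).
have H j : (k < j <= r)%N -> has_hrep (r - k).-1 (fun n => mu (peeled k j n Q)).
  move: {2}(r - j)%N (leqnn (r - j)) => l; elim: l j => [|l IHl] j rjl /andP[kj jr].
    have -> : j = r by apply/eqP; rewrite eqn_leq jr -subn_eq0 -leqn0.
    apply: has_hrep_eq (fun n => esym (peeled_last n pQ (ltnW kr))) _.
    apply: (@has_hrep_le _ (r - r)%N); first by rewrite subnn.
    by apply: IH => //; [lia|exact: is_polytope_chain].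
  move: jr; rewrite leq_eqVlt => /predU1P[jr|jr].
    by apply: IHl; rewrite ?jr ?subnn// kr leqnn.
  apply: has_hrep_eq (fun n => esym (peeled_step n pQ (ltnW kj) jr)) _.
  apply: has_hrepD; last by apply: IHl; lia.
  apply: (@has_hrep_le _ (r - j)%N); first lia.
  by apply: IH; [lia|exact: ltnW|exact: is_polytope_chain].
have -> : (r - k = (r - k).-1.+1)%N by lia.
apply: has_hrep_sum (H k.+1 _) _; first by rewrite leqnn.
by move=> n; rewrite -peeled_start peeled_step// chain_chain0.
Qed.

End Chain.

Section Simplex.
Variable R : realType.

Definition std_chain r : set 'rV[R]_r := chain 0 r 1 [set 0].

Definition dil d (n : nat) (A : set 'rV[R]_d) : set 'rV[R]_d := [set n%:R *: x | x in A].

Lemma chain_set0E r a (y : 'rV[R]_r) : chain 0 r a [set 0] y <->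
  (forall i, 0 <= y 0 i <= a) /\ (forall i i' : 'I_r, (i <= i')%N -> y 0 i' <= y 0 i).
Proof.
split.
  move=> [_ _ ya yy]; split=> [i|i i' ii']; first by apply: ya; rewrite ltn_ord.
  by apply: yy; rewrite ii' ltn_ord.
move=> [ya yy]; split=> //.
- by apply/rowP => i; rewrite truncE ltn0 mulr0 mxE.
- by move=> i; rewrite leqNgt ltn_ord.
- by move=> i i' /andP[ii' _]; apply: yy.
Qed.

Lemma dil0 d (A : set 'rV[R]_d) : A !=set0 -> dil 0 A = [set 0].
Proof.
move=> [x Ax]; apply/seteqP; split => y; first by move=> [z _ <-]; rewrite scale0r.
by move=> ->; exists x; rewrite ?scale0r.
Qed.

Lemma is_polytope_dil d n (A : set 'rV[R]_d) : is_polytope A -> is_polytope (dil n A).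
Proof. exact: is_polytope_dilate. Qed.

Lemma dil_affim d e n (N : 'M[R]_(d, e)) A : dil n (affim 0 N A) = affim 0 N (dil n A).
Proof.
apply/seteqP; split => x.
  move=> [_ [y Ay <-] <-]; exists (n%:R *: y); first by exists y.
  by rewrite !add0r scalemxAl.
move=> [_ [y Ay <-] <-]; exists (y *m N); first by exists y; rewrite ?add0r.
by rewrite add0r scalemxAl.
Qed.

Lemma std_chain0 r : @std_chain r 0.
Proof. by apply/chain_set0E; split => [i|i i' _]; rewrite !mxE ?lexx ?ler01. Qed.

Lemma dil_std_chain r n : dil n (@std_chain r) = chain 0 r n%:R [set 0].
Proof.
have [->|n0] := posnP n.
  rewrite dil0; last by exists 0; exact: std_chain0.
  apply/seteqP; split => y.
    by move=> ->; apply/chain_set0E; split=> [i|i i' _]; rewrite !mxE lexx.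
  by move=> /chain_set0E[y0 _]; apply/rowP => i; rewrite mxE; apply/esym/le_anti/y0.
have n0R : (0 : R) < n%:R by rewrite ltr0n.
apply/seteqP; split => y.
  move=> [z /chain_set0E[z1 zz] <-]; apply/chain_set0E; split=> [i|i i' ii']; rewrite !mxE.
    by have /andP[? ?] := z1 i; rewrite mulr_ge0//= ger_pMr.
  by rewrite ler_pM2l// zz.
move=> /chain_set0E[y1 yy]; exists (n%:R^-1 *: y); last by rewrite scalerA divff ?gt_eqF// scale1r.
apply/chain_set0E; split=> [i|i i' ii']; rewrite !mxE.
  have /andP[? ?] := y1 i; rewrite mulr_ge0 ?invr_ge0//= ler_pdivrMl// mulr1//.
by rewrite ler_pM2l ?invr_gt0// yy.
Qed.

Definition chain_vertex r (k : 'I_(r + 1)) : 'rV[R]_r := \row_i (i < k)%:R.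

Lemma hull_std_chain r : hull xpredT (@chain_vertex r) = @std_chain r.
Proof.
apply/seteqP; split => x.
- move=> [w [w0 _ w1 ->]]; apply/chain_set0E; split=> [i|i i' ii'].
    rewrite summxE; apply/andP; split.
      by apply: sumr_ge0 => k _; rewrite !mxE mulr_ge0.
    by rewrite -w1; apply: ler_sum => k _; rewrite !mxE ler_piMr// lern1; case: (_ < _)%N.
  rewrite !summxE; apply: ler_sum => k _; rewrite !mxE ler_wpM2l// ler_nat.
  by case: (ltnP i' k) => // ik; rewrite (leq_ltn_trans ii' ik).
- move=> /chain_set0E[x1 xx].
  pose g (k : nat) : R := if k is k'.+1 then
    (if insub k' is Some i then x 0 i else 0) else 1.
  have gS (i : 'I_r) : g i.+1 = x 0 i.
    by rewrite /g insubT// => ?; congr (x 0 _); apply/val_inj.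
  have gr : g r.+1 = 0 by rewrite /g insubF// ltnn.
  have g0 k : 0 <= g k.
    rewrite /g; case: k => [|k]; first exact: ler01.
    by case: insubP => // i _ _; have /andP[] := x1 i.
  have gd k : (k < r.+1)%N -> g k.+1 <= g k.
    rewrite ltnS leq_eqVlt => /predU1P[->|kr]; first by rewrite gr.
    rewrite (gS (Ordinal kr)); case: k kr => [|k] kr.
      by have /andP[] := x1 (Ordinal kr).
    by rewrite (gS (Ordinal (ltnW kr))); apply: xx.
  have tel a b : (a <= b)%N -> \sum_(a <= k < b) (g k - g k.+1) = g a - g b.
    move=> ab; rewrite -[RHS]opprB -(telescope_sumr g ab) -sumrN.
    by apply: eq_bigr => k _; rewrite opprB.
  exists (fun k : 'I_(r + 1) => g k - g k.+1); split => //.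
  + by move=> k; rewrite subr_ge0 gd// (leq_trans (ltn_ord k))// addn1.
  + by rewrite -(big_mkord xpredT (fun k => g k - g k.+1)) tel// addn1 gr subr0.
  + apply/rowP => i; rewrite summxE -gS.
    under eq_bigr do rewrite !mxE.
    rewrite -(big_mkord xpredT (fun k => (g k - g k.+1) * (i < k)%:R)).
    rewrite (@big_cat_nat _ _ _ i.+1)/=; [|by []|by rewrite addn1 ltnS ltnW].
    rewrite big_nat_cond big1 ?add0r; last first.
      by move=> k; rewrite andbT /= ltnS leqNgt => /negbTE ->; rewrite mulr0.
    rewrite (@eq_big_nat _ _ _ _ _ _ (fun k => g k - g k.+1)).
      by rewrite tel ?addn1 ?ltnS 1?ltnW// gr subr0.
    by move=> k /andP[-> _]; rewrite mulr1.
Qed.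

Lemma simplex_affim r (p : 'I_(r + 1) -> 'rV[R]_r) : homog_mx p \in unitmx ->
  exists t (N : 'M[R]_r), N \in unitmx /\ hull xpredT p = affim t N (@std_chain r).
Proof.
move=> pu; have r1 : (0 < r + 1)%N by rewrite addn1.
pose q k := if insub k is Some i then p i else 0.
have qE (i : 'I_(r + 1)) : q i = p i by rewrite /q valK.
pose N : 'M[R]_r := \matrix_i (q i.+1 - q i).
have qk (k : 'I_(r + 1)) : p k = q 0%N + chain_vertex k *m N.
  have -> : chain_vertex k *m N = \sum_(i < r | (i < k)%N) (q i.+1 - q i).
    rewrite mulmx_sum_row [RHS]big_mkcond/=; apply: eq_bigr => i _.
    by rewrite rowK mxE; case: ifP; rewrite ?scale1r ?scale0r.
  have kr : (k <= r)%N by rewrite -ltnS (leq_trans (ltn_ord k))// addn1.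
  rewrite -(big_ord_widen r (fun i => q i.+1 - q i) kr) -(big_mkord xpredT (fun i => q i.+1 - q i)).
  by rewrite telescope_sumr// addrC subrK qE.
exists (q 0%N), N; split; last first.
  by rewrite -hull_std_chain affim_hull; congr hull; apply/funext => k.
rewrite -unitmx_tr -row_free_unit -kermx_eq0; apply/negPn/negP.
move=> /rowV0Pn[v /sub_kermxP vN v0].
have Nv : N *m v^T = 0 by rewrite -[N]trmxK -trmx_mul vN trmx0.
pose c : 'cV[R]_(r + 1) := col_mx v^T (- dot (q 0%N) v^T)%:M.
have : homog_mx p *m c = 0.
  apply/colP => k; rewrite homog_mx_mul [RHS]mxE /unhomog col_mxKu col_mxKd.
  rewrite /affp affE/= mxE mulr1n qk dotDl addrAC subrr add0r.
  by rewrite /dot -mulmxA Nv mulmx0 mxE.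
move=> /(congr1 (mulmx (invmx (homog_mx p)))); rewrite mulKmx// mulmx0 => c0.
move: v0; rewrite -[v]trmxK (_ : v^T = 0) ?trmx0 ?eqxx//.
by rewrite -[v^T](col_mxKu _ (- dot (q 0%N) v^T)%:M) -/c c0 linear0.
Qed.

Lemma std_chain_box1 r : @std_chain r `<=` box (fun=> 1).
Proof. by move=> x /chain_set0E[x1 _] i; exact: x1. Qed.

Lemma box_std_chain r : exists c : 'rV[R]_r,
  trans c (box (fun=> r%:R^-1)) `<=` @std_chain r.
Proof.
exists (\row_i ((r - i.+1)%:R / r%:R)) => _ [x xb <-]; apply/chain_set0E.
have [r0|r0] := posnP r; first by split=> i; have := ltn_ord i; rewrite {2}r0.
have r0R : (0 : R) < r%:R by rewrite ltr0n.
have E (i : 'I_r) : ((r - i.+1)%:R / r%:R + r%:R^-1 : R) = (r - i)%:R / r%:R.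
  by rewrite -{2}[r%:R^-1]mul1r -mulrDl natr1 -subSn// subSS.
split=> [i|i i' ii']; rewrite !mxE.
  have /andP[x0 xr] := xb i; rewrite addr_ge0 ?divr_ge0//=.
  rewrite (@le_trans _ _ ((r - i.+1)%:R / r%:R + r%:R^-1))// ?lerD2l//.
  by rewrite E ler_pdivrMr// mul1r ler_nat leq_subr.
move: ii'; rewrite leq_eqVlt => /predU1P[/val_inj ->//|ii'].
have /andP[x0 _] := xb i; have /andP[_ xr] := xb i'.
rewrite (@le_trans _ _ ((r - i'.+1)%:R / r%:R + r%:R^-1))// ?lerD2l//.
rewrite E (@le_trans _ _ ((r - i.+1)%:R / r%:R))// ?lerDl//.
by rewrite ler_pM2r ?invr_gt0// ler_nat leq_sub2l.
Qed.

Lemma is_polytope_std_chain r : is_polytope (@std_chain r).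
Proof. exact/is_polytope_chain/is_polytope1. Qed.

Lemma pdim_affim_box d m (N : 'M[R]_(m, d)) (s : 'I_m -> R) t : row_free N ->
  (forall i, 0 < s i) -> pdim (affim t N (box s)) = m.
Proof.
move=> Nf s0; apply/eqP; rewrite eqn_leq; apply/andP; split.
  by rewrite (leq_trans (pdim_affim _ _ _))// (eqnP Nf).
pose M := diag_mx (\row_i s i).
have Mu : M \in unitmx.
  rewrite unitmxE det_diag unitfE; apply/prodf_neq0 => i _.
  by rewrite mxE gt_eqF.
apply: (pdim_ge (x := t) (M := M *m N)).
- by exists 0; rewrite ?mul0mx ?addr0// => i; rewrite mxE lexx ltW.
- move=> i; exists (row i M); last by rewrite row_mul.
  move=> j; rewrite !mxE; case: eqP => [->|_]; first by rewrite mulr1n lexx ltW.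
  by rewrite mulr0n lexx ltW.
- by rewrite /row_free mxrankMfree// mxrank_unit.
Qed.

End Simplex.

Section ClosedCone.
Variables (R : realType) (G : vectType R) (C : set G).

Lemma cone_archimedean (x y : G) : vect_closed C ->
  (forall k, C (k.+1%:R^-1 *: x + y)) -> C y.
Proof.
move=> Ccl Cxy; rewrite -[y]v2rK.
suff : ((r2v : 'rV[R]_(dim G) -> G) @^-1` C) (v2r y) by [].
apply: (@closed_cvg _ _ \oo _ (fun k : nat => k.+1%:R^-1 *: v2r x + v2r y) _ Ccl).
  by apply: nearW => k; rewrite /preimage/= linearP/= !v2rK.
rewrite -[X in _ --> X]add0r -(scale0r (v2r x)).
apply: cvgD; last exact: cvg_cst.
apply: cvgZr_tmp; exact: cvg_harmonic.
Qed.

End ClosedCone.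

(** * Positivity and vanishing in small dimension *)

Section Cone.
Variables (R : realType) (G : lmodType R) (C : set G).
Hypothesis Ccone : convex_cone C.

Lemma cone0 : C 0. Proof. by case: Ccone. Qed.

Lemma coneD x y : C x -> C y -> C (x + y). Proof. by case: Ccone => _ H _; exact: H. Qed.

Lemma coneZ a x : 0 <= a -> C x -> C (a *: x). Proof. by case: Ccone => _ _; exact. Qed.

Lemma coneMn x n : C x -> C (x *+ n).
Proof. by move=> Cx; rewrite -scaler_nat; apply: coneZ. Qed.

Lemma cone_pMn x n : (0 < n)%N -> C (x *+ n) -> C x.
Proof.
move=> n0 Cx; rewrite -[x](@scalerK _ _ (n%:R : R)) ?pnatr_eq0 -?lt0n//.
by rewrite scaler_nat; apply: coneZ; rewrite ?invr_ge0.
Qed.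

Lemma cone_sum (I : Type) (r : seq I) (P : pred I) (F : I -> G) :
  (forall i, P i -> C (F i)) -> C (\sum_(i <- r | P i) F i).
Proof. by move=> CF; apply: big_ind => //; [exact: cone0|exact: coneD]. Qed.

Lemma pointed_eq0 x : pointed_cone C -> C x -> C (- x) -> x = 0.
Proof.
by move=> /seteqP[+ _] => /(_ x); rewrite /= => H Cx Cnx; apply: H.
Qed.

End Cone.

Section Stage.
Variables (R : realType) (d : nat) (G : vectType R) (C : set G).
Hypotheses (Ccone : convex_cone C) (Cptd : pointed_cone C) (Ccl : vect_closed C).
Variable mu : set 'rV[R]_d -> G.
Hypothesis muV : set_valuation mu.

Definition hmono := forall P Q h k, is_polytope P -> is_polytope Q -> P !=set0 ->
  P `<=` Q -> pdim P = pdim Q ->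
  hrep (pdim P) (fun n => mu (dil n P)) h -> hrep (pdim Q) (fun n => mu (dil n Q)) k ->
  forall i, (i <= pdim P)%N -> C (k i - h i).

Definition vanish_below r := forall P, is_polytope P -> (pdim P < r)%N -> mu P = 0.

Lemma hrep1 r f (h : nat -> G) : (0 < r)%N -> hrep r f h -> f 0%N = 0 -> h 1%N = f 1%N.
Proof.
case: r => // r _ fh; have := fh 0%N; have := fh 1%N; rewrite !big_ord_recl/=.
rewrite !add0n !subn0 binn !mulr1n !big1 ?addr0.
- rewrite /bump/= addn0 subn1/=.
  rewrite (@bin_small r)// mulr0n addr0.
  by move=> f1 f00 f0; rewrite f1 -f00 f0 mul0rn add0r.
- by move=> i _; rewrite bin_small// /bump/=; lia.
- by move=> i _; rewrite bin_small// /bump/=; lia.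
Qed.

Lemma dil1 (P : set 'rV[R]_d) : dil 1 P = P.
Proof.
apply/seteqP; split => x; first by move=> [y Py <-]; rewrite scale1r.
by move=> Px; exists x; rewrite ?scale1r.
Qed.

Lemma pdim_set1 (x : 'rV[R]_d) : pdim [set x] = 0%N.
Proof.
apply/eqP; rewrite -leqn0.
apply: (@leq_trans (\rank (0 : 'M[R]_(0, d)))); last by rewrite mxrank0.
by apply: (@pdim_le _ _ _ _ _ x) => y ->; exists 0; rewrite mul0mx addr0.
Qed.

Lemma dil_box m n (s : 'I_m -> R) : nonneg s -> dil n (box s) = box (fun i => s i *+ n).
Proof.
move=> s0; have [->|] := posnP n; last exact: scale_box.
rewrite dil0; last by exists 0 => i; rewrite mxE lexx s0.
apply/seteqP; split => [x -> i|x xs]; first by rewrite mxE mulr0n lexx.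
by apply/rowP => i; rewrite mxE; apply/esym/le_anti/xs.
Qed.

Hypothesis muM : hmono.

Variable r : nat.
Hypotheses (r0 : (0 < r)%N) (mur : vanish_below r).

Lemma mu0 x : mu [set x] = 0.
Proof. by apply: mur; [exact: is_polytope1|rewrite pdim_set1]. Qed.

(* [h_1 P = mu P] because [mu] vanishes on points. *)
Lemma h1_mono P Q : is_polytope P -> is_polytope Q -> P !=set0 -> P `<=` Q ->
  pdim P = r -> pdim Q = r ->
  has_hrep r (fun n => mu (dil n P)) -> has_hrep r (fun n => mu (dil n Q)) ->
  C (mu Q - mu P).
Proof.
move=> pP pQ P0 PQ dP dQ [h hP] [k kQ].
have Q0 : Q !=set0 by case: P0 => x /PQ; exists x.
have := muM pP pQ P0 PQ; rewrite dP dQ => /(_ h k erefl hP kQ 1%N r0).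
by rewrite (hrep1 r0 hP) ?(hrep1 r0 kQ) ?dil1// dil0// mu0.
Qed.

Section Image.
Variable N : 'M[R]_(r, d).
Hypothesis Nf : row_free N.

Let psi := pull N mu.

Lemma psiV : set_valuation psi. Proof. exact: pull_valuation. Qed.

Lemma psiS : simple_val psi. Proof. exact: pull_simple. Qed.

Lemma box_hrep s : nonneg s -> has_hrep r (fun n => mu (dil n (affim 0 N (box s)))).
Proof.
move=> s0; exists (fun i => psi (box s) *+ eul r i).
apply: hrep_eq (hrep_exp _ _) => n.
rewrite dil_affim dil_box// -[RHS]/(psi _) simple_box_scale//; [exact: psiV|exact: psiS].
Qed.

Lemma chain_psi_hrep : has_hrep r (fun n => mu (dil n (affim 0 N (@std_chain R r)))).
Proof.
have := @chain_hrep R r G psi psiV psiS 0%N [set 0] (leq0n r) (@is_polytope1 _ _ _).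
by rewrite subn0; apply: has_hrep_eq => n; rewrite dil_affim dil_std_chain.
Qed.

Lemma box_nonempty m (s : 'I_m -> R) : nonneg s -> box s !=set0.
Proof. by move=> s0; exists 0 => i; rewrite mxE lexx s0. Qed.

Lemma affim_nonempty m t (M : 'M[R]_(m, d)) A : A !=set0 -> affim t M A !=set0.
Proof. by move=> [x Ax]; exists (t + x *m M); exists x. Qed.

Lemma affim_sub m t (M : 'M[R]_(m, d)) A B : A `<=` B -> affim t M A `<=` affim t M B.
Proof. by move=> AB _ [x /AB Bx <-]; exists x. Qed.

Lemma box_pos s : (forall i, 0 < s i) -> C (psi (box s)).
Proof.
move=> s0; pose s2 i := s i / 2.
have s20 i : 0 < s2 i by rewrite divr_gt0.
have E : psi (box s) = psi (box s2) *+ 2 ^ r.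
  rewrite -simple_box_scale; [|exact: psiV|exact: psiS|by move=> i; exact: ltW].
  congr (psi (box _)); apply/funext => i.
  by rewrite /s2 -[RHS]mulr_natr divfK.
have : C (psi (box s) - psi (box s2)).
  apply: h1_mono; rewrite ?pdim_affim_box//.
  - exact/is_polytope_affim/is_polytope_box.
  - exact/is_polytope_affim/is_polytope_box.
  - by apply/affim_nonempty/box_nonempty => i; exact: ltW.
  - apply: affim_sub => x xs i; have /andP[-> xi] := xs i.
    by rewrite (le_trans xi)// ler_pdivrMr// ler_peMr ?(ltW (s0 i))// ler1n.
  - by apply: box_hrep => i; exact: ltW.
  - by apply: box_hrep => i; exact: ltW.
rewrite E -{2}[psi _]mulr1n -mulrnBr ?expn_gt0// => /cone_pMn H.
by apply: coneMn => //; apply: H; rewrite // subn_gt0 -{1}(expn0 2) ltn_exp2l.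
Qed.

Lemma pdim_chain : pdim (affim 0 N (@std_chain R r)) = r.
Proof.
have [c cP] := @box_std_chain R r.
apply/eqP; rewrite eqn_leq; apply/andP; split.
  by rewrite (leq_trans (pdim_affim _ _ _))// (eqnP Nf).
rewrite -{1}(@pdim_affim_box _ _ _ N (fun=> r%:R^-1) (c *m N) Nf); last first.
  by move=> i; rewrite invr_gt0 ltr0n.
by rewrite affim_trans -trans_affim; apply/pdim_sub/affim_sub.
Qed.

Lemma chain_nonempty : @std_chain R r !=set0.
Proof. by exists 0; exact: std_chain0. Qed.

Lemma chain_pos : C (psi (@std_chain R r)).
Proof.
have [c cP] := @box_std_chain R r.
have r0R : (0 : R) < r%:R^-1 by rewrite invr_gt0 ltr0n.
pose B := affim (c *m N) N (box (fun=> r%:R^-1)).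
have BE : B = affim 0 N (trans c (box (fun=> r%:R^-1))).
  by rewrite /B affim_trans -trans_affim.
have pB := is_polytope_box (fun _ : 'I_r => r%:R^-1 : R).
have [_ _ psiT] := psiV.
have muB : mu B = psi (box (fun=> r%:R^-1)).
  by rewrite BE -[LHS]/(psi _) psiT.
have : C (psi (@std_chain R r) - mu B).
  apply: h1_mono; rewrite ?pdim_affim_box// ?pdim_chain//.
  - exact: is_polytope_affim.
  - exact/is_polytope_affim/is_polytope_std_chain.
  - by apply/affim_nonempty/box_nonempty => i; exact: ltW.
  - by rewrite BE; exact: affim_sub.
  - have [h hP] := @box_hrep (fun=> r%:R^-1) (fun=> ltW r0R).
    exists h; apply: hrep_eq hP => n.
    have [_ _ muT] := muV.
    rewrite -(muT (n%:R *: (c *m N))); last first.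
      by apply: is_polytope_dil; apply: is_polytope_affim.
    congr mu; rewrite /B (affim_trans (c *m N)); apply/seteqP; split => x.
      by move=> [_ [y By <-] <-]; exists (c *m N + y); [exists y|rewrite scalerDr].
    move=> [_ [y By <-] <-]; exists (n%:R *: y); last by rewrite scalerDr.
    by exists y.
  - exact: chain_psi_hrep.
by move=> /coneD; rewrite -[X in C X](subrK (mu B)); apply => //; rewrite muB; apply: box_pos.
Qed.

Lemma chain_le_box : C (psi (box (fun=> 1)) - psi (@std_chain R r)).
Proof.
apply: h1_mono; rewrite ?pdim_affim_box// ?pdim_chain//.
- exact/is_polytope_affim/is_polytope_std_chain.
- exact/is_polytope_affim/is_polytope_box.
- exact/affim_nonempty/chain_nonempty.
- exact/affim_sub/std_chain_box1.
- exact: chain_psi_hrep.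
- by apply: box_hrep => i; exact: ler01.
Qed.

End Image.

Lemma pull_ind (N : 'M[R]_(r, d)) (E : G -> Prop) : row_free N -> E 0 ->
  (forall x y, E x -> E y -> E (x + y)) ->
  (forall M : 'M[R]_(r, d), row_free M -> E (pull M mu (@std_chain R r))) ->
  forall A, is_polytope A -> E (pull N mu A).
Proof.
move=> Nf E0 ED EM; apply: triangulation => //; [exact: psiV|exact: psiS|].
move=> p /simplex_affim[t [M [Mu ->]]].
have [_ _ muT] := muV.
rewrite /pull affim_comp add0r affim_trans muT.
  apply: EM; rewrite /row_free mxrankMfree ?mxrank_unit//.
exact/is_polytope_affim/is_polytope_std_chain.
Qed.

Lemma val_pos P : is_polytope P -> (pdim P <= r)%N -> C (mu P).
Proof.
move=> pP; rewrite leq_eqVlt => /predU1P[Pr|/(mur pP) ->]; last exact: cone0.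
have [->|/set0P P0] := eqVneq P set0; first by case: muV => -> _ _; exact: cone0.
have := polytope_affim pP P0; rewrite Pr => -[t [N [Q [Nf pQ ->]]]].
have [_ _ muT] := muV.
rewrite affim_trans muT; last exact: is_polytope_affim.
rewrite -/(pull N mu Q); apply: pull_ind => //; first exact: cone0.
  by move=> ? ?; apply: coneD.
by move=> M; exact: chain_pos.
Qed.

Lemma vanish_next : (forall M : 'M[R]_(r, d), row_free M ->
    pull M mu (box (fun=> 1)) = 0) -> vanish_below r.+1.
Proof.
move=> mubox P pP; rewrite ltnS leq_eqVlt => /predU1P[Pr|/(mur pP) ->//].
have [->|/set0P P0] := eqVneq P set0; first by case: muV => -> _ _.
have := polytope_affim pP P0; rewrite Pr => -[t [N [Q [Nf pQ ->]]]].
have [_ _ muT] := muV.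
rewrite affim_trans muT; last exact: is_polytope_affim.
rewrite -/(pull N mu Q); apply: (pull_ind (E := fun x => x = 0)) => //.
  by move=> ? ? -> ->; rewrite addr0.
move=> M Mf; apply: (pointed_eq0 Cptd); first exact: chain_pos.
by have := chain_le_box Mf; rewrite mubox// sub0r.
Qed.

End Stage.

Section Extension.
Variables (R : realType) (d : nat).

Lemma box_face m (N : 'M[R]_(m.+1, d)) (s : 'I_m.+1 -> R) i : s i = 0 ->
  affim 0 N (box s) = affim 0 (row' i N) (box (fun k => s (lift i k))).
Proof.
move=> si.
have E (x : 'rV[R]_m.+1) : x 0 i = 0 -> x *m N = col' i x *m row' i N.
  move=> xi; apply/rowP => j; rewrite !mxE (bigD1_ord i)//= xi mul0r add0r.
  by apply: eq_bigr => k _; rewrite !mxE.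
apply/seteqP; split => y.
  move=> [x xs <-]; have xi : x 0 i = 0 by have := xs i; rewrite si => /le_anti.
  by exists (col' i x); rewrite ?E// => k; rewrite mxE.
move=> [x xs <-]; pose z : 'rV[R]_m.+1 := \row_j (if unlift i j is Some k then x 0 k else 0).
have zE : col' i z = x by apply/rowP => k; rewrite !mxE liftK.
exists z; last by rewrite E ?zE// mxE unlift_none.
by move=> j; rewrite mxE; case: unliftP => [k ->|->]; rewrite ?si ?lexx.
Qed.

Lemma extend_row_free m (N0 : 'M[R]_(m, d)) : row_free N0 -> (m < d)%N ->
  exists N : 'M[R]_(m.+1, d), row_free N /\ row' ord_max N = N0.
Proof.
move=> Nf md.
have : ~~ row_full N0 by rewrite /row_full (eqnP Nf) ltn_eqF.
rewrite -sub1mx => /row_subPn[i]; set v := row i _ => vN.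
exists (\matrix_i (if unlift ord_max i is Some j then row j N0 else v)); split; last first.
  by apply/row_matrixP => j; apply/rowP => k; rewrite !mxE liftK mxE.
set N := \matrix_i _.
have := row_free_col_mx Nf vN; rewrite /row_free => /eqP cE.
have : (col_mx N0 v <= N)%MS.
  rewrite col_mx_sub; apply/andP; split.
    apply/row_subP => j; rewrite (_ : row j N0 = row (lift ord_max j) N) ?row_sub//.
    by rewrite rowK liftK.
  by rewrite (_ : v = row ord_max N) ?row_sub// rowK unlift_none.
by move/mxrankS; rewrite cE addn1 eqn_leq rank_leq_row.
Qed.

End Extension.

Section NextStage.
Variables (R : realType) (d : nat) (G : vectType R) (C : set G).
Hypotheses (Ccone : convex_cone C) (Cptd : pointed_cone C) (Ccl : vect_closed C).
Variable mu : set 'rV[R]_d -> G.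
Hypotheses (muV : set_valuation mu) (muM : hmono C mu).
Variable r : nat.
Hypotheses (r0 : (0 < r)%N) (mur : vanish_below mu r).

Let subrDA (x y z : G) : x - (y + z) = x - y - z.
Proof. by rewrite opprD addrA. Qed.

Section Prism.
Variables (N : 'M[R]_(r.+1, d)) (Nf : row_free N).

Let f s := pull N mu (box s).

Lemma prism_semiadditive : semiadditive f.
Proof. exact/box_semiadditive/pull_valuation. Qed.

Lemma prism_two_zeros s i j : i != j -> nonneg s -> s i = 0 -> s j = 0 -> f s = 0.
Proof.
move=> ij _ si sj; rewrite /f /pull (box_face _ si); apply: mur.
  exact/is_polytope_affim/is_polytope_box.
have [k jE] : exists k, j = lift i k by case: (unliftP i j) ij => [k ->|->]; [exists k|rewrite eqxx].
apply: (@pdim_affim_hyperplane _ _ _ _ _ _ (delta_mx k 0) 0).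
  by apply/eqP => /matrixP/(_ k 0)/eqP; rewrite !mxE !eqxx oner_eq0.
move=> x /(_ k); rewrite -jE sj => /le_anti xk.
by rewrite /hyperplane/= affE dot_delta addr0 -xk.
Qed.

Lemma prism_hrep s : nonneg s ->
  hrep r.+1 (fun n => mu (dil n (affim 0 N (box s))))
    (fun i => core_part f s *+ eul r.+1 i +
              hlift r (fun i => (\sum_j face f j s) *+ eul r i) i).
Proof.
move=> s0; have := hrepD (hrep_exp r.+1 (core_part f s))
  (hrep_lift (hrep_exp r (\sum_j face f j s))).
apply: hrep_eq => n; rewrite dil_affim dil_box//.
by rewrite -(box_expansion prism_semiadditive prism_two_zeros).
Qed.

(* The last entry of the h-vector of a prism is the interior part minus the
   part coming from the facets. *)
Lemma prism_mono s s' : (forall i, 0 < s i) -> (forall i, s i <= s' i) ->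
  C ((core_part f s' - \sum_j face f j s') - (core_part f s - \sum_j face f j s)).
Proof.
move=> s0 ss'; have s0' i : 0 < s' i by exact: lt_le_trans (ss' i).
have sn : nonneg s by move=> i; exact: ltW.
have sn' : nonneg s' by move=> i; exact: ltW.
have := muM (is_polytope_affim 0 N (is_polytope_box s))
  (is_polytope_affim 0 N (is_polytope_box s')) (affim_nonempty _ _ (box_nonempty sn)).
rewrite !pdim_affim_box// => /(_ _ _ _ erefl (prism_hrep sn) (prism_hrep sn') r.+1 (leqnn _)).
rewrite !eul_top /hlift ltnn /= eul_top !mulr1n !sub0r; apply.
by apply: affim_sub => x xs i; have /andP[-> /le_trans ->] := xs i.
Qed.

Lemma face_pos s i : nonneg s -> C (face f i s).
Proof.
move=> s0; apply: (val_pos Ccone muV muM r0 mur).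
  exact/is_polytope_affim/is_polytope_box.
rewrite -ltnS; apply: (@pdim_affim_hyperplane _ _ _ _ _ _ (delta_mx i 0) 0).
  by apply/eqP => /matrixP/(_ i 0)/eqP; rewrite !mxE !eqxx oner_eq0.
move=> x /(_ i); rewrite /upd eqxx => /le_anti xk.
by rewrite /hyperplane/= affE dot_delta addr0 -xk.
Qed.

Let l : 'I_r.+1 := ord_max.

Lemma prism_bound s : (forall i, 0 < s i) -> C (core_part f s - face f l s).
Proof.
move=> s0; have sn : nonneg s by move=> i; exact: ltW.
pose s' := scale_on (predC1 l) 2 s.
have ss' i : s i <= s' i.
  by rewrite /s' /scale_on; case: ifP => // _; rewrite mulr2n lerDl.
have := prism_mono s0 ss'.
have cl : #|predC1 l| = r by rewrite cardC1 card_ord.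
have IE : core_part f s' = core_part f s *+ 2 ^ r.
  rewrite additive_scale ?cl// => i _.
  exact: (core_additive prism_semiadditive prism_two_zeros).
have FE : face f l s' = face f l s *+ 2 ^ r.
  rewrite additive_scale ?cl// => i il.
  by apply: (face_additive prism_semiadditive prism_two_zeros); rewrite eq_sym.
have FC i : C (face f i s' - face f i s).
  have -> : face f i s' = face f i (scale_on (predI (predC1 l) (predC1 i)) 2 s).
    congr f; apply/funext => j; rewrite /upd /s' /scale_on/=.
    by case: (j == i); rewrite ?andbF ?andbT.
  rewrite additive_scale//; last first.
    move=> j /andP[_ ji].
    by apply: (face_additive prism_semiadditive prism_two_zeros); rewrite eq_sym.
  rewrite -{2}[face f i s]mulr1n -mulrnBr ?expn_gt0//.
  by apply: coneMn => //; exact: face_pos.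
move=> H; apply: (@cone_pMn _ _ _ Ccone _ (2 ^ r - 1)).
  by rewrite subn_gt0 -{1}(expn0 2) ltn_exp2l.
rewrite mulrnBr ?expn_gt0// mulr1n mulrnBl -FE -IE.
have -> : core_part f s' - face f l s' - (core_part f s - face f l s) =
  ((core_part f s' - \sum_j face f j s') - (core_part f s - \sum_j face f j s)) +
  \sum_(j | j != l) (face f j s' - face f j s).
  have E t : \sum_j face f j t = face f l t + \sum_(j | j != l) face f j t.
    by rewrite (bigD1 l).
  rewrite !{}E sumrB.
  set A := \sum_(j | _) _; set B := \sum_(j | _) _.
  rewrite [core_part f s' - (_ + _)]subrDA [core_part f s - (_ + _)]subrDA.
  move: (core_part f s' - _) (core_part f s - _) => U V.
  by rewrite [- (V - B)]opprD opprK addrACA subrK addrK.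
by apply: coneD => //; apply: cone_sum.
Qed.

Lemma prism_base : C (- face f l (fun=> 1)).
Proof.
apply: (@cone_archimedean _ _ _ (core_part f (fun=> 1))) => // k.
pose s := upd (fun=> 1) l (k.+1%:R^-1 : R).
have s0 i : 0 < s i by rewrite /s /upd; case: ifP.
have -> : k.+1%:R^-1 *: core_part f (fun=> 1) = core_part f s.
  have -> : core_part f (fun=> 1) = core_part f s *+ k.+1.
    rewrite -additive_at_mulrn//.
    - by rewrite -[k.+1%:R^-1 *+ _]mulr_natl divff// (upd_id (fun=> 1) l).
    - exact: (core_additive prism_semiadditive prism_two_zeros).
  by rewrite -[X in _ *: X](scaler_nat k.+1) scalerA mulVf// scale1r.
have -> : face f l (fun=> 1) = face f l s by rewrite /face /s upd_upd.
exact: prism_bound.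
Qed.

End Prism.

Lemma vanish_step : (r < d)%N -> vanish_below mu r.+1.
Proof.
move=> rd; apply: (vanish_next Ccone Cptd muV muM r0 mur) => M Mf.
have [N [Nf NM]] := extend_row_free Mf rd.
apply: (pointed_eq0 Cptd); first exact: (box_pos Ccone muV muM r0 mur).
have := prism_base Nf; rewrite /face /pull (box_face _ (i := ord_max)).
  rewrite NM; congr (C (- mu (affim _ _ (box _)))); apply/funext => k.
  by rewrite /upd eq_sym (negbTE (neq_lift _ _)).
by rewrite /upd eqxx.
Qed.

End NextStage.

(** * Lebesgue measure on row vectors *)

Section TupleMeasure.
Variable R : realType.
Local Notation T d := (d.-tuple (measurableTypeR R)).

Definition tup d (v : 'rV[R]_d) : T d := [tuple v 0 i | i < d].

Definition untup d (t : T d) : 'rV[R]_d := \row_i tnth t i.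

Lemma tupK d : cancel (@tup d) (@untup d).
Proof. by move=> v; apply/rowP => i; rewrite mxE tnth_mktuple. Qed.

Lemma untupK d : cancel (@untup d) (@tup d).
Proof. by move=> t; apply: eq_from_tnth => i; rewrite tnth_mktuple mxE. Qed.

Definition tcons d (p : measurableTypeR R * T d) : T d.+1 := [tuple of p.1 :: p.2].

Lemma measurable_tcons d : measurable_fun setT (@tcons d).
Proof. exact: measurable_cons. Qed.

Lemma tup_row_mx d (x : R) (v : 'rV[R]_d) :
  tup (row_mx (x%:M : 'rV[R]_1) v) = tcons (x, tup v) :> T d.+1.
Proof.
apply: eq_from_tnth => i; rewrite tnth_mktuple.
have [->|[j ->]] : i = ord0 \/ exists j, i = lift ord0 j.
  by case: (unliftP ord0 i) => [j ->|->]; [right; exists j|left].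
  rewrite (_ : ord0 = lshift d (0 : 'I_1)); last exact/val_inj.
  by rewrite (row_mxEl (x%:M : 'rV_1) v) mxE.
rewrite (_ : lift ord0 j = rshift 1 j); last exact/val_inj.
rewrite (row_mxEr (x%:M : 'rV_1) v).
rewrite (_ : rshift 1 j = lift ord0 j); last exact/val_inj.
by rewrite tnthS tnth_mktuple.
Qed.

Lemma untup_tcons d (x : R) (t : T d) :
  untup (tcons (x, t)) = row_mx (x%:M : 'rV[R]_1) (untup t).
Proof. by apply: (can_inj (@tupK _)); rewrite untupK tup_row_mx untupK. Qed.

Section Step.
Local Open Scope ereal_scope.
Variables (d : nat) (mu : {sigma_finite_measure set (T d) -> \bar R}).

Let nu : {measure set (T d.+1) -> \bar R} :=
  measure_function_pushforward__canonical__measure_function_Measure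
    (@lebesgue_measure R \x mu)%E (@measurable_tcons d).

Let nu_sigma_finite : sigma_finite setT nu.
Proof.
have /sigma_finiteP[F [TF ndF Foo]] := sigma_finiteT (@lebesgue_measure R).
have /sigma_finiteP[G [TG ndG Goo]] := sigma_finiteT mu.
pose g (t : T d.+1) : measurableTypeR R * T d := (thead t, [tuple of behead t]).
have gK : cancel (@tcons d) g.
  by move=> [x t]; rewrite /g/=; congr pair; apply/val_inj.
have mg : measurable_fun setT g.
  apply: measurable_fun_pair; last exact: measurable_behead.
  exact: (measurable_tnth ord0).
exists (fun n => g @^-1` (F n `*` G n)).
  apply/esym; rewrite -subTset => t _.
  have [n _ Fn] : (\bigcup_n F n) (g t).1 by rewrite -TF.
  have [k _ Gk] : (\bigcup_n G n) (g t).2 by rewrite -TG.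
  exists (maxn n k) => //; split.
    by move: Fn; exact/subsetPset/ndF/leq_maxl.
  by move: Gk; exact/subsetPset/ndG/leq_maxr.
move=> n; have [mF Fn] := Foo n; have [mG Gn] := Goo n; split.
  by rewrite -[X in measurable X]setTI; apply: mg => //; exact: measurableX.
have -> : nu (g @^-1` (F n `*` G n)) = (lebesgue_measure \x mu) (F n `*` G n).
  rewrite /nu/= /pushforward; congr product_measure1.
  by apply/seteqP; split => p; rewrite /preimage /mkset gK.
by rewrite product_measure1E// lte_mul_pinfty// ge0_fin_numE.
Qed.

Definition tuple_step : {sigma_finite_measure set (T d.+1) -> \bar R} :=
  HB.pack_for (sigma_finite_measure (T d.+1) R) (nu : set _ -> \bar R) nu
    (Measure_isSigmaFinite.Build _ _ _ nu nu_sigma_finite).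

Lemma tuple_stepE A : tuple_step A = (lebesgue_measure \x mu) (@tcons d @^-1` A).
Proof. by []. Qed.

End Step.

Fixpoint tuple_measure d : {sigma_finite_measure set (T d) -> \bar R} :=
  match d with
  | 0 => [the sigma_finite_measure _ _ of dirac ([tuple] : T 0)]
  | d'.+1 => tuple_step (tuple_measure d')
  end.

Lemma tuple_measureE d (A : set 'rV[R]_d) :
  lebesgue_rV A = tuple_measure d [set t | A (untup t)].
Proof.
elim: d A => [|d IH] A.
  rewrite /= diracE indicE; have u0 : untup ([tuple] : T 0) = 0 by apply/rowP => -[].
  suff -> : (0 \in A) = ([tuple] \in [set t | A (untup t)]) by [].
  by apply/idP/idP; rewrite !inE/= u0.
rewrite -[RHS]/(tuple_step (tuple_measure d) _) tuple_stepE /product_measure1; apply: eq_integral => x _.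
apply: etrans (IH _) _ => /=; congr (tuple_measure d _); apply/seteqP; split => t; rewrite /xsection/= inE /=;
  by rewrite untup_tcons.
Qed.

End TupleMeasure.

Section LebesgueRV.
Variable R : realType.
Local Notation T d := (d.-tuple (measurableTypeR R)).

Definition tset d (A : set 'rV[R]_d) : set (T d) := [set t | A (untup t)].

Definition mset d (A : set 'rV[R]_d) : Prop := measurable (tset A).

Lemma mset_halfspace d (a : 'cV[R]_d) b : mset (halfspace a b).
Proof.
rewrite /mset /tset (_ : [set _ | _] =
    setT `&` (fun t : T d => (\sum_i tnth t i * a i 0 + b)) @^-1` [set x | 0 <= x]).
  apply: measurable_funD => //; last by rewrite -set_itvE; exact: measurable_itv.
  by apply: measurable_sum => i; apply: measurable_funM => //; exact: measurable_tnth.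
have E (t : T d) : aff a b (untup t) = \sum_i tnth t i * a i 0 + b.
  by rewrite /aff mxE; under eq_bigr do rewrite mxE.
by rewrite setTI; apply/seteqP; split => t; rewrite /halfspace/= E.
Qed.

Lemma msetI d (A B : set 'rV[R]_d) : mset A -> mset B -> mset (A `&` B).
Proof. exact: measurableI. Qed.

Lemma msetT d : mset (setT : set 'rV[R]_d). Proof. exact: measurableT. Qed.

Lemma mset_polytope d (A : set 'rV[R]_d) : is_polytope A -> mset A.
Proof.
move=> /polytope_polyhedron[L ->]; elim: L => [|f L IH].
  by rewrite (_ : polyhedron _ = setT); [exact: msetT|rewrite -subTset].
rewrite (_ : polyhedron _ = halfspace f.1 f.2 `&` polyhedron L).
  by apply: msetI => //; exact: mset_halfspace.
apply/seteqP; split=> x.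
  move=> xL; split; first by apply: xL; rewrite mem_head.
  by move=> g gL; apply: xL; rewrite inE gL orbT.
by move=> [xf xL] g; rewrite inE => /predU1P[->|/xL].
Qed.

Definition cube d (a b : R) : set 'rV[R]_d := [set x | forall i, a <= x 0 i <= b].

Arguments cube : clear implicits.

Lemma is_polytope_cube d a b : is_polytope (cube d a b).
Proof.
apply: (@bounded_polyhedral _ _ _ (`|a| + `|b|)).
  by apply: polyhedral_forall => i; exact: polyhedral_band.
move=> x i /(_ i)/andP[ax xb]; rewrite ler_norml; apply/andP; split.
  by rewrite (le_trans _ ax)// lerNl (le_trans (ler_norm _))// normrN lerDl.
by rewrite (le_trans xb)// (le_trans (ler_norm _))// lerDr.
Qed.

Lemma slice_cube d a b (x : R) :
  [set v : 'rV[R]_d | cube d.+1 a b (row_mx (x%:M : 'rV[R]_1) v)] =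
  if a <= x <= b then cube d a b else set0.
Proof.
have E0 v : (row_mx (x%:M : 'rV[R]_1) v : 'rV[R]_d.+1) 0 ord0 = x.
  rewrite (_ : ord0 = lshift d (0 : 'I_1)); last exact/val_inj.
  by rewrite (row_mxEl (x%:M : 'rV_1) v) mxE.
have ES v (j : 'I_d) : (row_mx (x%:M : 'rV[R]_1) v : 'rV[R]_d.+1) 0 (lift ord0 j) = v 0 j.
  rewrite (_ : lift ord0 j = rshift 1 j); last exact/val_inj.
  by rewrite (row_mxEr (x%:M : 'rV_1) v).
apply/seteqP; split => v /=.
  move=> xv; have := xv ord0; rewrite E0 => ->.
  by move=> j; have := xv (lift ord0 j); rewrite ES.
case: ifP => // xab vab i; case: (unliftP ord0 i) => [j ->|->]; rewrite ?ES ?E0//.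
Qed.

Lemma lebesgue_set0 d : lebesgue_rV (set0 : set 'rV[R]_d) = 0%E.
Proof. by rewrite tuple_measureE (_ : [set _ | _] = set0)// measure0. Qed.

Lemma lebesgue_cube d a b : a <= b -> lebesgue_rV (cube d a b) = ((b - a) ^+ d)%:E.
Proof.
move=> ab; elim: d => [|d IH].
  rewrite /= indicE mem_set// => -[]//.
transitivity (\int[lebesgue_measure]_x
    (((b - a) ^+ d)%:E * (\1_`[a, b] (x : measurableTypeR R))%:E))%E.
  apply: eq_integral => x _; rewrite slice_cube indicE; case: ifP => xab.
    by rewrite mem_set ?mule1//= in_itv.
  rewrite memNset ?mule0/=; last by rewrite in_itv/= xab.
  exact: lebesgue_set0.
rewrite ge0_integralZl//.
- rewrite integral_indic// setIT /= lebesgue_measure_itv/= lte_fin.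
  case: ltP => [_|ba]; first by rewrite -EFinB -EFinM exprSr.
  have -> : a = b by apply/le_anti; rewrite ab ba.
  by rewrite subrr mule0 exprS mul0r.
- exact/measurable_EFinP/measurable_indic.
- by rewrite lee_fin exprn_ge0// subr_ge0.
Qed.

Lemma le_lebesgue d (A B : set 'rV[R]_d) : mset A -> mset B -> A `<=` B ->
  (lebesgue_rV A <= lebesgue_rV B)%E.
Proof.
move=> mA mB AB; rewrite !tuple_measureE.
by apply: le_measure; rewrite ?inE// => t; exact: AB.
Qed.

Lemma lebesgue_ge0 d (A : set 'rV[R]_d) : (0 <= lebesgue_rV A)%E.
Proof. by rewrite tuple_measureE. Qed.

Lemma polytope_in_cube d (A : set 'rV[R]_d) : is_polytope A ->
  exists N : nat, A `<=` cube d (- N%:R) N%:R.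
Proof.
move=> /polytope_bounded[N AN]; exists N => x Ax i; rewrite -ler_norml; exact: AN.
Qed.

Lemma lebesgue_polytope_fin d (A : set 'rV[R]_d) : is_polytope A ->
  lebesgue_rV A \is a fin_num.
Proof.
move=> pA; have [N AN] := polytope_in_cube pA.
rewrite ge0_fin_numE ?lebesgue_ge0//.
apply: (@le_lt_trans _ _ (lebesgue_rV (cube d (- N%:R) N%:R))).
  by apply: le_lebesgue => //; apply: mset_polytope => //; exact: is_polytope_cube.
by rewrite lebesgue_cube ?ltry// (@le_trans _ _ 0)// oppr_le0.
Qed.

Lemma lebesgue_affine1 (c t : R) (A : set (measurableTypeR R)) : 0 < c -> measurable A ->
  lebesgue_measure ((fun x => (x - t) / c) @^-1` A) = (c%:E * lebesgue_measure A)%E.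
Proof.
move=> c0 mA.
pose phi (x : measurableTypeR R) : measurableTypeR R := (x - t) / c.
have mphi : measurable_fun setT phi.
  by apply: measurable_funM => //; apply: measurable_funB.
have ci0 : 0 <= c^-1 by rewrite invr_ge0 ltW.
pose nu : {measure set (measurableTypeR R) -> \bar R} :=
  measure_function_pushforward__canonical__measure_function_Measure
    (@lebesgue_measure R) mphi.
have nuE B : nu B = lebesgue_measure (phi @^-1` B) by [].
have nu_oc X : ocitv X -> lebesgue_measure X = mscale (NngNum ci0) nu X.
  move=> [[a b] _ <-]; rewrite /mscale/= -[pushforward _ _ _]/(nu _) nuE.
  have -> : phi @^-1` `]a, b] = [set` `]c * a + t, c * b + t]].
    apply/seteqP; split => x; rewrite /phi/= !in_itv/= ltr_pdivlMr// ler_pdivrMr//;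
      by rewrite ltrBrDr lerBlDr ![_ * c]mulrC.
  rewrite !lebesgue_measure_itv/= !lte_fin ltrD2r ltr_pM2l//.
  case: ifP => _; last by rewrite mule0.
  by rewrite -!EFinB -EFinM; congr (_%:E); field; rewrite gt_eqF.
have -> : lebesgue_measure A = (c^-1%:E * lebesgue_measure (phi @^-1` A))%E.
  exact: lebesgue_measure_unique nu_oc A mA.
by rewrite muleA -EFinM divff ?gt_eqF// mul1e.
Qed.

Lemma ge0_integral_affine (c t : R) (g : R -> \bar R) : 0 < c ->
  measurable_fun setT (g : measurableTypeR R -> \bar R) -> (forall x, 0 <= g x)%E ->
  (\int[lebesgue_measure]_(x in [set: R]) g (((x : R) - t) / c)%R =
   c%:E * \int[lebesgue_measure]_(x in [set: R]) g x)%E.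
Proof.
move=> c0 mg g0.
pose phi (x : measurableTypeR R) : measurableTypeR R := (x - t) / c.
have mphi : measurable_fun setT phi.
  by apply: measurable_funM => //; apply: measurable_funB.
have := ge0_integral_pushforward mphi (@lebesgue_measure R) (measurableT) mg
  (fun x _ => g0 x).
rewrite preimage_setT => <-.
rewrite -(ge0_integral_mscale _ measurableT (NngNum (ltW c0)))//.
pose nu : {measure set (measurableTypeR R) -> \bar R} :=
  measure_function_pushforward__canonical__measure_function_Measure
    (@lebesgue_measure R) mphi.
apply: (eq_measure_integral _ (m1 := nu)) => A mA _.
exact: lebesgue_affine1.
Qed.

Lemma slice_affine d (c : R) (t : 'rV[R]_d.+1) (A : set 'rV[R]_d.+1) (x : R) : 0 < c ->
  [set v : 'rV[R]_d | trans t [set c *: y | y in A] (row_mx (x%:M : 'rV[R]_1) v)] =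
  trans (rsubmx (t : 'rV_(1 + d)))
    [set c *: y | y in [set v : 'rV[R]_d |
      A (row_mx (((x - t 0 ord0) / c)%:M : 'rV[R]_1) v)]].
Proof.
move=> c0; have c00 : c != 0 by rewrite gt_eqF.
have t0 : lsubmx (t : 'rV_(1 + d)) = (t 0 ord0)%:M.
  apply/rowP => j; rewrite ord1 !mxE; congr (t _ _); exact/val_inj.
have tE : (t : 'rV_(1 + d)) = row_mx (t 0 ord0)%:M (rsubmx (t : 'rV_(1 + d))).
  by rewrite -t0 hsubmxK.
apply/seteqP; split => v.
- move=> [_ [y Ay <-]] xv.
  have [y0 yl] : exists y0, lsubmx (y : 'rV_(1 + d)) = y0%:M.
    by exists (lsubmx (y : 'rV_(1 + d)) 0 0); rewrite -mx11_scalar.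
  have /(congr1 (fun M : 'M[R]_1 => M 0 0)) := congr1 (fun u : 'rV_(1 + d) => lsubmx u) xv.
  rewrite row_mxKl linearD linearZ/= t0 yl !mxE/= !mulr1n => xE.
  have := congr1 (fun u : 'rV_(1 + d) => rsubmx u) xv.
  rewrite /= row_mxKr linearD linearZ/= => <-.
  exists (c *: rsubmx (y : 'rV_(1 + d))) => //.
  exists (rsubmx (y : 'rV_(1 + d))) => //=.
  suff -> : (x - t 0 ord0) / c = y0 by rewrite -yl hsubmxK.
  by rewrite -xE addrAC subrr add0r mulrC mulKf.
- move=> [_ [y Ay <-] <-] /=.
  pose z : 'rV[R]_(1 + d) := row_mx ((x - t 0 ord0) / c)%:M y.
  exists (c *: z); first by exists z.
  rewrite -[LHS](@hsubmxK _ 1 1 d) !linearD !linearZ/= /z row_mxKl row_mxKr t0.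
  rewrite scale_scalar_mx -raddfD/=.
  by congr (row_mx _%:M _); rewrite mulrC divfK// addrC subrK.
Qed.

Lemma lebesgue_affine d (c : R) (t : 'rV[R]_d) (A : set 'rV[R]_d) : 0 < c -> mset A ->
  lebesgue_rV (trans t [set c *: y | y in A]) = ((c ^+ d)%:E * lebesgue_rV A)%E.
Proof.
elim: d t A => [|d IH] t A c0 mA.
  rewrite /= expr0 mul1e !indicE; congr (_%:E); congr (_%:R).
  suff -> : trans t [set c *: y | y in A] = A by [].
  apply/seteqP; split => x; rewrite [x]thinmx0; first by move=> [_ [y + _] _]; rewrite [y]thinmx0.
  by move=> A0; exists 0; [exists 0 => //|]; rewrite ?[t]thinmx0 ?scaler0 ?addr0.
pose g (x : R) := lebesgue_rV [set v : 'rV[R]_d | A (row_mx (x%:M : 'rV[R]_1) v)].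
have mtc : measurable (@tcons R d @^-1` tset A).
  by rewrite -[X in measurable X]setTI; exact: measurable_tcons.
have gE x : g x = (tuple_measure R d \o xsection (@tcons R d @^-1` tset A)) x.
  rewrite /g tuple_measureE/=; congr (tuple_measure R d _).
  by apply/seteqP; split => s; rewrite /xsection/= inE/= /tset/= untup_tcons.
transitivity (\int[lebesgue_measure]_(x in [set: R]) ((c ^+ d)%:E * g (((x : R) - t 0 ord0) / c)%R))%E.
  apply: eq_integral => x _; rewrite slice_affine//; apply: IH => //.
  rewrite /mset /tset (_ : [set _ | _] =
    xsection (@tcons R d @^-1` tset A) ((x - t 0 ord0) / c)).
    exact: measurable_xsection.
  by apply/seteqP; split => s; rewrite /xsection/= inE/= /tset/= untup_tcons.
have mg : measurable_fun setT (g : measurableTypeR R -> \bar R).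
  by rewrite (funext gE); exact: measurable_fun_xsection.
have g0 x : (0 <= g x)%E by exact: lebesgue_ge0.
rewrite ge0_integralZl//; last by rewrite lee_fin exprn_ge0// ltW.
  by rewrite ge0_integral_affine// muleA -EFinM exprSr.
apply: (measurableT_comp mg).
by apply: measurable_funM => //; apply: measurable_funB.
Qed.

End LebesgueRV.

Arguments cube {R} d a b _.

Section Volume.
Variables (R : realType) (d : nat).

Definition lebv (A : set 'rV[R]_d) : R := fine (lebesgue_rV A).

Lemma lebv_ge0 A : 0 <= lebv A.
Proof. exact/fine_ge0/lebesgue_ge0. Qed.

Lemma lebvK A : is_polytope A -> (lebv A)%:E = lebesgue_rV A.
Proof. by move=> pA; rewrite fineK// lebesgue_polytope_fin. Qed.

Lemma le_lebv A B : is_polytope A -> is_polytope B -> A `<=` B -> lebv A <= lebv B.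
Proof.
move=> pA pB AB; rewrite -lee_fin !lebvK//.
by apply: le_lebesgue => //; exact: mset_polytope.
Qed.

Lemma lebv_affine c (t : 'rV[R]_d) A : 0 < c -> is_polytope A ->
  lebv (trans t [set c *: y | y in A]) = c ^+ d * lebv A.
Proof.
move=> c0 pA; rewrite /lebv lebesgue_affine//; last exact: mset_polytope.
by rewrite -lebvK.
Qed.

Lemma lebv_valuation : set_valuation lebv.
Proof.
split.
- by rewrite /lebv lebesgue_set0.
- move=> A B pA pB pAB; apply/EFin_inj; rewrite !EFinD !lebvK//; last exact: is_polytopeI.
  have fin X : is_polytope X -> tuple_measure R d (tset X) \is a fin_num.
    by move=> /lebesgue_polytope_fin; rewrite tuple_measureE.
  rewrite !tuple_measureE -!/(tset _).
  have -> : tset (A `|` B) = tset A `|` tset B by [].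
  rewrite measureUfinr; [|exact: mset_polytope..|].
    by rewrite subeK//; apply: (fin (A `&` B)); exact: is_polytopeI.
  by rewrite -ge0_fin_numE ?fin.
- move=> t A pA; rewrite -[RHS]mul1r -(expr1n _ d) -(lebv_affine t)//; congr lebv.
  congr trans; apply/seteqP; split => x; first by move=> Ax; exists x; rewrite ?scale1r.
  by move=> [y Ay <-]; rewrite scale1r.
Qed.

(* Infinitely many disjoint translates of [A] fit in a cube. *)
Lemma lebv_simple : simple_val lebv.
Proof.
move=> A a b pA a0 Aab.
have [i ai] : exists i, a i 0 != 0.
  apply: contrapT => H; move: a0; rewrite (_ : a = 0) ?eqxx//.
  apply/colP => i; rewrite mxE; apply: contrapT => /eqP ai; apply: H; by exists i.
have [N AN] := polytope_in_cube pA.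
pose e (j : nat) : 'rV[R]_d := j.+1%:R^-1 *: delta_mx 0 i.
pose P j := trans (e j) A.
have pP j : is_polytope (P j) by exact: is_polytope_translate.
have PN j : P j `<=` cube d (- (N%:R + 1)) (N%:R + 1).
  move=> _ [x Ax <-] k; have /andP[xl xu] := AN x Ax k.
  have e0 : 0 <= e j 0 k by rewrite !mxE mulr_ge0.
  have e1 : e j 0 k <= 1.
    rewrite !mxE; case: (_ && _); rewrite ?mulr1 ?mulr0 ?ler01//.
    by rewrite invf_le1 ?ltr0n// ler1n.
  by rewrite mxE; apply/andP; split; lra.
have affP j x : P j x -> aff a b x = j.+1%:R^-1 * a i 0.
  move=> [y Ay <-]; rewrite affE dotDl -addrA [dot y a + b](Aab _ Ay) addr0.
  rewrite /e dotZl; congr (_ * _); rewrite /dot mxE (bigD1 i)//= mxE !eqxx mul1r.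
  by rewrite big1 ?addr0// => k /negbTE ki; rewrite mxE ki andbF mul0r.
have tP : trivIset setT (fun j => tset (P j)).
  apply/trivIsetP => j k _ _ jk; apply/seteqP; split => // t [/affP jt /affP].
  rewrite jt => /(mulIf ai)/invr_inj/eqP; rewrite eqr_nat eqSS.
  by rewrite (negbTE jk).
have [_ _ lebT] := lebv_valuation.
have bound n : lebv A *+ n <= lebv (cube d (- (N%:R + 1)) (N%:R + 1)).
  have <- : \sum_(j < n) lebv (P j) = lebv A *+ n.
    by rewrite (eq_bigr _ (fun j _ => lebT _ _ pA)) sumr_const card_ord.
  rewrite -lee_fin lebvK; last exact: is_polytope_cube.
  have E j : (lebv (P j))%:E = tuple_measure R d (tset (P j)).
    by rewrite (lebvK (pP j)) tuple_measureE.
  rewrite -sumEFin; under eq_bigr do rewrite E.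
  rewrite -(@measure_bigsetU _ _ _ (tuple_measure R d) (fun j => tset (P j)) _ tP n);
    last by move=> j; exact: (mset_polytope (pP j)).
  rewrite tuple_measureE; apply: le_measure; rewrite ?inE.
  - by apply: bigsetU_measurable => j _; exact: (mset_polytope (pP j)).
  - exact: (mset_polytope (is_polytope_cube _ _ _)).
  - by elim/big_ind: _ => [t //|X Y XC YC t [/XC|/YC]//|j _ t /(PN j)].
apply/le_anti; rewrite lebv_ge0 andbT leNgt; apply/negP => A0.
pose K := lebv (cube d (- (N%:R + 1)) (N%:R + 1)).
have : K < lebv A *+ Num.bound (K / lebv A).
  rewrite -mulr_natl -ltr_pdivrMr// archi_boundP// divr_ge0 ?lebv_ge0//.
by rewrite ltNge bound.
Qed.

Lemma lebv_dil n A : is_polytope A -> A !=set0 -> lebv (dil n A) = n%:R ^+ d * lebv A.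
Proof.
move=> pA A0; have [->|n0] := posnP n.
  rewrite dil0//; have [d0|d0] := posnP d.
    rewrite [in RHS]d0 expr0 mul1r; congr lebv.
    have [x Ax] := A0; have z0 (z : 'rV[R]_d) : z = 0.
      by apply/rowP => -[i id]; exfalso; rewrite d0 in id.
    by apply/seteqP; split => y; rewrite (z0 y)// => _; rewrite -(z0 x).
  rewrite expr0n gtn_eqF// mul0r.
  apply: (lebv_simple (a := delta_mx (Ordinal d0) 0) (b := 0)).
  - exact: is_polytope1.
  - by apply/eqP => /matrixP/(_ (Ordinal d0) 0)/eqP; rewrite !mxE !eqxx oner_eq0.
  - by move=> _ ->; rewrite /hyperplane/= affE dot_delta mxE addr0.
rewrite -(lebv_affine 0) ?ltr0n//; congr lebv.
apply/seteqP; split => x; first by move=> [y Ay <-]; exists (n%:R *: y); rewrite ?add0r//; exists y.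
by move=> [_ [y Ay <-] <-]; rewrite add0r; exists y.
Qed.

Lemma lebv_cube a b : a <= b -> lebv (cube d a b) = (b - a) ^+ d.
Proof. by move=> ab; rewrite /lebv lebesgue_cube. Qed.

Definition thick (A : set 'rV[R]_d) (e : R) := mink_sum A (cube d (- e) e).

Lemma is_polytope_thick A e : is_polytope A -> is_polytope (thick A e).
Proof. by move=> pA; apply: is_polytope_sum => //; exact: is_polytope_cube. Qed.

Lemma thick_sub A e e' : e <= e' -> thick A e `<=` thick A e'.
Proof.
move=> ee x [y [z [Ay zc ->]]]; exists y, z; split=> // i.
by have /andP[? ?] := zc i; apply/andP; split; lra.
Qed.

Lemma bigcap_thick A : is_polytope A -> \bigcap_k thick A k.+1%:R^-1 = A.
Proof.
move=> pA; apply/seteqP; split => x; last first.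
  move=> Ax k _; exists x, 0; split; rewrite ?addr0// => i.
  by rewrite mxE oppr_le0 invr_ge0 ler0n.
have [L LE] := polytope_polyhedron pA; rewrite {2}LE => xA f fL.
rewrite leNgt; apply/negP => fx.
pose S := \sum_i `|f.1 i 0|.
have S0 : 0 <= S by apply: sumr_ge0.
have H k : - affp f x <= k.+1%:R^-1 * S.
  have [y [z [Ay zc ->]]] := xA k I.
  have : 0 <= affp f y by move: Ay; rewrite {1}LE; apply.
  rewrite /affp !affE dotDl => fy.
  suff zS : - dot z f.1 <= k.+1%:R^-1 * S.
    by apply: le_trans zS; rewrite lerN2 addrAC lerDr.
  rewrite -dotNr /dot mxE mulr_sumr; apply: ler_sum => i _.
  rewrite !mxE (le_trans (ler_norm _))// normrM normrN ler_wpM2r//.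
  by rewrite ler_norml zc.
have k0 : 0 < - affp f x by rewrite oppr_gt0.
have := H (Num.bound (S / - affp f x)).
rewrite mulrC ler_pdivlMr ?ltr0n// mulrC -ler_pdivlMr// leNgt.
rewrite (lt_trans (archi_boundP _)) ?divr_ge0// ?(ltW k0)// ltr_nat//.
Qed.

Lemma thick_limit A e : is_polytope A -> 0 < e ->
  exists k : nat, lebv (thick A k.+1%:R^-1) <= lebv A + e.
Proof.
move=> pA e0; pose F k := tset (thick A k.+1%:R^-1).
have mF k : measurable (F k) by apply: mset_polytope; exact: is_polytope_thick.
have FA : \bigcap_k F k = tset A.
  by rewrite -(bigcap_thick pA); apply/seteqP; split.
have : tuple_measure R d \o F @ \oo --> tuple_measure R d (\bigcap_n F n).
  apply: nonincreasing_cvg_mu => //.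
  - have := lebesgue_polytope_fin (is_polytope_thick 1%:R^-1 pA).
    by rewrite tuple_measureE ge0_fin_numE.
  - by rewrite FA; exact: mset_polytope.
  - move=> k l kl; apply/subsetPset => t; apply: thick_sub.
    by rewrite lef_pV2 ?posrE ?ltr0n// ler_nat.
rewrite FA -tuple_measureE -lebvK// => /fine_cvg.
move=> /cvgrPdist_le/(_ _ e0)[N _ /(_ N (leqnn N)) H]; exists N.
have -> : lebv (thick A N.+1%:R^-1) = fine (tuple_measure R d (F N)).
  by rewrite /lebv tuple_measureE.
by move: H; rewrite ler_norml /=; lra.
Qed.

End Volume.

(** * Comparison with the volume *)

Section Compare.
Variables (R : realType) (d : nat) (G : vectType R) (C : set G).
Hypotheses (Ccone : convex_cone C) (Cptd : pointed_cone C) (Ccl : vect_closed C).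
Implicit Types (mu nu : set 'rV[R]_d -> G).

Definition positive mu := forall A, is_polytope A -> C (mu A).

Lemma simple_mono mu P Q : set_valuation mu -> simple_val mu -> positive mu ->
  is_polytope P -> is_polytope Q -> P `<=` Q -> C (mu Q - mu P).
Proof.
move=> muV muS mupos pP pQ PQ; have [L LE] := polytope_polyhedron pP.
have -> : P = Q `&` polyhedron L by rewrite -LE; apply/esym/setIidr.
elim: L Q pQ {LE PQ} => [|f L IH] Q pQ.
  by rewrite (_ : polyhedron _ = setT) ?setIT ?subrr -?subTset//; exact: cone0.
have -> : Q `&` polyhedron (f :: L) = (Q `&` halfspace f.1 f.2) `&` polyhedron L.
  rewrite -setIA; congr (_ `&` _); apply/seteqP; split=> x.
    move=> xL; split; first by apply: xL; rewrite mem_head.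
    by move=> g gL; apply: xL; rewrite inE gL orbT.
  by move=> [xf xL] g; rewrite inE => /predU1P[->|/xL].
have pQf := is_polytope_halfspace f.1 f.2 pQ.
rewrite -[mu Q](subrK (mu (Q `&` halfspace f.1 f.2))) -addrA.
apply: coneD => //; last exact: IH.
have [f0|f0] := eqVneq f.1 0; last first.
  rewrite (simple_cut muV muS f.2 pQ f0) addrAC subrr add0r.
  by apply: mupos; exact: is_polytope_halfspace.
have affE0 x : aff f.1 f.2 x = f.2 by rewrite f0 /aff mulmx0 mxE add0r.
have [f2|f2] := leP 0 f.2.
  rewrite (_ : Q `&` _ = Q) ?subrr; first exact: cone0.
  by apply: setIidl => x _; rewrite /halfspace/= affE0.
rewrite (_ : Q `&` _ = set0).
  by case: muV => -> _ _; rewrite subr0; exact: mupos.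
by apply/seteqP; split => // x [_]; rewrite /halfspace/= affE0 leNgt f2.
Qed.

Definition grid_box (K : nat) (a : 'rV[R]_d) (n : 'I_d -> nat) : set 'rV[R]_d :=
  [set x | forall i, a 0 i <= x 0 i <= a 0 i + (n i)%:R / K%:R].

Lemma grid_boxE K a n : grid_box K a n = trans a (box (fun i => (n i)%:R / K%:R)).
Proof.
apply/seteqP; split => x.
  move=> xn; exists (x - a); last by rewrite addrC subrK.
  by move=> i; rewrite !mxE subr_ge0 lerBlDl; exact: xn.
by move=> [y yn <-] i; have := yn i; rewrite mxE lerDl lerD2l.
Qed.

Lemma is_polytope_grid_box K a n : is_polytope (grid_box K a n).
Proof. by rewrite grid_boxE; exact/is_polytope_translate/is_polytope_box. Qed.

(* Grid cells meeting [P] lie in [Q]. *)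
Lemma grid_comparison mu nu K P Q :
  set_valuation mu -> simple_val mu -> positive mu ->
  set_valuation nu -> simple_val nu -> positive nu ->
  (0 < K)%N -> mu (box (fun=> K%:R^-1)) = nu (box (fun=> K%:R^-1)) ->
  is_polytope P -> is_polytope Q ->
  (forall x y : 'rV[R]_d, P x -> (forall i, `|x 0 i - y 0 i| <= K%:R^-1) -> Q y) ->
  C (nu Q - mu P).
Proof.
move=> muV muS mup nuV nuS nup K0 munu pP pQ H.
have [mu0 _ muT] := muV; have [nu0 _ nuT] := nuV.
have K0R : (0 : R) < K%:R by rewrite ltr0n.
have small a n : ~ (exists i, (1 < n i)%N) ->
    C (nu (Q `&` grid_box K a n) - mu (P `&` grid_box K a n)).
  move=> n1; have [[i ni]|n0] := pselect (exists i, n i = 0%N).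
    have e0 : delta_mx i 0 != 0 :> 'cV[R]_d.
      by apply/eqP => /matrixP/(_ i 0)/eqP; rewrite !mxE !eqxx oner_eq0.
    have sub X : X `&` grid_box K a n `<=` hyperplane (delta_mx i 0) (- a 0 i).
      move=> x [_ /(_ i)]; rewrite ni mul0r addr0 => /le_anti xi.
      by rewrite /hyperplane/= affE dot_delta -xi subrr.
    rewrite (nuS _ _ _ _ e0 (sub Q)) ?(muS _ _ _ _ e0 (sub P)) ?subrr; first exact: cone0.
      by apply: is_polytopeI => //; exact: is_polytope_grid_box.
    by apply: is_polytopeI => //; exact: is_polytope_grid_box.
  have {n0 n1}nE : n = fun=> 1%N.
    apply/funext => i; apply/eqP; rewrite eqn_leq; apply/andP; split.
      by rewrite leqNgt; apply/negP => ni; apply: n1; exists i.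
    by rewrite lt0n; apply/negP => /eqP ni; apply: n0; exists i.
  have pW := is_polytope_grid_box K a n.
  have [PW|/set0P[x [Px Wx]]] := eqVneq (P `&` grid_box K a n) set0.
    by rewrite PW mu0 subr0; apply: nup; exact: is_polytopeI.
  have WQ : grid_box K a n `<=` Q.
    move=> y Wy; apply: H Px _ => i; have := Wx i; have := Wy i.
    rewrite nE mul1r ler_norml => /andP[? ?] /andP[? ?]; apply/andP; split; lra.
  rewrite (setIidr WQ) [nu _](_ : _ = mu (grid_box K a n)).
    by apply: simple_mono => //; exact: is_polytopeI.
  rewrite grid_boxE nuT; last exact: is_polytope_box.
  rewrite muT; last exact: is_polytope_box.
  by rewrite nE mul1r munu.
have good m a n : (\sum_i n i <= m)%N ->
    C (nu (Q `&` grid_box K a n) - mu (P `&` grid_box K a n)).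
  elim: m a n => [|m IH] a n nm.
    apply: small => -[i ni]; move: nm; rewrite leqn0 => /eqP/eqP.
    by rewrite sum_nat_eq0 => /forallP/(_ i)/eqP ni0; rewrite ni0 in ni.
  have [[i ni]|nsmall] := pselect (exists i, (1 < n i)%N); last exact: small.
    pose e : 'cV[R]_d := delta_mx i 0.
    pose b : R := - (a 0 i + K%:R^-1).
    have e0 : e != 0 by apply/eqP => /matrixP/(_ i 0)/eqP; rewrite !mxE !eqxx oner_eq0.
    have affe x : aff e b x = x 0 i - (a 0 i + K%:R^-1) by rewrite affE dot_delta.
    pose n1 j := if j == i then 1%N else n j.
    pose n2 j := if j == i then (n i).-1 else n j.
    pose a2 : 'rV[R]_d := \row_j (if j == i then a 0 i + K%:R^-1 else a 0 j).
    have ni1 : (n i)%:R / K%:R = K%:R^-1 + (n i).-1%:R / K%:R :> R.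
      by rewrite -{1}(prednK (ltnW ni)) -natr1 mulrDl mul1r addrC.
    have nn0 : 0 <= (n i).-1%:R / K%:R :> R by rewrite divr_ge0.
    have W1 : grid_box K a n `&` halfspace (- e) (- b) = grid_box K a n1.
      apply/seteqP; split => x.
        move=> [xn]; rewrite /halfspace/= affN affe oppr_ge0 subr_le0 => xi j.
        have := xn j; rewrite /n1; case: eqP => // -> /andP[-> _].
        by rewrite mul1r.
      move=> xn; split.
        move=> j; have := xn j; rewrite /n1; case: eqP => // -> /andP[-> xi].
        by rewrite (le_trans xi)// mul1r lerD2l ni1 lerDl.
      have := xn i; rewrite /n1 eqxx mul1r => /andP[_ xi].
      by rewrite /halfspace/= affN affe oppr_ge0 subr_le0.
    have W2 : grid_box K a n `&` halfspace e b = grid_box K a2 n2.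
      apply/seteqP; split => x.
        move=> [xn]; rewrite /halfspace/= affe subr_ge0 => xi j.
        have := xn j; rewrite /n2 mxE; case: eqP => // -> /andP[_].
        by rewrite xi ni1 addrA.
      move=> xn; split.
        move=> j; have := xn j; rewrite /n2 mxE; case: eqP => // -> /andP[xi].
        rewrite ni1 addrA => ->; rewrite andbT (le_trans _ xi)// lerDl invr_ge0 ltW//.
      have := xn i; rewrite /n2 mxE eqxx => /andP[xi _].
      by rewrite /halfspace/= affe subr_ge0.
    have cut (xi : set 'rV[R]_d -> G) X : set_valuation xi -> simple_val xi ->
        is_polytope X -> xi (X `&` grid_box K a n) =
        xi (X `&` grid_box K a2 n2) + xi (X `&` grid_box K a n1).
      move=> xiV xiS pX; rewrite (simple_cut xiV xiS b _ e0); last first.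
        by apply: is_polytopeI => //; exact: is_polytope_grid_box.
      by rewrite -!setIA W1 W2.
    have sumD1 (k : 'I_d -> nat) : (\sum_j k j = k i + \sum_(j | j != i) k j)%N.
      by rewrite (bigD1 i).
    rewrite !cut// opprD addrACA; apply: coneD => //; apply: IH.
      rewrite -ltnS; apply: leq_trans nm; rewrite (sumD1 n2) (sumD1 n) /n2 eqxx.
      by rewrite (eq_bigr n) => [|j /negbTE ->//]; rewrite ltn_add2r ltn_predL ltnW.
    rewrite -ltnS; apply: leq_trans nm; rewrite (sumD1 n1) (sumD1 n) /n1 eqxx.
    by rewrite (eq_bigr n) => [|j /negbTE ->//]; rewrite ltn_add2r.
have [N PN] := polytope_in_cube pP.
pose a : 'rV[R]_d := \row_i (- N%:R).
pose n (i : 'I_d) := ((N + N) * K)%N.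
have PW : P `<=` grid_box K a n.
  move=> x /PN xN i; have /andP[x0 x1] := xN i.
  rewrite mxE /n natrM mulfK ?gt_eqF// natrD x0/=; lra.
have pW := is_polytope_grid_box K a n.
have := good _ a n (leqnn _); rewrite (setIidl PW) => /coneD H1.
have := H1 Ccone _ (simple_mono nuV nuS nup (is_polytopeI pQ pW) pQ (@subIsetl _ _ _)).
by rewrite addrC subrKA.
Qed.

Lemma set_valuation_comb mu nu (a b : R) : set_valuation mu -> set_valuation nu ->
  set_valuation (fun A => a *: mu A + b *: nu A).
Proof.
move=> [mu0 muU muT] [nu0 nuU nuT]; split.
- by rewrite mu0 nu0 !scaler0 addr0.
- move=> A B pA pB pAB; rewrite addrACA -!scalerDr muU// nuU// !scalerDr.
  by rewrite addrACA.
- by move=> t A pA; rewrite muT// nuT.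
Qed.

Lemma simple_comb mu nu (a b : R) : simple_val mu -> simple_val nu ->
  simple_val (fun A => a *: mu A + b *: nu A).
Proof.
move=> muS nuS A e f pA e0 Ae.
by rewrite (muS _ _ _ pA e0 Ae) (nuS _ _ _ pA e0 Ae) !scaler0 addr0.
Qed.

Definition vol_times (c : G) (A : set 'rV[R]_d) : G := lebv A *: c.

Lemma vol_times_valuation c : set_valuation (vol_times c).
Proof.
have [leb0 lebU lebT] := lebv_valuation R d.
split; rewrite /vol_times ?leb0 ?scale0r//.
  by move=> A B pA pB pAB; rewrite -!scalerDl lebU.
by move=> t A pA; rewrite lebT.
Qed.

Lemma vol_times_simple c : simple_val (vol_times c).
Proof.
by move=> A a b pA a0 Aab; rewrite /vol_times (lebv_simple pA a0 Aab) scale0r.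
Qed.

Lemma vol_times_positive c : C c -> positive (vol_times c).
Proof. by move=> Cc A _; apply: coneZ => //; exact: lebv_ge0. Qed.

Lemma box_cube (s : R) : box (fun _ : 'I_d => s) = cube d 0 s.
Proof. by []. Qed.

(* The outer approximation gives [mu <= vol_times c]; the difference is again a
   nonnegative simple valuation, hence monotone, and it vanishes on large
   cubes. *)
Lemma simple_positive_volume mu : set_valuation mu -> simple_val mu -> positive mu ->
  forall A, is_polytope A -> mu A = lebv A *: mu (box (fun=> 1)).
Proof.
move=> muV muS mup; set c := mu (box _) => A pA.
have Cc : C c by apply: mup; exact: is_polytope_box.
have scaled n : mu (box (fun=> n%:R)) = (n%:R ^+ d) *: c.
  by rewrite -natrX scaler_nat -simple_box_scale// => i; exact: ler01.
have cell K : (0 < K)%N -> mu (box (fun=> K%:R^-1)) = vol_times c (box (fun=> K%:R^-1)).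
  move=> K0; have K0R : (0 : R) < K%:R by rewrite ltr0n.
  have : mu (box (fun=> K%:R^-1)) *+ K ^ d = c.
    rewrite -simple_box_scale//.
    by congr (mu (box _)); apply/funext => i; rewrite -[LHS]mulr_natl divff// gt_eqF.
  rewrite /vol_times box_cube lebv_cube ?invr_ge0 ?(ltW K0R)// subr0 => <-.
  rewrite -[X in _ *: X](scaler_nat (K ^ d)) scalerA natrX exprVn mulVf ?scale1r//.
  by rewrite expf_neq0// gt_eqF.
have upper B : is_polytope B -> C (vol_times c B - mu B).
  move=> pB; apply: (@cone_archimedean _ _ _ c) => // k.
  have k0 : (0 : R) < k.+1%:R^-1 by rewrite invr_gt0 ltr0n.
  have [m Bm] := thick_limit pB k0.
  have pT := is_polytope_thick m.+1%:R^-1 pB.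
  have : C (vol_times c (thick B m.+1%:R^-1) - mu B).
    apply: (@grid_comparison _ _ m.+1) => //.
    - exact: vol_times_valuation.
    - exact: vol_times_simple.
    - exact: vol_times_positive.
    - exact: cell.
    - move=> x y Bx xy; exists x, (y - x); split=> //; last by rewrite addrC subrK.
      by move=> i; rewrite !mxE -ler_norml distrC.
  have : C ((k.+1%:R^-1 + lebv B - lebv (thick B m.+1%:R^-1)) *: c).
    by apply: coneZ => //; rewrite subr_ge0 addrC.
  move=> /(coneD Ccone) H1 /H1; congr C.
  by rewrite /vol_times !addrA -!scalerDl subrK.
pose del B := 1 *: vol_times c B + (- 1) *: mu B.
have delE B : del B = vol_times c B - mu B by rewrite /del scale1r scaleN1r.
have delV : set_valuation del by apply: set_valuation_comb => //; exact: vol_times_valuation.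
have delS : simple_val del by apply: simple_comb => //; exact: vol_times_simple.
have delp : positive del by move=> B pB; rewrite delE; exact: upper.
have [N AN] := polytope_in_cube pA.
have cubeE : cube d (- N%:R : R) N%:R =
    trans (\row_i (- N%:R)) (box (fun=> (N + N)%:R)) :> set 'rV[R]_d.
  apply/(@seteqP 'rV[R]_d); split => x.
    move=> xN; exists (x - \row_i (- N%:R)); last by rewrite addrC subrK.
    by move=> i; have /andP[? ?] := xN i; rewrite !mxE natrD; apply/andP; split; lra.
  by move=> [y yN <-] i; have := yN i; rewrite !mxE natrD => /andP[? ?]; apply/andP; split; lra.
have del0 : del (cube d (- N%:R) N%:R) = 0.
  have [_ _ delT] := delV.
  rewrite cubeE delT; last exact: is_polytope_box.
  by rewrite delE scaled /vol_times box_cube lebv_cube ?ler0n// subr0 subrr.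
have := simple_mono delV delS delp pA (is_polytope_cube _ _ _) AN.
rewrite del0 sub0r => Cdel.
have := pointed_eq0 Cptd (delp A pA) Cdel.
by rewrite delE => /eqP; rewrite subr_eq0 => /eqP <-.
Qed.

End Compare.

(** * The characterization *)

Section Euler.
Variables (R : realType) (d : nat).
Implicit Types P Q : set 'rV[R]_d.

(* Polytopes with a convex union meet: otherwise a polyhedral description of
   [P - Q], which misses the origin, gives a strictly separating functional,
   whereas bisecting a segment from [P] to [Q] brings points of [P] and [Q]
   arbitrarily close to each other. *)
Lemma polytope_unionI P Q : is_polytope P -> is_polytope Q -> is_polytope (P `|` Q) ->
  P !=set0 -> Q !=set0 -> P `&` Q !=set0.
Proof.
move=> pP pQ pPQ [x0 Px0] [y0 Qy0].
apply: contrapT => PQ0.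
pose D := mink_sum P (affim 0 (- 1%:M) Q).
have pD : is_polytope D by apply: is_polytope_sum => //; exact: is_polytope_affim.
have [L LE] := polytope_polyhedron pD.
have D0 : ~ D 0.
  move=> [x [_ [Px [y Qy <-]]]]; rewrite add0r mulmxN mulmx1 => /eqP.
  by rewrite eq_sym subr_eq0 => /eqP xy; apply: PQ0; exists x; split=> //; rewrite xy.
have [f fL f0] : exists2 f, f \in L & affp f 0 < 0.
  apply: contrapT => H; apply: D0; rewrite LE => f fL.
  by rewrite leNgt; apply/negP => f0; apply: H; exists f.
have dot0 : dot (0 : 'rV[R]_d) f.1 = 0 by rewrite /dot mul0mx mxE.
rewrite /affp affE dot0 add0r in f0.
have sep x y : P x -> Q y -> - f.2 <= dot x f.1 - dot y f.1.
  move=> Px Qy; have : D (x - y).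
    by exists x, (- y); split=> //; exists y; rewrite // add0r mulmxN mulmx1.
  by rewrite LE => /(_ f fL); rewrite /affp affE dotBl; lra.
have bisect k : exists x y, [/\ P x, Q y &
    dot x f.1 - dot y f.1 = (dot x0 f.1 - dot y0 f.1) / 2 ^+ k].
  elim: k => [|k [x [y [Px Qy xy]]]]; first by exists x0, y0; rewrite expr0 divr1.
  have half : (2^-1 : R) + 2^-1 = 1 by field.
  have : (P `|` Q) ((1 - 2^-1) *: x + 2^-1 *: y).
    by apply: polytope_convex2 => //; [left|right|lra].
  have E : (dot x0 f.1 - dot y0 f.1) / 2 ^+ k.+1 = (dot x f.1 - dot y f.1) / 2.
    by rewrite xy exprSr invfM mulrA.
  move=> [Pm|Qm]; [exists ((1 - 2^-1) *: x + 2^-1 *: y), y|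
                   exists x, ((1 - 2^-1) *: x + 2^-1 *: y)];
    by split=> //; rewrite E dotDl !dotZl; field.
pose K := dot x0 f.1 - dot y0 f.1.
have K0 : 0 <= K by have := sep _ _ Px0 Qy0; rewrite -/K; lra.
have f20 : 0 < - f.2 by rewrite oppr_gt0.
have [x [y [Px Qy xy]]] := bisect (Num.bound (K / - f.2)).
have := sep _ _ Px Qy; rewrite xy leNgt => /negP; apply.
rewrite ltr_pdivrMr ?exprn_gt0// mulrC -ltr_pdivrMr//.
apply: (lt_trans (archi_boundP _)); first by rewrite divr_ge0// ltW.
by rewrite -natrX ltr_nat ltn_expl.
Qed.

Variable G : lmodType R.

Definition chi (c : G) (A : set 'rV[R]_d) : G := (`[< A !=set0 >])%:R *: c.

Lemma chi1 c A : A !=set0 -> chi c A = c.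
Proof. by move=> A0; rewrite /chi asboolT// scale1r. Qed.

Lemma chi0 c : chi c set0 = 0.
Proof. by rewrite /chi asboolF ?scale0r// => -[]. Qed.

Lemma chi_valuation c : set_valuation (chi c).
Proof.
split; first exact: chi0.
- move=> A B pA pB pAB.
  have [->|/set0P A0] := eqVneq A set0; first by rewrite set0U set0I chi0 addrC.
  have [->|/set0P B0] := eqVneq B set0; first by rewrite setU0 setI0 chi0.
  rewrite !chi1//; first exact: polytope_unionI.
  by case: A0 => x Ax; exists x; left.
- move=> t A pA; have [->|/set0P A0] := eqVneq A set0.
    by rewrite /trans image_set0.
  by rewrite !chi1//; case: A0 => x Ax; exists (t + x); exists x.
Qed.

End Euler.

Section Bridge.
Variables (R : realType) (d : nat) (G : vectType R).
Implicit Types (phi : polytope R d -> G) (P Q : polytope R d).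

Lemma polytope_eq P Q : P = Q :> set _ -> P = Q.
Proof.
case: P Q => [A pA] [B pB] /= AB; subst B; congr Polytope; exact: Prop_irrelevance.
Qed.

Definition setval phi (A : set 'rV[R]_d) : G :=
  if pselect (is_polytope A) is left pA then phi (Polytope pA) else 0.

Lemma setvalE phi P : setval phi P = phi P.
Proof.
rewrite /setval; case: pselect => [pP|]; last by case; exact: psetP.
by congr phi; exact: polytope_eq.
Qed.

Lemma setval_valuation phi : valuation phi -> set_valuation (setval phi).
Proof.
move=> [phi0 phiU phiT]; split.
- by rewrite -phi0 -[RHS]setvalE.
- move=> A B pA pB pAB.
  have := phiU (Polytope pA) (Polytope pB) (Polytope pAB) (Polytope (is_polytopeI pA pB)).
  by move=> /(_ erefl erefl); rewrite -!setvalE.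
- by move=> t A pA; have := phiT t (Polytope pA); rewrite -!setvalE.
Qed.

Lemma is_hvectorP phi P (h : {ffun 'I_d.+1 -> G}) :
  is_hvector phi P h <->
  hrep (pdim P) (fun n => setval phi (dil n P)) (fun i => h (inord i)) /\
  forall i : 'I_d.+1, (pdim P < i)%N -> h i = 0.
Proof.
have E n : \sum_(i < d.+1 | (i <= pdim P)%N) h i *+ 'C(n + pdim P - i, pdim P) =
    \sum_(i < (pdim P).+1) h (inord i) *+ 'C(n + pdim P - i, pdim P).
  have Pd : ((pdim P).+1 <= d.+1)%N by rewrite ltnS pdim_max.
  rewrite [RHS](big_ord_widen d.+1 (fun i => h (inord i) *+ 'C(n + pdim P - i, pdim P)) Pd).
  by apply: eq_big => i; rewrite ?ltnS// inord_val.
by split=> -[H H0]; split=> // n; have := H n;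
  rewrite -[phi (dilate n P)]setvalE E.
Qed.

Lemma hvectorE phi P k i : hrep (pdim P) (fun n => setval phi (dil n P)) k ->
  hvector phi P i = if (i <= pdim P)%N then k i else 0.
Proof.
move=> kP; pose h : {ffun 'I_d.+1 -> G} := [ffun i : 'I_d.+1 => if (i <= pdim P)%N then k i else 0].
have hP : is_hvector phi P h.
  apply/is_hvectorP; split=> [n|j]; last by rewrite ffunE ltnNge => /negbTE ->.
  rewrite kP; apply: eq_bigr => j _; rewrite ffunE inordK; last first.
    by rewrite (leq_trans (ltn_ord j))// ltnS pdim_max.
  by rewrite -ltnS ltn_ord.
have : is_hvector phi P (hvector phi P).
  by rewrite /hvector; case: xgetP => [_ -> //|/(_ h)].
move=> /is_hvectorP[Hk H0]; case: ifP => ir; last by rewrite H0// ltnNge ir.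
by have := hrep_unique Hk kP ir; rewrite inord_val.
Qed.

End Bridge.

Section Characterization.
Variables (R : realType) (d : nat) (G : vectType R) (C : set G).
Hypotheses (Ccone : convex_cone C) (Cptd : pointed_cone C) (Ccl : vect_closed C).
Implicit Types (phi : polytope R d -> G) (P Q : polytope R d).

Lemma euler_volE (c : G * G) P : euler_vol d c P = chi c.1 P + vol_times c.2 P.
Proof. by []. Qed.

Lemma dil_nonempty n (A : set 'rV[R]_d) : A !=set0 -> dil n A !=set0.
Proof. by move=> [x Ax]; exists (n%:R *: x); exists x. Qed.

Lemma lebv_lower (A : set 'rV[R]_d) : is_polytope A -> (pdim A < d)%N -> lebv A = 0.
Proof.
move=> pA Ad; have [->|/set0P A0] := eqVneq A set0.
  by case: (lebv_valuation R d).
have [t [N [Q [Nf pQ AE]]]] := polytope_affim pA A0.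
have : ~~ row_free N^T by rewrite /row_free mxrank_tr (eqnP Nf) ltn_eqF.
rewrite -kermx_eq0 => /rowV0Pn[v /sub_kermxP vN v0].
have Nv : N *m v^T = 0 by rewrite -[N]trmxK -trmx_mul vN trmx0.
apply: (lebv_simple (a := v^T) (b := - dot t v^T)) => //.
  by apply: contraNneq v0 => v0; rewrite -[v]trmxK v0 trmx0.
rewrite AE => _ [u _ <-]; rewrite /hyperplane/= affE dotDl addrAC subrr add0r.
by rewrite /dot -mulmxA Nv mulmx0 mxE.
Qed.

Lemma euler_vol_hrep (c1 c2 : G) (A : set 'rV[R]_d) : is_polytope A -> A !=set0 ->
  hrep (pdim A) (fun n => chi c1 (dil n A) + vol_times c2 (dil n A))
    (fun i => c1 *~ hconst (pdim A) i + (lebv A *: c2) *+ eul (pdim A) i).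
Proof.
move=> pA A0.
apply: hrep_eq (hrepD (hrep_const _ _) (hrep_exp _ _)) => n.
rewrite chi1; last exact: dil_nonempty.
congr (_ + _); rewrite /vol_times lebv_dil// -natrX -scalerA scaler_nat.
have := pdim_max A; rewrite leq_eqVlt => /predU1P[->//|Ad].
by rewrite lebv_lower// scale0r !mul0rn.
Qed.

Lemma euler_vol_valuation (c : G * G) : valuation (euler_vol d c).
Proof.
have [chi_0 chiU chiT] := @chi_valuation R d _ c.1.
have [vol_0 volU volT] := @vol_times_valuation R d _ c.2.
split.
- by rewrite euler_volE chi_0 vol_0 addr0.
- move=> P Q U I UE IE; rewrite !euler_volE UE IE addrACA.
  have pU := psetP U; rewrite UE in pU.
  by rewrite chiU ?volU//; [rewrite addrACA|exact: psetP..].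
- by move=> t P; rewrite !euler_volE chiT ?volT//; exact: psetP.
Qed.

Lemma euler_vol_monotone c1 c2 : C c1 -> C c2 ->
  weakly_hmonotone C (euler_vol d (c1, c2)).
Proof.
move=> C1 C2; split.
  rewrite /cone_le subr0 euler_volE/=; apply: coneD => //.
    by rewrite chi1//; exists 0.
  by apply: coneZ => //; exact: lebv_ge0.
move=> P Q P0 PQ dPQ i; rewrite /cone_le.
have Q0 : Defs.pset Q !=set0 by case: P0 => x /PQ; exists x.
have hr T : Defs.pset T !=set0 -> hrep (pdim T)
    (fun n => setval (euler_vol d (c1, c2)) (dil n T))
    (fun i => c1 *~ hconst (pdim T) i + (lebv T *: c2) *+ eul (pdim T) i).
  move=> T0; apply: hrep_eq (euler_vol_hrep c1 c2 (psetP T) T0) => n.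
  by rewrite -[dil n T]/(Defs.pset (dilate n T)) setvalE.
rewrite (hvectorE i (hr P P0)) (hvectorE i (hr Q Q0)) -dPQ.
case: ifP => _; last by rewrite subrr; exact: cone0.
rewrite opprD addrACA subrr add0r -mulrnBl -scalerBl.
apply: (coneMn Ccone); apply: (coneZ Ccone) => //; rewrite subr_ge0.
by apply: le_lebv => //; exact: psetP.
Qed.

Section Forward.
Variable phi : polytope R d -> G.
Hypotheses (phiV : valuation phi) (phiM : weakly_hmonotone C phi).

Let c1 := phi (poly1 0).

Let mu A := setval phi A - chi c1 A.

Lemma reduced_valuation : set_valuation mu.
Proof.
have : set_valuation (fun A => 1 *: setval phi A + (- 1) *: chi c1 A).
  by apply: set_valuation_comb; [exact: setval_valuation|exact: chi_valuation].
by congr set_valuation; apply/funext => A; rewrite scale1r scaleN1r.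
Qed.

Lemma reduced_hmono : hmono C mu.
Proof.
move=> P Q h k pP pQ P0 PQ dPQ hP kQ i iP.
have Q0 : Q !=set0 by case: P0 => x /PQ; exists x.
have id : (i < d.+1)%N by rewrite ltnS (leq_trans iP)// pdim_max.
have lift T (g : nat -> G) : T !=set0 -> hrep (pdim T) (fun n => mu (dil n T)) g ->
    hrep (pdim T) (fun n => setval phi (dil n T)) (fun i => g i + c1 *~ hconst (pdim T) i).
  move=> T0 gT; apply: hrep_eq (hrepD gT (hrep_const (pdim T) c1)) => n.
  by rewrite /mu chi1 ?subrK//; exact: dil_nonempty.
have [_ /(_ (Polytope pP) (Polytope pQ) P0 PQ dPQ (Ordinal id))] := phiM.
rewrite /cone_le (@hvectorE _ _ _ phi (Polytope pP) _ _ (lift P h P0 hP)).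
rewrite (@hvectorE _ _ _ phi (Polytope pQ) _ _ (lift Q k Q0 kQ))/= -dPQ iP.
by rewrite opprD addrACA subrr addr0.
Qed.

Lemma reduced_point : vanish_below mu 1.
Proof.
move=> A pA; rewrite ltnS leqn0 => /eqP A0.
have [mu0' _ _] := reduced_valuation.
have [->//|/set0P An] := eqVneq A set0.
have [x AE] := pdim0 A0 An; have [_ _ phiT] := phiV.
rewrite /mu chi1// AE -[set1 x]/(Defs.pset (poly1 x)) setvalE /c1 -(phiT x (poly1 0)).
rewrite (_ : translate x (poly1 0) = poly1 x) ?subrr//.
by apply: polytope_eq; rewrite /= image_set1 addr0.
Qed.

Lemma reduced_vanish r : (0 < r)%N -> (r <= d)%N -> vanish_below mu r.
Proof.
elim: r => // r IH _ rd; have [->|r0] := posnP r; first exact: reduced_point.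
apply: (vanish_step Ccone Cptd Ccl reduced_valuation reduced_hmono) => //.
exact/IH/ltnW.
Qed.

Lemma monotone_euler_vol : exists c1 c2, [/\ C c1, C c2 & phi = euler_vol d (c1, c2)].
Proof.
have C1 : C c1 by have [] := phiM; rewrite /cone_le subr0.
have [d0|d0] := posnP d.
  exists c1, 0; split=> //; first exact: cone0.
  apply/funext => P; rewrite euler_volE/= /vol_times scaler0 addr0.
  rewrite -setvalE -[LHS](subrK (chi c1 P)) -/(mu P) reduced_point ?add0r//.
    exact: psetP.
  by rewrite ltnS; apply: leq_trans (pdim_max _) _; rewrite d0.
have mud := reduced_vanish d0 (leqnn d).
have muS : simple_val mu.
  move=> A a b pA a0 Aab; apply: mud => //.
  have <- : affim 0 1%:M A = A.
    apply/seteqP; split => x; first by move=> [y Ay <-]; rewrite add0r mulmx1.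
    by move=> Ax; exists x; rewrite // add0r mulmx1.
  exact: pdim_affim_hyperplane Aab.
have mup : positive C mu.
  move=> A pA; apply: (val_pos Ccone reduced_valuation reduced_hmono d0 mud) => //.
  exact: pdim_max.
exists c1, (mu (box (fun=> 1))); split=> //.
  by apply: mup; exact: is_polytope_box.
apply/funext => P; rewrite euler_volE/= /vol_times.
rewrite -(simple_positive_volume Ccone Cptd Ccl reduced_valuation muS mup (psetP P)).
by rewrite /mu addrC subrK setvalE.
Qed.

End Forward.

Lemma weakly_hmonotoneP phi : weakly_hmonotone_valuations d C phi <->
  exists c1 c2, [/\ C c1, C c2 & phi = euler_vol d (c1, c2)].
Proof.
split; first by move=> [phiV phiM]; exact: monotone_euler_vol.
move=> [c1 [c2 [C1 C2 ->]]]; split; first exact: euler_vol_valuation.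
exact: euler_vol_monotone.
Qed.

Lemma euler_volD (x y : G * G) : euler_vol d (x + y) = euler_vol d x + euler_vol d y.
Proof. by apply/funext => P; rewrite /euler_vol/= !scalerDr addrACA. Qed.

Lemma euler_volZ a (x : G * G) : euler_vol d (a *: x) = a *: euler_vol d x.
Proof.
apply/funext => P; rewrite /euler_vol/= -[RHS]/(a *: (_ + _)) scalerDr !scalerA.
by rewrite ![a * _]mulrC.
Qed.

Lemma euler_vol_inj : (0 < d)%N -> injective (@euler_vol R d G).
Proof.
move=> d0 [c1 c2] [e1 e2] E.
have pt0 g : vol_times g [set (0 : 'rV[R]_d)] = 0 :> G.
  by rewrite /vol_times lebv_lower ?scale0r//; [exact: is_polytope1|rewrite pdim_set1].
have E1 : c1 = e1.
  have := congr1 (fun f : polytope R d -> G => f (poly1 0)) E.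
  rewrite /= !euler_volE/= !pt0 !addr0 !chi1//; by exists 0.
have := congr1 (fun f : polytope R d -> G => f (Polytope (is_polytope_cube d 0 1))) E.
rewrite /= !euler_volE/= E1 => /addrI; rewrite /vol_times lebv_cube// subr0 expr1n.
by rewrite !scale1r => ->.
Qed.

End Characterization.

Theorem theorem6p6 (R : realType) (d : nat) (G : vectType R) (C : set G)
    (C_cone : convex_cone C) (C_pointed : pointed_cone C)
    (C_closed : vect_closed C) :
  [/\ forall phi : polytope R d -> G,
        weakly_hmonotone_valuations d C phi <->
        exists c1 c2 : G, [/\ C c1, C c2 & phi = euler_vol d (c1, c2)],
      convex_cone (weakly_hmonotone_valuations d C) &
      (0 < d)%N ->
        cone_isomorphism (C `*` C) (weakly_hmonotone_valuations d C)
          (euler_vol d)].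
Proof.
have charP := weakly_hmonotoneP C_cone C_pointed C_closed.
split; first exact: charP.
- split.
  + apply/charP; exists 0, 0; split; [exact: cone0|exact: cone0|].
    by apply/funext => P; rewrite /euler_vol/= !scaler0 addr0.
  + move=> _ _ /charP[x1 [x2 [Cx1 Cx2 ->]]] /charP[y1 [y2 [Cy1 Cy2 ->]]].
    apply/charP; exists (x1 + y1), (x2 + y2); split; [exact: coneD|exact: coneD|].
    by rewrite -euler_volD.
  + move=> a _ a0 /charP[x1 [x2 [Cx1 Cx2 ->]]].
    apply/charP; exists (a *: x1), (a *: x2); split; [exact: coneZ|exact: coneZ|].
    by rewrite -euler_volZ.
- move=> d0; split.
  + split.
    * by move=> [c1 c2] [Cc1 Cc2]; apply/charP; exists c1, c2.
    * by move=> x y _ _; exact: euler_vol_inj.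
    * by move=> phi /charP[c1 [c2 [Cc1 Cc2 ->]]]; exists (c1, c2).
  + by move=> x y _ _; exact: euler_volD.
  + by move=> a x _ _; exact: euler_volZ.
Qed.
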